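(* There does not exist an $SU(2)$ Bogomolny monopole of charge $6$ with icosahedral symmetry, i.e. there is no charge $6$ monopole on $\mathbf R^3$ that is invariant under the group (of order 60) of rotational symmetries of a regular icosahedron in $\mathbf R^3$.
   Context: Consider pairs $(A,\phi)$ on $\mathbf R^3$, where $A$ is an $\mathfrak{su}(2)$-valued connection 1-form and $\phi:\mathbf R^3\to\mathfrak{su}(2)$ (the Higgs field), with curvature $F_A=dA+A\wedge A$ and $\nabla_A\phi=d\phi+[A,\phi]$. A monopole of charge $k\ge 1$ is a gauge equivalence class (under maps $g:\mathbf R^3\to SU(2)$, acting by $(gAg^{-1}-dg\,g^{-1},\,g\phi g^{-1})$) of smooth solutions of the Bogomolny equation $\star F_A=\nabla_A\phi$ with finite energy $\int(|F_A|^2+|\nabla_A\phi|^2)\,d^3x$ and satisfying the standard boundary conditions $|\phi|=1-\frac{k}{2r}+O(r^{-2})$, $\partial|\phi|/\partial\Omega=O(r^{-2})$ (angular derivatives), $|\nabla_A\phi|=O(r^{-2})$ as $r\to\infty$, where the norm on $\mathfrak{su}(2)$ is such that $|\mathrm{diag}(i,-i)|=1$; $k$ is the degree of $\phi$ at infinity as a map from $S^2_\infty$ to the unit sphere of $\mathfrak{su}(2)$. A monopole is invariant under a group of rotations of $\mathbf R^3$ if the pull-back of $(A,\phi)$ by each rotation in the group is gauge equivalent to $(A,\phi)$. *)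

(* Defs.v *)
From HB Require Import structures.
From mathcomp Require Import all_boot all_order all_algebra spectral.
From mathcomp Require Import complex.
From mathcomp Require Import all_classical all_reals all_analysis.

Set Implicit Arguments.
Unset Strict Implicit.
Unset Printing Implicit Defensive.

Import Order.TTheory GRing.Theory Num.Theory.
Import numFieldNormedType.Exports.

Local Open Scope classical_set_scope.
Local Open Scope ring_scope.
Local Open Scope complex_scope.
Local Open Scope sesquilinear_scope.

(* Components of one-forms and points of R^3 are indexed by 'I_3, i.e. the
   integers mod 3, so (i, i + 1, i + 2) is always an even permutation of the
   axes. *)

Section Euclidean.
Variable R : realType.
Implicit Types (x : 'rV[R]_3) (f : 'rV[R]_3 -> R).

Definition row3 (a b c : R) : 'rV[R]_3 := \row_(i < 3) nth 0 [:: a; b; c] i.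

(* The norm `|x| of the library on 'rV[R]_3 is the sup norm. *)
Definition enorm x : R := Num.sqrt (\sum_i x 0 i ^+ 2).

Definition partial (i : 'I_3) f : 'rV[R]_3 -> R :=
  fun x => 'D_(delta_mx 0 i) f x.

Definition smooth f : Prop :=
  forall s : seq 'I_3, let g := foldr partial f s in
    continuous g /\ forall x i, derivable g x (delta_mx 0 i).

(* f = O(r^-2) as r -> oo, uniformly in all directions. *)
Definition bigO_rm2 f : Prop :=
  exists C r0 : R, 0 < r0 /\
    forall x, r0 <= enorm x -> `|f x| <= C / enorm x ^+ 2.

(* The rotation field x_{i+1} d_{i+2} - x_{i+2} d_{i+1}.  Restricted to the
   sphere of radius r, the three fields are independent of r in angular
   coordinates and span the derivatives with respect to these. *)
Definition angular_derivative (i : 'I_3) f : 'rV[R]_3 -> R :=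
  fun x => x 0 (i + 1) * partial (i + 2%:R) f x
           - x 0 (i + 2%:R) * partial (i + 1) f x.

Definition integral_R3 (f : 'rV[R]_3 -> R) : \bar R :=
  (\int[((lebesgue_measure \x lebesgue_measure) \x lebesgue_measure)%E]_p
     (f (row3 p.1.1 p.1.2 p.2))%:E)%E.

Definition sphere_point (t u : R) : 'rV[R]_3 :=
  row3 (sin t * cos u) (sin t * sin u) (cos t).

(* Degree of the self-map x |-> f x of the oriented unit sphere, as the
   normalised integral of the pulled back area form n . (dn x dn) / 2; the
   chart (t, u) is compatible with the outward orientation. *)
Definition sphere_degree (f : 'rV[R]_3 -> 'rV[R]_3) : R :=
  (4 * pi)^-1 *
  \int[lebesgue_measure]_(t in `[0, pi])
    \int[lebesgue_measure]_(u in `[0, 2 * pi])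
      \det (\matrix_(i < 3) nth 0
        [:: f (sphere_point t u);
            derive1 (fun t' => f (sphere_point t' u)) t;
            derive1 (fun u' => f (sphere_point t u')) u] i).

End Euclidean.

Section Gauge.
Variable R : realType.
Local Notation M2 := 'M[R[i]]_2.
Implicit Types (X : M2) (F : 'rV[R]_3 -> M2) (A : 'I_3 -> 'rV[R]_3 -> M2).

Definition su2 X : Prop := X ^t* = - X /\ \tr X = 0.

Definition SU2 X : Prop := X \is unitarymx /\ \det X = 1.

(* Normalised so that diag(i, -i) has norm 1. *)
Definition su2_norm X : R := Num.sqrt (complex.Re (\tr (X *m X ^t*)) / 2).

(* Coordinates of su(2) in the orthonormal basis i sigma_1, i sigma_2,
   i sigma_3 (sigma_a the Pauli matrices).  Its orientation fixes the sign of
   the degree of the Higgs field: it is the one for which solutions of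
   *F = D phi with |phi| = 1 - k/2r + O(r^-2) have degree k, rather than -k. *)
Definition su2_coord X : 'rV[R]_3 :=
  row3 (complex.Im (X 0 1)) (complex.Re (X 0 1)) (complex.Im (X 0 0)).

(* R[i] has no normed module structure over R in the library, so derivatives
   are taken on real and imaginary parts of the entries. *)
Definition mx_smooth F : Prop := forall a b,
  smooth (fun x => complex.Re (F x a b)) /\
  smooth (fun x => complex.Im (F x a b)).

Definition mx_partial (i : 'I_3) F : 'rV[R]_3 -> M2 := fun x =>
  \matrix_(a, b) (partial i (fun y => complex.Re (F y a b)) x +i*
                  partial i (fun y => complex.Im (F y a b)) x).

Definition lie_bracket X Y : M2 := X *m Y - Y *m X.

(* The connection one-form is A = sum_i A_i dx_i. *)
Record configuration := Configuration {
  connection : 'I_3 -> 'rV[R]_3 -> M2;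
  higgs : 'rV[R]_3 -> M2 }.

Definition curvature A (i j : 'I_3) : 'rV[R]_3 -> M2 := fun x =>
  mx_partial i (A j) x - mx_partial j (A i) x + lie_bracket (A i x) (A j x).

Definition hodge_star (F : 'I_3 -> 'I_3 -> 'rV[R]_3 -> M2) (i : 'I_3) :
    'rV[R]_3 -> M2 :=
  F (i + 1) (i + 2%:R).

Definition cov_derivative A F (i : 'I_3) : 'rV[R]_3 -> M2 := fun x =>
  mx_partial i F x + lie_bracket (A i x) (F x).

Definition oneform_norm A : 'rV[R]_3 -> R := fun x =>
  Num.sqrt (\sum_i su2_norm (A i x) ^+ 2).

Definition twoform_norm (F : 'I_3 -> 'I_3 -> 'rV[R]_3 -> M2) : 'rV[R]_3 -> R :=
  fun x => Num.sqrt (\sum_(i < 3) \sum_(j < 3 | (i < j)%N)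
                       su2_norm (F i j x) ^+ 2).

Definition gauge_transform (g : 'rV[R]_3 -> M2) (c : configuration) :
    configuration :=
  Configuration
    (fun i x => g x *m connection c i x *m invmx (g x)
                - mx_partial i g x *m invmx (g x))
    (fun x => g x *m higgs c x *m invmx (g x)).

Definition gauge_equivalent (c c' : configuration) : Prop :=
  exists g : 'rV[R]_3 -> M2,
    [/\ mx_smooth g, forall x, SU2 (g x) & c' = gauge_transform g c].

Definition smooth_configuration (c : configuration) : Prop :=
  (forall i, mx_smooth (connection c i) /\
     forall x, su2 (connection c i x)) /\
  (mx_smooth (higgs c) /\ forall x, su2 (higgs c x)).

Definition bogomolny (c : configuration) : Prop :=
  forall i x, hodge_star (curvature (connection c)) i x =
              cov_derivative (connection c) (higgs c) i x.

Definition finite_energy (c : configuration) : Prop :=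
  (integral_R3 (fun x =>
     (twoform_norm (curvature (connection c)) x ^+ 2 +
      oneform_norm (cov_derivative (connection c) (higgs c)) x ^+ 2)%R)
   < +oo)%E.

Definition boundary_conditions (k : nat) (c : configuration) : Prop :=
  [/\ bigO_rm2 (fun x =>
        su2_norm (higgs c x) - (1 - k%:R / (2 * enorm x))),
      forall i, bigO_rm2
        (angular_derivative i (fun x => su2_norm (higgs c x))) &
      bigO_rm2 (oneform_norm (cov_derivative (connection c) (higgs c)))].

(* The boundary conditions make phi / |phi| well defined on all large
   spheres. *)
Definition degree_at_infinity (k : nat) (c : configuration) : Prop :=
  \forall r \near +oo,
    sphere_degree (fun x => (su2_norm (higgs c (r *: x)))^-1 *:
                            su2_coord (higgs c (r *: x))) = k%:R.

Definition monopole_solution (k : nat) (c : configuration) : Prop :=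
  [/\ smooth_configuration c, bogomolny c, finite_energy c,
      boundary_conditions k c & degree_at_infinity k c].

Definition monopole (k : nat) (m : set configuration) : Prop :=
  (0 < k)%N /\
  exists2 c, monopole_solution k c & m = [set c' | gauge_equivalent c c'].

End Gauge.

Section Symmetry.
Variable R : realType.
Implicit Types (x a : 'rV[R]_3) (V : set 'rV[R]_3).

(* A pair (Q, a) stands for the map x |-> x Q + a; the translation part is
   needed for rotations about a point other than the origin. *)
Definition motion (q : 'M[R]_3 * 'rV[R]_3) x : 'rV[R]_3 := x *m q.1 + q.2.

Definition proper_motion (q : 'M[R]_3 * 'rV[R]_3) : Prop :=
  q.1 *m q.1^T = 1%:M /\ \det q.1 = 1.

(* As y = x Q + a has dy_j = sum_i Q_ij dx_i, the i-th component of the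
   pulled back form is sum_j Q_ij (A_j o motion). *)
Definition pullback (q : 'M[R]_3 * 'rV[R]_3) (c : configuration R) :
    configuration R :=
  Configuration
    (fun i x => \sum_j (q.1 i j)%:C *: connection c j (motion q x))
    (fun x => higgs c (motion q x)).

Definition invariant_under (G : set ('M[R]_3 * 'rV[R]_3))
    (m : set (configuration R)) : Prop :=
  forall q c, G q -> m c -> gauge_equivalent c (pullback q c).

Definition golden_ratio : R := (1 + Num.sqrt 5) / 2.

(* (0, +-1, +-tau) and their cyclic permutations. *)
Definition icosahedron_vertices : set 'rV[R]_3 :=
  [set x | exists i : 'I_3,
     [/\ x 0 i = 0, `|x 0 (i + 1)| = 1 & `|x 0 (i + 2%:R)| = golden_ratio]].

Definition convex_hull V : set 'rV[R]_3 :=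
  smallest (fun W => convex_set W) V.

Definition regular_icosahedron V : Prop :=
  exists (s : R) (Q : 'M[R]_3) (a : 'rV[R]_3),
    [/\ 0 < s, Q *m Q^T = 1%:M &
        V = (fun x => s *: (x *m Q) + a) @` convex_hull icosahedron_vertices].

Definition rotational_symmetries V : set ('M[R]_3 * 'rV[R]_3) :=
  [set q | proper_motion q /\ motion q @` V = V].

End Symmetry.

(* Main.v *)
(** The half-turns of the icosahedron about the axes of a suitable frame form,
with the identity, a Klein four-group normalised by a rotation of order three;
this tetrahedral symmetry is already impossible.

In quaternionic notation the normalised Higgs field on a large sphere is a map
n = psi I psi^-1 to the imaginary units.  The lift psi is constant at one pole
and winds D times around the circle exp(I b) at the other; integrating the area
form, which is exact in terms of psi, identifies D with the degree 6.

A gauge transformation relating the fields to their pull-back by a motion is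
unique up to sign: two of them differ by a covariantly constant endomorphism
commuting with phi, whose imaginary part, if nonzero, would extend phi / |phi|
from the sphere to the ball and make the degree zero.  Hence the transformations
g_a, g_b over the half-turns a, b satisfy g_a^2 = g_b^2 = e and
g_a g_b = e g_b g_a with one sign e, by the rotation of order three.  Comparing
the phases of psi over a and b gives e = exp(-I pi D) = 1, so that g_a, g_b can
be taken to be 1 at the centre, hence on the axes; then the same phases give
exp(-I pi D / 2) = 1, which is false for D = 6. *)

From HB Require Import structures.
Require Import Defs.
From mathcomp Require Import all_boot all_order all_algebra.
From mathcomp Require Import complex spectral.
From mathcomp Require Import all_classical all_reals all_analysis.
From mathcomp Require Import ring lra.

Set Implicit Arguments.
Unset Strict Implicit.
Unset Printing Implicit Defensive.

Import Order.TTheory GRing.Theory Num.Theory.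
Import numFieldNormedType.Exports.

Local Open Scope classical_set_scope.
Local Open Scope ring_scope.

(** * Quaternions *)

(** The arithmetic behind the two phase identities: the eigenlines of phi on a large sphere form a
    line bundle of degree D, on which the lifted Klein group acts once e = 1. If each half-turn acts
    trivially on the fibres over its fixed points, the bundle descends to the quotient sphere with
    degree D / 4, so 4 divides D, which fails for 6. The fibre actions are trivial because on its
    own axis a lift is a square root of 1, whose sign cannot change between the centre, where the
    axes meet, and the sphere.

    Two obstacles shape the proof. As D is nonzero, n has no lift on the whole sphere; everything
    takes place in the chart (t, u), with a lift that may disagree with itself along the pole t =
    pi, and the recurring argument is that a continuous real function with constant exponential is
    constant. Also, the icosahedron may have any centre and orientation, whereas the degree is given
    on spheres about the origin: the frame is chosen so that a straight-line homotopy between the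
    two charted spheres stays where phi does not vanish. *)

Section Quaternions.
Variable R : realType.

Record quat := Quat { qre : R; qi : R; qj : R; qk : R }.

Implicit Types (a b c : quat) (r s : R).

Lemma quatP a b :
  [/\ qre a = qre b, qi a = qi b, qj a = qj b & qk a = qk b] -> a = b.
Proof. by case: a => ????; case: b => ???? /= [-> -> -> ->]. Qed.

(** Transports the choice structure of [R * R * R * R] to [quat], on which the ring structure is
    built. *)
Definition quat_tuple a := (qre a, qi a, qj a, qk a).
Definition tuple_quat (x : R * R * R * R) := Quat x.1.1.1 x.1.1.2 x.1.2 x.2.

Lemma quat_tupleK : cancel quat_tuple tuple_quat.
Proof. by case. Qed.

HB.instance Definition _ := Choice.copy quat (can_type quat_tupleK).

Definition qadd a b :=
  Quat (qre a + qre b) (qi a + qi b) (qj a + qj b) (qk a + qk b).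
Definition qopp a := Quat (- qre a) (- qi a) (- qj a) (- qk a).
Definition qzero := Quat 0 0 0 0.
Definition qone := Quat 1 0 0 0.
Definition qmul a b :=
  Quat (qre a * qre b - qi a * qi b - qj a * qj b - qk a * qk b)
       (qre a * qi b + qi a * qre b + qj a * qk b - qk a * qj b)
       (qre a * qj b - qi a * qk b + qj a * qre b + qk a * qi b)
       (qre a * qk b + qi a * qj b - qj a * qi b + qk a * qre b).

Fact qaddA : associative qadd.
Proof. by move=> a b c; apply: quatP; split; rewrite /= addrA. Qed.
Fact qaddC : commutative qadd.
Proof. by move=> a b; apply: quatP; split; rewrite /= addrC. Qed.
Fact qadd0 : left_id qzero qadd.
Proof. by move=> a; apply: quatP; split; rewrite /= add0r. Qed.
Fact qaddN : left_inverse qzero qopp qadd.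
Proof. by move=> a; apply: quatP; split; rewrite /= addNr. Qed.

HB.instance Definition _ :=
  GRing.isZmodule.Build quat qaddA qaddC qadd0 qaddN.

Fact qmulA : associative qmul.
Proof. by move=> a b c; apply: quatP; split; rewrite /=; ring. Qed.
Fact qmul1 : left_id qone qmul.
Proof. by move=> a; apply: quatP; split; rewrite /=; ring. Qed.
Fact qmulr1 : right_id qone qmul.
Proof. by move=> a; apply: quatP; split; rewrite /=; ring. Qed.
Fact qmulDl : left_distributive qmul qadd.
Proof. by move=> a b c; apply: quatP; split; rewrite /=; ring. Qed.
Fact qmulDr : right_distributive qmul qadd.
Proof. by move=> a b c; apply: quatP; split; rewrite /=; ring. Qed.
Fact qone_neq0 : qone != qzero.
Proof. by apply/eqP => -[]/eqP; rewrite oner_eq0. Qed.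

HB.instance Definition _ := GRing.Zmodule_isNzRing.Build quat
  qmulA qmul1 qmulr1 qmulDl qmulDr qone_neq0.

Definition qR r := Quat r 0 0 0.
Definition qI := Quat 0 1 0 0.
Definition qJ := Quat 0 0 1 0.
Definition qconj a := Quat (qre a) (- qi a) (- qj a) (- qk a).
Definition qdot a b := qre a * qre b + qi a * qi b + qj a * qj b + qk a * qk b.

Lemma reM a b : qre (a * b) =
  qre a * qre b - qi a * qi b - qj a * qj b - qk a * qk b. Proof. by []. Qed.
Lemma iM a b : qi (a * b) =
  qre a * qi b + qi a * qre b + qj a * qk b - qk a * qj b. Proof. by []. Qed.
Lemma jM a b : qj (a * b) =
  qre a * qj b - qi a * qk b + qj a * qre b + qk a * qi b. Proof. by []. Qed.
Lemma kM a b : qk (a * b) =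
  qre a * qk b + qi a * qj b - qj a * qi b + qk a * qre b. Proof. by []. Qed.
Lemma reD a b : qre (a + b) = qre a + qre b. Proof. by []. Qed.
Lemma iD a b : qi (a + b) = qi a + qi b. Proof. by []. Qed.
Lemma jD a b : qj (a + b) = qj a + qj b. Proof. by []. Qed.
Lemma kD a b : qk (a + b) = qk a + qk b. Proof. by []. Qed.
Lemma reN a : qre (- a) = - qre a. Proof. by []. Qed.
Lemma iN a : qi (- a) = - qi a. Proof. by []. Qed.
Lemma jN a : qj (- a) = - qj a. Proof. by []. Qed.
Lemma kN a : qk (- a) = - qk a. Proof. by []. Qed.
Lemma quat1 : (1 : quat) = Quat 1 0 0 0. Proof. by []. Qed.
Lemma quat0 : (0 : quat) = Quat 0 0 0 0. Proof. by []. Qed.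

Definition qE := (reM, iM, jM, kM, reD, iD, jD, kD, reN, iN, jN, kN,
                  quat1, quat0).

Definition qunit a := qdot a a = 1.
Definition qimag a := qre a = 0.
(* The complex numbers w + x I. *)
Definition qcplx a := qj a = 0 /\ qk a = 0.

Lemma qconjM a b : qconj (a * b) = qconj b * qconj a.
Proof. by apply: quatP; split; rewrite /=; ring. Qed.

Lemma qmul_conj a : qunit a -> a * qconj a = 1.
Proof. by rewrite /qunit /qdot => h; apply: quatP; split; rewrite /= -?h; ring. Qed.

Lemma qconj_mul a : qunit a -> qconj a * a = 1.
Proof. by rewrite /qunit /qdot => h; apply: quatP; split; rewrite /= -?h; ring. Qed.

Lemma qdotM a b : qdot (a * b) (a * b) = qdot a a * qdot b b.
Proof. by rewrite /qdot !qE; ring. Qed.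

Lemma qunitM a b : qunit a -> qunit b -> qunit (a * b).
Proof. by rewrite /qunit qdotM => -> ->; rewrite mulr1. Qed.

Lemma qunit_conj a : qunit a -> qunit (qconj a).
Proof. by rewrite /qunit /qdot /= => <-; ring. Qed.

Lemma qunitN a : qunit a -> qunit (- a).
Proof. by rewrite /qunit /qdot !qE => <-; ring. Qed.

Lemma qunit1 : qunit 1.
Proof. by rewrite /qunit /qdot !qE /=; ring. Qed.

Lemma qunitI : qunit qI.
Proof. by rewrite /qunit /qdot /=; ring. Qed.

Lemma qmulIl a b c : qunit a -> a * b = a * c -> b = c.
Proof.
by move=> ha e; rewrite -[b]mul1r -(qconj_mul ha) -mulrA e mulrA qconj_mul ?mul1r.
Qed.

Lemma qmulIr a b c : qunit a -> b * a = c * a -> b = c.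
Proof.
by move=> ha e; rewrite -[b]mulr1 -(qmul_conj ha) mulrA e -mulrA qmul_conj ?mulr1.
Qed.

Lemma qdotC a b : qdot a b = qdot b a.
Proof. by rewrite /qdot; ring. Qed.

Lemma qdotMl c a b : qdot (c * a) (c * b) = qdot c c * qdot a b.
Proof. by rewrite /qdot !qE; ring. Qed.

(** The squared distance of two unit quaternions is 2 - 2 <a, b>. *)
Lemma qdot_eq1 a b : qunit a -> qunit b -> qdot a b = 1 -> a = b.
Proof.
rewrite /qunit => ha hb hab.
have h : qdot (a - b) (a - b) = 0.
  have -> : qdot (a - b) (a - b) = qdot a a + qdot b b - 2 * qdot a b.
    by rewrite /qdot !qE; ring.
  by rewrite ha hb hab; ring.
have : qre (a - b) = 0 /\ qi (a - b) = 0 /\ qj (a - b) = 0 /\ qk (a - b) = 0.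
  have h0 (x : R) : 0 <= x * x by rewrite -expr2 sqr_ge0.
  move: h; rewrite /qdot; set x := qre _; set y := qi _; set z := qj _; set w := qk _.
  move=> h; have := h0 x; have := h0 y; have := h0 z; have := h0 w => hw hz hy hx.
  by do ?split; apply/eqP; rewrite -sqrf_eq0 expr2; apply/eqP; lra.
rewrite !qE => -[h1[h2[h3 h4]]].
by apply: quatP; split; apply/eqP; rewrite -subr_eq0; apply/eqP.
Qed.

Lemma qdot_eqN1 a b : qunit a -> qunit b -> qdot a b = -1 -> a = - b.
Proof.
move=> ha hb h; apply: qdot_eq1 => //; first exact: qunitN.
have -> : qdot a (- b) = - qdot a b by rewrite /qdot !qE; ring.
by rewrite h opprK.
Qed.

Lemma qimag_sqr a : qunit a -> qimag a -> a * a = - 1.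
Proof.
rewrite /qunit /qimag /qdot => h h0; rewrite h0 in h.
by apply: quatP; split; rewrite /= ?h0; try ring; move: h; lra.
Qed.

Lemma qcplxM a b : qcplx a -> qcplx b -> qcplx (a * b).
Proof. by move=> [h1 h2] [h3 h4]; split; rewrite /= h1 h2 h3 h4; ring. Qed.

Lemma qcplx_conj a : qcplx a -> qcplx (qconj a).
Proof. by move=> [h1 h2]; split; rewrite /= ?h1 ?h2 oppr0. Qed.

Lemma qcplxC a b : qcplx a -> qcplx b -> a * b = b * a.
Proof.
move=> [h1 h2] [h3 h4]; apply: quatP; split; rewrite /= h1 h2 h3 h4; ring.
Qed.

Lemma qcplx_commI a : a * qI = qI * a -> qcplx a.
Proof.
by move=> h; move: (congr1 qj h) (congr1 qk h); rewrite !qE /= => h1 h2; split; lra.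
Qed.

Definition qexp r := Quat (cos r) (sin r) 0 0.

Lemma qexpD r s : qexp (r + s) = qexp r * qexp s.
Proof. by apply: quatP; split; rewrite /= ?cosD ?sinD; ring. Qed.

Lemma qexp0 : qexp 0 = 1.
Proof. by apply: quatP; split; rewrite /= ?cos0 ?sin0. Qed.

Lemma qexpN r : qexp (- r) = qconj (qexp r).
Proof. by apply: quatP; split; rewrite /= ?cosN ?sinN ?oppr0. Qed.

Lemma qcplx_exp r : qcplx (qexp r).
Proof. by split. Qed.

Lemma qunit_exp r : qunit (qexp r).
Proof. by have := cos2Dsin2 r; rewrite /qunit /qdot /= => <-; ring. Qed.

(** The eigenvectors of [n] for [qI] form a fibre of the Hopf map: the quotient of two of them
    centralises [qI], hence is a complex number. This is why lifts are unique up to a phase. *)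
Lemma qcplx_ratio n a b :
  qunit a -> n * a = a * qI -> n * b = b * qI -> qcplx (qconj a * b).
Proof.
move=> ua na nb; apply: qcplx_commI.
apply: (qmulIl ua); rewrite !mulrA qmul_conj // mul1r -na -(mulrA n) qmul_conj //.
by rewrite mulr1 nb.
Qed.

End Quaternions.

(** * Continuity and lifts along paths *)

(** Pointwise continuity under a name, so that the tactic [cts] can decompose goals by their
    shape. *)
Definition rcts (S T : topologicalType) (f : S -> T) (x : S) :=
  {for x, continuous f}.

Section Continuity.
Variables (R : realType) (T : topologicalType).
Implicit Types (f g : T -> R) (F G : T -> quat R) (x : T).

Definition qcts F x := [/\ rcts (fun y => qre (F y)) x,
  rcts (fun y => qi (F y)) x, rcts (fun y => qj (F y)) x &
  rcts (fun y => qk (F y)) x].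

Lemma rcts_cst (r : R) x : rcts (fun=> r) x.
Proof. exact: cvg_cst. Qed.

Lemma rctsD f g x : rcts f x -> rcts g x -> rcts (fun y => f y + g y) x.
Proof. by move=> hf hg; apply: (@cvgD R _ _ _ _ f g _ _ hf hg). Qed.

Lemma rctsN f x : rcts f x -> rcts (fun y => - f y) x.
Proof. by move=> hf; apply: (@cvgN R _ _ _ _ f _ hf). Qed.

Lemma rctsB f g x : rcts f x -> rcts g x -> rcts (fun y => f y - g y) x.
Proof. by move=> hf /rctsN; exact: rctsD. Qed.

Lemma rctsM f g x : rcts f x -> rcts g x -> rcts (fun y => f y * g y) x.
Proof. by move=> hf hg; apply: (@cvgM R _ _ _ f g _ _ hf hg). Qed.

Lemma rcts_comp f (h : R -> R) x : rcts f x -> {for f x, continuous h} ->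
  rcts (fun y => h (f y)) x.
Proof. by move=> hf hh; apply: (continuous_comp hf hh). Qed.

Lemma rctsV f x : f x != 0 -> rcts f x -> rcts (fun y => (f y)^-1) x.
Proof. by move=> f0 hf; apply: cvgV. Qed.

Lemma rcts_sum n (f : 'I_n -> T -> R) x :
  (forall i, rcts (f i) x) -> rcts (fun y => \sum_i f i y) x.
Proof.
move=> h; elim: n f h => [|n IH] f h.
  by under [X in rcts X _]funext => y do rewrite big_ord0; exact: rcts_cst.
by under [X in rcts X _]funext => y do rewrite big_ord_recr; apply: rctsD => //; exact: IH.
Qed.

Lemma qcts_cst (q : quat R) x : qcts (fun=> q) x.
Proof. by split; exact: rcts_cst. Qed.

Lemma qctsD F G x : qcts F x -> qcts G x -> qcts (fun y => F y + G y) x.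
Proof. by move=> [? ? ? ?] [? ? ? ?]; split; exact: rctsD. Qed.

Lemma qctsN F x : qcts F x -> qcts (fun y => - F y) x.
Proof. by move=> [? ? ? ?]; split; exact: rctsN. Qed.

Lemma qctsB F G x : qcts F x -> qcts G x -> qcts (fun y => F y - G y) x.
Proof. by move=> ? /qctsN; exact: qctsD. Qed.

Lemma qctsM F G x : qcts F x -> qcts G x -> qcts (fun y => F y * G y) x.
Proof.
move=> [f0 f1 f2 f3] [g0 g1 g2 g3]; split.
- exact: (rctsB (rctsB (rctsB (rctsM f0 g0) (rctsM f1 g1)) (rctsM f2 g2)) (rctsM f3 g3)).
- exact: (rctsB (rctsD (rctsD (rctsM f0 g1) (rctsM f1 g0)) (rctsM f2 g3)) (rctsM f3 g2)).
- exact: (rctsD (rctsD (rctsB (rctsM f0 g2) (rctsM f1 g3)) (rctsM f2 g0)) (rctsM f3 g1)).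
- exact: (rctsD (rctsB (rctsD (rctsM f0 g3) (rctsM f1 g2)) (rctsM f2 g1)) (rctsM f3 g0)).
Qed.

Lemma qcts_conj F x : qcts F x -> qcts (fun y => qconj (F y)) x.
Proof. by move=> [? ? ? ?]; split=> //=; exact: rctsN. Qed.

Lemma rcts_dot F G x : qcts F x -> qcts G x -> rcts (fun y => qdot (F y) (G y)) x.
Proof. by move=> [? ? ? ?] [? ? ? ?]; repeat apply: rctsD; apply: rctsM. Qed.

Lemma qcts_real f x : rcts f x -> qcts (fun y => qR (f y)) x.
Proof. by move=> ?; split=> //=; exact: rcts_cst. Qed.

Definition qnormalize (q : quat R) := qR (Num.sqrt (qdot q q))^-1 * q.

Lemma qunit_normalize q : 0 < qdot q q -> qunit (qnormalize q).
Proof.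
move=> h; rewrite /qunit /qnormalize qdotM /qdot /=.
have -> : forall r : R, r * r + 0 * 0 + 0 * 0 + 0 * 0 = r * r by move=> r; ring.
have e : Num.sqrt (qdot q q) ^+ 2 = qdot q q by rewrite sqr_sqrtr ?ltW.
have e0 : Num.sqrt (qdot q q) != 0 by rewrite gt_eqF // sqrtr_gt0.
by rewrite -/(qdot q q) -{3}e; field.
Qed.

Lemma qcts_normalize F x : 0 < qdot (F x) (F x) -> qcts F x ->
  qcts (fun y => qnormalize (F y)) x.
Proof.
move=> h hF; apply: qctsM => //; apply: qcts_real; apply: rctsV.
  by rewrite gt_eqF // sqrtr_gt0.
by apply: (rcts_comp (rcts_dot hF hF)); exact: sqrt_continuous.
Qed.

End Continuity.

Lemma qcts_comp (R : realType) (S T : topologicalType) (F : T -> quat R)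
  (h : S -> T) (y : S) :
  rcts h y -> qcts F (h y) -> qcts (fun z => F (h z)) y.
Proof.
by move=> hh [? ? ? ?]; split; rewrite /rcts;
  [apply: (continuous_comp (g := fun z => qre (F z)) hh)
  |apply: (continuous_comp (g := fun z => qi (F z)) hh)
  |apply: (continuous_comp (g := fun z => qj (F z)) hh)
  |apply: (continuous_comp (g := fun z => qk (F z)) hh)].
Qed.

(** * Uniform step sizes over a compact set *)

Section SmallSteps.
Variables (R : realType) (T : topologicalType).

(** Uniform continuity in the path parameter: [compact_near_coveringP] turns continuity at each
    point of [0, 1] x K into one step size valid for all of them. *)
Lemma small_steps (K : set T) (F : R * T -> quat R) :
  compact K ->
  (forall (r : R) x, 0 <= r <= 1 -> K x -> qcts F (r, x)) ->
  exists2 N : nat, (0 < N)%N &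
  forall j x, (j < N)%N -> K x ->
    qdot (F (j.+1%:R / N%:R, x) - F (j%:R / N%:R, x))
         (F (j.+1%:R / N%:R, x) - F (j%:R / N%:R, x)) < 1.
Proof.
move=> cK hF.
pose P (e : R) (p : R * T) := forall r, `|r - p.1| < e ->
  qdot (F (r, p.2) - F p) (F (r, p.2) - F p) < 1.
have : compact ((`[0, 1]%classic : set R) `*` K : set (R * T)%type).
  by apply: compact_setX => //; exact: segment_compact.
move=> /compact_near_coveringP /(_ _ (0 : R)^'+ P _) [].
  move=> [r0 x0] [/= hr0 Kx0].
  have {hr0} : qcts F (r0, x0) by apply: hF => //; move: hr0; rewrite in_itv.
  move=> [h1 h2 h3 h4].
  (* Two values that are both within 1 / 8 of the limit in each component differ by a quaternion
     whose four squared components are each below 1 / 4. *)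
  have h18 : 0 < 1 / 8 :> R by lra.
  have nr : \forall p \near (r0, x0), [/\ `|qre (F (r0, x0)) - qre (F p)| < 1 / 8,
      `|qi (F (r0, x0)) - qi (F p)| < 1 / 8, `|qj (F (r0, x0)) - qj (F p)| < 1 / 8 &
      `|qk (F (r0, x0)) - qk (F p)| < 1 / 8].
    near=> p; split; near: p.
    - by move/cvgrPdist_lt: h1 => /(_ _ h18).
    - by move/cvgrPdist_lt: h2 => /(_ _ h18).
    - by move/cvgrPdist_lt: h3 => /(_ _ h18).
    - by move/cvgrPdist_lt: h4 => /(_ _ h18).
  case: nr => -[V1 V2] /= [/nbhs_ballP[e /= e0 he] hV2] hV.
  have e20 : 0 < e / 2 by rewrite divr_gt0.
  exists ([set p : R * T | ball r0 (e / 2) p.1 /\ V2 p.2], [set d | 0 < d < e / 2]).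
    split => /=.
      exists (ball r0 (e / 2), V2) => //=; split => //.
      exact: nbhsx_ballx.
    near=> d; apply/andP; split; near: d; first exact: nbhs_right_gt.
    exact: nbhs_right_lt.
  move=> [[r x] d] [/= [hr hx] /andP[d0 de]] r' /= hr'.
  have b1 : V1 r.
    by apply: he; apply: le_ball hr; rewrite ler_pdivrMr // ler_peMr ?ltW //; lra.
  have b2 : V1 r'.
    apply: he; rewrite /ball /= in hr *.
    rewrite -(subrKA r) (le_lt_trans (ler_normD _ _)) // (splitr e) ltrD //.
    by rewrite distrC (lt_trans hr').
  have [/=] := hV (r, x) (conj b1 hx); have [/=] := hV (r', x) (conj b2 hx).
  rewrite /qdot !qE.
  have aux (u v w : R) : `|u - v| < 1 / 8 -> `|u - w| < 1 / 8 ->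
     (v - w) * (v - w) < 1 / 4.
    rewrite !ltr_norml => /andP[? ?] /andP[? ?]; nra.
  move=> ? ? ? ? ? ? ? ?.
  have -> : 1 = 1 / 4 + 1 / 4 + 1 / 4 + 1 / 4 :> R by lra.
  by rewrite !ltrD ?(aux _ _ _) //; apply: aux; eassumption.
move=> e /= e0 he.
(* The covering is used with the radius e / 2, so the step 1 / N has to be smaller than that. *)
have [N hN] : exists N : nat, 2 / e < N%:R by exists (Num.bound (2 / e)); rewrite archi_boundP // divr_ge0 // ltW.
have N0 : 0 < N%:R :> R by rewrite (lt_trans _ hN) // divr_gt0.
exists N; first by rewrite -(ltr0n R).
move=> j x jN Kx.
have := he (e / 2); rewrite /= sub0r normrN gtr0_norm ?divr_gt0 //.
move=> /(_ _ _ (j%:R / N%:R, x)); apply.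
- by rewrite ltr_pdivrMr // ltr_pMr // ltr1n.
- by [].
- split => //=; rewrite in_itv /= divr_ge0 ?ler0n //= ler_pdivrMr // mul1r ler_nat.
  exact: ltnW.
- rewrite /= -mulrBl -natrB // subSnn mul1r gtr0_norm ?invr_gt0 //.
  rewrite invf_plt ?posrE ?divr_gt0 // invf_div //.
Unshelve. all: by end_near. Qed.

End SmallSteps.

Lemma pairr_continuous (S T : topologicalType) (r : S) (x : T) :
  rcts (fun y : T => (r, y)) x.
Proof. by apply: cvg_pair; [exact: cvg_cst|exact: cvg_id]. Qed.

Lemma pairl_continuous (S T : topologicalType) (y : T) (x : S) :
  rcts (fun x' : S => (x', y)) x.
Proof. by apply: cvg_pair; [exact: cvg_id|exact: cvg_cst]. Qed.

(** * Continuous logarithms and lifts through the Hopf fibration *)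

Section Phase.
Variables (R : realType) (T : topologicalType).
Implicit Types (K : set T).

(** Closeness to 1 keeps w in the right half-plane, where the argument is the [asin] of the
    imaginary part. *)
Lemma qexp_asin (w : quat R) : qunit w -> qcplx w -> qdot (w - 1) (w - 1) < 1 ->
  `|qi w| < 1 /\ qexp (asin (qi w)) = w.
Proof.
move=> + [hj hk]; rewrite /qunit /qdot !qE hj hk /= => h1 h2.
have re0 : 0 < qre w by move: h1 h2; nra.
have i1 : `|qi w| < 1 by rewrite ltr_norml; apply/andP; split; nra.
have iB : -1 <= qi w <= 1 by rewrite -ler_norml ltW.
split => //; apply: quatP; split => //=.
- rewrite cos_asin //; have -> : 1 - qi w ^+ 2 = qre w ^+ 2 by lra.
  by rewrite sqrtr_sqr gtr0_norm.
- by rewrite asinK // in_itv.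
Qed.

(** The path r -> z(r, x) is cut into steps so short that [asin] gives the logarithm of each ratio,
    and these are added up. Applied to a contraction of the parameter domain, this yields logarithms
    of phase functions on squares and segments. *)
Lemma phase_log K (z : R * T -> quat R) : compact K ->
  (forall (r : R) x, 0 <= r <= 1 -> K x ->
     [/\ qcts z (r, x), qunit (z (r, x)) & qcplx (z (r, x))]) ->
  exists b : T -> R, forall x, K x ->
    rcts b x /\ z (1, x) = z (0, x) * qexp (b x).
Proof.
move=> cK hz.
have [N N0 small] : exists2 N : nat, (0 < N)%N & forall j x, (j < N)%N -> K x ->
    qdot (z (j.+1%:R / N%:R, x) - z (j%:R / N%:R, x))
         (z (j.+1%:R / N%:R, x) - z (j%:R / N%:R, x)) < 1.
  by apply: small_steps => // r x r01 Kx; have [] := hz r x r01 Kx.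
have r01 j : (j <= N)%N -> 0 <= (j%:R / N%:R : R) <= 1.
  move=> jN; rewrite divr_ge0 ?ler0n //= ler_pdivrMr ?ltr0n // mul1r ler_nat //.
pose w j x := qconj (z (j%:R / N%:R, x)) * z (j.+1%:R / N%:R, x).
exists (fun x => \sum_(j < N) asin (qi (w j x))) => x Kx.
have hj j : (j < N)%N -> [/\ qcts (w j) x, `|qi (w j x)| < 1 &
    z (j.+1%:R / N%:R, x) = z (j%:R / N%:R, x) * qexp (asin (qi (w j x)))].
  move=> jN.
  have [c1 u1 k1] := hz _ x (r01 j (ltnW jN)) Kx.
  have [c2 u2 k2] := hz _ x (r01 j.+1 jN) Kx.
  have uw : qunit (w j x) by apply: qunitM => //; exact: qunit_conj.
  have kw : qcplx (w j x) by apply: qcplxM => //; exact: qcplx_conj.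
  have dw : qdot (w j x - 1) (w j x - 1) < 1.
    have <- : qconj (z (j%:R / N%:R, x)) *
      (z (j.+1%:R / N%:R, x) - z (j%:R / N%:R, x)) = w j x - 1.
      by rewrite mulrBr qconj_mul.
    by rewrite qdotM (qunit_conj u1) mul1r; exact: small.
  have [iw ew] := qexp_asin uw kw dw.
  split => //.
  - apply: qctsM; first apply: qcts_conj.
      by apply: (qcts_comp (h := fun y => (_, y)) (@pairr_continuous _ _ _ _)).
    by apply: (qcts_comp (h := fun y => (_, y)) (@pairr_continuous _ _ _ _)).
  - by rewrite ew /w mulrA qmul_conj // mul1r.
split.
- apply: rcts_sum => j; have [[_ c _ _] i1 _] := hj j (ltn_ord j).
  by apply: (rcts_comp c); apply: continuous_asin; rewrite -ltr_norml.
- have : forall m, (m <= N)%N -> z (m%:R / N%:R, x) =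
      z (0, x) * qexp (\sum_(j < m) asin (qi (w j x))).
    elim=> [_|m IH mN]; first by rewrite big_ord0 qexp0 mulr1 mul0r.
    have [_ _ ->] := hj m mN.
    by rewrite big_ord_recr /= qexpD mulrA -IH // ltnW.
  by move=> /(_ N (leqnn N)); rewrite divff // pnatr_eq0 -lt0n.
Qed.

(** For imaginary units, n (1 - n m) = n + m = (1 - n m) m, so this unit quaternion conjugates [m]
    to [n]; it is the rotation along the shorter arc, undefined only for n = - m. *)
Definition qstep (m n : quat R) := qnormalize (1 - n * m).

(** Discrete parallel transport along a sampled path of imaginary units. Being an explicit formula
    in the samples, it inherits their continuity, periodicity and differentiability in
    parameters. *)
Fixpoint transport (n : nat -> quat R) k : quat R :=
  if k is j.+1 then qstep (n j) (n k) * transport n j else 1.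

Lemma qstep_pos (m n : quat R) : qunit m -> qunit n -> qimag m -> qimag n ->
  qdot (n - m) (n - m) < 1 -> 0 < qdot (1 - n * m) (1 - n * m).
Proof.
rewrite /qunit /qimag /qdot !qE => h1 h2 h3 h4; rewrite !h3 !h4 /= in h1 h2 *.
move=> h5.
have : 0 < 2 * (1 - (- qi n * qi m - qj n * qj m - qk n * qk m)).
  by move: h1 h2 h5; lra.
set s := - qi n * qi m - _ - _ => hs.
(* Lagrange's identity for the cross product; as s = - <n, m>, it gives |1 - n m|^2 = (1 - s)^2 + 1
   - s^2. *)
have e (u v w u' v' w' : R) : (v * w' - w * v') ^+ 2 + (w * u' - u * w') ^+ 2 +
   (u * v' - v * u') ^+ 2 = (u * u + v * v + w * w) * (u' * u' + v' * v' + w' * w')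
   - (u * u' + v * v' + w * w') ^+ 2 by ring.
have := e (qi n) (qj n) (qk n) (qi m) (qj m) (qk m).
have -> : qi n * qi n + qj n * qj n + qk n * qk n = 1 by rewrite -h2; ring.
have -> : qi m * qi m + qj m * qj m + qk m * qk m = 1 by rewrite -h1; ring.
have -> : (qi n * qi m + qj n * qj m + qk n * qk m) ^+ 2 = s ^+ 2 by rewrite /s; ring.
move=> e'.
rewrite [X in 0 < X](_ : _ = (1 - s) ^+ 2 + (1 * 1 - s ^+ 2)).
  by move: hs; rewrite expr2; nra.
by rewrite -e' /s; ring.
Qed.

Lemma qnormalize_comm (q a b : quat R) : a * q = q * b ->
  a * qnormalize q = qnormalize q * b.
Proof.
move=> h; rewrite /qnormalize -mulrA -h mulrA [RHS]mulrA; congr (_ * _).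
by apply: quatP; split; rewrite !qE /=; ring.
Qed.

Lemma qstep_comm (m n : quat R) : qunit m -> qunit n -> qimag m -> qimag n ->
  n * qstep m n = qstep m n * m.
Proof.
move=> *; apply: qnormalize_comm.
rewrite mulrBr mulrBl mulr1 mul1r mulrA -(mulrA n m m) !qimag_sqr //.
by rewrite mulrN1 mulNr mul1r !opprK addrC.
Qed.

Lemma eq_transport (n n' : nat -> quat R) k :
  (forall j, (j <= k)%N -> n j = n' j) -> transport n k = transport n' k.
Proof.
elim: k => //= k IH h; rewrite IH => [|j jk]; last by rewrite h // leqW.
by rewrite !(h k.+1, h k).
Qed.

Definition sample (N : nat) (F : R * T -> quat R) (x : T) (j : nat) :=
  F (j%:R / N%:R, x).

(** Path lifting for the Hopf fibration, uniform over [K]. The number of steps and the nonvanishing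
    of [1 - n * m] along them are part of the conclusion because the differentiability of the lift
    is derived later from the same formula. *)
Lemma lift_path K (F : R * T -> quat R) : compact K ->
  (forall (r : R) x, 0 <= r <= 1 -> K x ->
     [/\ qcts F (r, x), qunit (F (r, x)) & qimag (F (r, x))]) ->
  exists2 N : nat, (0 < N)%N &
    (forall j x, (j < N)%N -> K x ->
      0 < qdot (1 - sample N F x j.+1 * sample N F x j)
               (1 - sample N F x j.+1 * sample N F x j)) /\
    (forall x, K x -> let q := transport (sample N F x) N in
    [/\ qcts (fun y => transport (sample N F y) N) x, qunit q &
        F (1, x) * q = q * F (0, x)]).
Proof.
move=> cK hF.
have [N N0 small] : exists2 N : nat, (0 < N)%N & forall j x, (j < N)%N -> K x ->
    qdot (F (j.+1%:R / N%:R, x) - F (j%:R / N%:R, x))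
         (F (j.+1%:R / N%:R, x) - F (j%:R / N%:R, x)) < 1.
  by apply: small_steps => // r x r01 Kx; have [] := hF r x r01 Kx.
have r01 j : (j <= N)%N -> 0 <= (j%:R / N%:R : R) <= 1.
  by move=> jN; rewrite divr_ge0 ?ler0n //= ler_pdivrMr ?ltr0n // mul1r ler_nat.
have pos j x : (j < N)%N -> K x ->
      0 < qdot (1 - sample N F x j.+1 * sample N F x j)
               (1 - sample N F x j.+1 * sample N F x j).
  move=> jN Kx; have [_ ? ?] := hF _ x (r01 j (ltnW jN)) Kx.
  by have [_ ? ?] := hF _ x (r01 j.+1 jN) Kx; apply: qstep_pos => //; exact: small.
exists N => //; split=> // x Kx /=.
have : forall k, (k <= N)%N -> let q := transport (sample N F x) k in
  [/\ qcts (fun y => transport (sample N F y) k) x, qunit q &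
        F (k%:R / N%:R, x) * q = q * F (0, x)].
  elim=> [_|k IH kN] /=.
    by split; [exact: qcts_cst|exact: qunit1|rewrite mul0r mulr1 mul1r].
  have [c u e] := IH (ltnW kN).
  have [c1 u1 i1] := hF _ x (r01 k (ltnW kN)) Kx.
  have [c2 u2 i2] := hF _ x (r01 k.+1 kN) Kx.
  split.
  - apply: qctsM => //; apply: qcts_normalize; first exact: pos.
    apply: qctsB; first exact: qcts_cst.
    apply: qctsM.
      by apply: (qcts_comp (h := fun y => (_, y)) (@pairr_continuous _ _ _ _)).
    by apply: (qcts_comp (h := fun y => (_, y)) (@pairr_continuous _ _ _ _)).
  - by apply: qunitM => //; apply: qunit_normalize; exact: pos.
  - by rewrite mulrA qstep_comm // -mulrA e mulrA.
move=> /(_ N (leqnn N)) /=; rewrite divff //.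
by rewrite pnatr_eq0 -lt0n.
Qed.

End Phase.

(** * The winding number of a map from the sphere to the imaginary units *)

Section PointwiseContinuity.
Variables (S T U : topologicalType).
Implicit Types (f : S -> T) (x : S).

Lemma cts_id x : rcts (fun y : S => y) x.
Proof. exact: cvg_id. Qed.

Lemma cts_cst (c : T) x : rcts (fun y : S => c) x.
Proof. exact: cvg_cst. Qed.

Lemma cts_pair f (g : S -> U) x : rcts f x -> rcts g x ->
  rcts (fun y => (f y, g y)) x.
Proof. by move=> hf hg; apply: cvg_pair. Qed.

Lemma cts_fst (f : S -> T * U) x : rcts f x -> rcts (fun y => (f y).1) x.
Proof. by move=> h; apply: (continuous_comp h); exact: cvg_fst. Qed.

Lemma cts_snd (f : S -> T * U) x : rcts f x -> rcts (fun y => (f y).2) x.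
Proof. by move=> h; apply: (continuous_comp h); exact: cvg_snd. Qed.

End PointwiseContinuity.

Ltac cts := repeat match goal with
  | |- rcts (fun y => y) _ => exact: cts_id
  | |- rcts fst _ => exact: cvg_fst
  | |- rcts snd _ => exact: cvg_snd
  | |- rcts (fun=> ?c) _ => exact: cts_cst
  | |- rcts (fun y => (_, _)) _ => apply: cts_pair
  | |- rcts (fun y => _.1) _ => apply: cts_fst
  | |- rcts (fun y => _.2) _ => apply: cts_snd
  | |- rcts (fun y => _ - _) _ => apply: rctsB
  | |- rcts (fun y => _ + _) _ => apply: rctsD
  | |- rcts (fun y => - _) _ => apply: rctsN
  | |- rcts (fun y => _ * _) _ => apply: rctsM
  end.

Section Winding.
Variable R : realType.
Local Notation quat := (quat R).
Implicit Types (n psi : R * R -> quat).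

(** If f b exceeded f a, the intermediate value theorem would give a value f a + d with 0 < d <= 1,
    and sin d > 0 contradicts the constant exponential. *)
Lemma qexp_const (f : R -> R) a b : a <= b ->
  (forall x, a <= x <= b -> rcts f x) ->
  (forall x, a <= x <= b -> qexp (f x) = qexp (f a)) -> f b = f a.
Proof.
move=> ab; wlog lab : f / f a <= f b.
  move=> H hc he; have [l|/ltW l] := leP (f a) (f b); first exact: H.
  apply: oppr_inj; apply: (H (fun x => - f x)); rewrite ?lerN2 //.
    by move=> x hx; apply: rctsN; exact: hc.
  by move=> x hx; rewrite !qexpN he.
move=> hc he; apply/eqP; rewrite eq_le lab andbT leNgt; apply/negP => fab.
pose d := Num.min 1 (f b - f a).
have d0 : 0 < d by rewrite /d lt_min ltr01 subr_gt0.
have d1 : d <= 1 by rewrite /d ge_min lexx.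
have db : d <= f b - f a by rewrite /d ge_min lexx orbT.
have [] := @IVT _ f a b (f a + d) ab.
- apply: continuous_in_subspaceT => x; rewrite inE /= in_itv /= => hx; exact: hc.
- by rewrite min_l // max_r //; apply/andP; split; move: db; lra.
move=> x; rewrite in_itv /= => hx fx.
have := he x hx; rewrite fx qexpD => e.
have : qexp d = 1 by apply: (qmulIl (qunit_exp (f a))); rewrite mulr1.
move=> /(congr1 (@qi R)) /=; apply/eqP; rewrite gt_eqF // sin_gt0_pi // d0 /=.
by have := @pi_ge2 R; move: d1; lra.
Qed.

(** A square around the rectangle [0, pi] x [0, 2 pi] of the chart. It is star-shaped about the
    origin, so maps on it can be contracted, and its margin leaves room for two-sided continuity and
    for translates by pi. *)
Definition box : set (R * R) := [set p | `|p.1| <= 10 /\ `|p.2| <= 10].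

Lemma pi_lt4 : pi < 4 :> R.
Proof. by have := @pihalf_lt2 R; lra. Qed.

Lemma compact_box : compact box.
Proof.
have -> : box = (`[-10, 10]%classic : set R) `*` (`[-10, 10]%classic : set R).
  by apply/seteqP; split => -[x y] [/=]; rewrite ?in_itv /= -?ler_norml; split; rewrite /= ?in_itv /= -?ler_norml.
by apply: compact_setX; exact: segment_compact.
Qed.

Lemma box_scale (r : R) p : 0 <= r <= 1 -> box p -> box (r * p.1, r * p.2).
Proof.
move=> /andP[r0 r1] [/= h1 h2]; split=> /=; rewrite normrM ger0_norm //.
  by apply: le_trans h1; rewrite ler_piMl.
by apply: le_trans h2; rewrite ler_piMl.
Qed.

(** [qstep] from [qI] to [n] works except at the antipode n = - I, where [qJ] does. *)
Lemma eigenvector_exists (n : quat) : qunit n -> qimag n ->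
  exists2 p : quat, qunit p & n * p = p * qI R.
Proof.
move=> u i; have [h|h] := eqVneq (qi n) (-1).
  exists (qJ R); first by rewrite /qunit /qdot /=; ring.
  move: u i; rewrite /qunit /qimag /qdot h => h1 h2.
  have [h3 h4] : qj n = 0 /\ qk n = 0 by rewrite h2 in h1; split; nra.
  by apply: quatP; split; rewrite !qE /= ?h ?h2 ?h3 ?h4; ring.
have uI := qunitI R.
have iI : qimag (qI R) by [].
exists (qstep (qI R) n); last exact: qstep_comm.
apply: qunit_normalize; rewrite lt_neqAle.
have hs (x y z w : R) : 0 <= x * x + y * y + z * z + w * w.
  by rewrite !addr_ge0 // -expr2 sqr_ge0.
rewrite hs andbT eq_sym; apply/eqP; rewrite /qdot => h0.
have : qre (1 - n * qI R) = 0.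
  by move: h0; set x := qre _; set y := qi _; set z := qj _; set w := qk _; nra.
by rewrite !qE /=; move/eqP: h => h e; apply: h; lra.
Qed.

Definition sphere_lift n psi := forall p, box p ->
  [/\ qcts psi p, qunit (psi p) & n p * psi p = psi p * qI R].

(* In the chart (t, u) of the sphere a lift is constant on the pole t = 0,
   and differs from a constant by a phase on the pole t = pi. *)
Definition winding_lift n psi (b : R -> R) (D : R) :=
  [/\ sphere_lift n psi,
      forall u, `|u| <= 10 -> psi (0, u) = psi (0, 0),
      forall t u, psi (t, u + 2 * pi) = psi (t, u),
      forall u, `|u| <= 10 -> rcts b u /\ psi (pi, u) = psi (pi, 0) * qexp (b u) &
      b (2 * pi) - b 0 = 2 * pi * D].

Definition has_winding n D := exists psi b, winding_lift n psi b D.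

(** One lift over the whole homotopy restricts to lifts of both ends, and the increment of its phase
    over t = pi varies continuously through multiples of 2 pi. *)
Lemma winding_homotopy (F : R * (R * R) -> quat) :
  (forall (s : R) p, 0 <= s <= 1 -> box p ->
     [/\ qcts F (s, p), qunit (F (s, p)) & qimag (F (s, p))]) ->
  (forall s u, F (s, (0, u)) = F (s, (0, 0))) ->
  (forall s u, F (s, (pi, u)) = F (s, (pi, 0))) ->
  (forall s t u, F (s, (t, u + 2 * pi)) = F (s, (t, u))) ->
  exists D, has_winding (fun p => F (0, p)) D /\ has_winding (fun p => F (1, p)) D.
Proof.
move=> hF h0 hpi hper.
have b0 : box (0, 0) by split; rewrite normr0.
have z01 : 0 <= (0 : R) <= 1 by rewrite lexx ler01.
have o01 : 0 <= (1 : R) <= 1 by rewrite lexx ler01.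
have [_ u00 i00] := hF 0 _ z01 b0.
have [p0 up0 ep0] := eigenvector_exists u00 i00.
(* The scaling by r moves every point to s = 0, t = 0 but keeps u. The starting value is thus common
   to all points, so one eigenvector [p0] serves everywhere; the lift inherits the period in u, and
   over t = 0 it does not depend on u because F does not. *)
pose G (x : R * (R * (R * R))) := F (x.1 * x.2.1, (x.1 * x.2.2.1, x.2.2.2)).
pose K := (`[0, 1]%classic : set R) `*` box.
have cK : compact K by apply: compact_setX; [exact: segment_compact|exact: compact_box].
have hK s p : 0 <= s <= 1 -> box p -> K (s, p) by move=> h1 h2; split; rewrite /= ?in_itv.
have hG (r : R) x : 0 <= r <= 1 -> K x ->
     [/\ qcts G (r, x), qunit (G (r, x)) & qimag (G (r, x))].
  case: x => s [t u] r01 [/=]; rewrite in_itv /= => s01 hb.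
  have rs : 0 <= r * s <= 1.
    by move/andP: r01 => [? ?]; move/andP: s01 => [? ?]; rewrite mulr_ge0 //= mulr_ile1.
  have hb' : box (r * t, u).
    by split => /=; [have [] := box_scale r01 hb|have [] := hb].
  have [c ? ?] := hF _ _ rs hb'; split => //.
  apply: (@qcts_comp _ _ _ F
    (fun x : R * (R * (R * R)) => (x.1 * x.2.1, (x.1 * x.2.2.1, x.2.2.2))) (r, (s, (t, u)))) => //.
  by cts.
have [N N0 [_ hN]] := lift_path cK hG.
pose psi x := transport (sample N G x) N * p0.
have hpsi s p : 0 <= s <= 1 -> box p ->
  [/\ qcts psi (s, p), qunit (psi (s, p)) & F (s, p) * psi (s, p) = psi (s, p) * qI R].
  move=> hs hp; have [c u e] := hN (s, p) (hK _ _ hs hp); split.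
  - by apply: qctsM c _; exact: qcts_cst.
  - exact: qunitM.
  - move: e; rewrite /G /= !mul1r !mul0r h0; case: (p) => t u' /= e.
    by rewrite /psi mulrA e -!mulrA ep0.
have psi0 s u : psi (s, (0, u)) = psi (s, (0, 0)).
  rewrite /psi; congr (_ * _); apply: eq_transport => j _.
  by rewrite /sample /G /= mulr0 h0.
have psiper s t u : psi (s, (t, u + 2 * pi)) = psi (s, (t, u)).
  rewrite /psi; congr (_ * _); apply: eq_transport => j _.
  by rewrite /sample /G /= hper.
have pi4 := pi_lt4; have pi0 := @pi_gt0 R.
have bpi u : `|u| <= 10 -> box (pi, u).
  by split => //=; rewrite gtr0_norm //; move: pi4; lra.
have n0 : `|0 : R| <= 10 by rewrite normr0.
(* Over t = pi, for fixed s, all values of psi lie in one Hopf fibre and differ by phases; scaling u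
   to 0 gives a logarithm b that is jointly continuous in (s, u). *)
pose z (x : R * (R * R)) := qconj (psi (x.2.1, (pi, 0))) * psi (x.2.1, (pi, x.1 * x.2.2)).
pose K' := (`[0, 1]%classic : set R) `*` (`[-10, 10]%classic : set R).
have cK' : compact K' by apply: compact_setX; exact: segment_compact.
have hK' s u : 0 <= s <= 1 -> `|u| <= 10 -> K' (s, u).
  by rewrite ler_norml => h1 h2; split; rewrite /= in_itv.
have hz (r : R) x : 0 <= r <= 1 -> K' x ->
     [/\ qcts z (r, x), qunit (z (r, x)) & qcplx (z (r, x))].
  case: x => s u hr [/=]; rewrite !in_itv /= -ler_norml => hs hu.
  have hb1 : box (pi, 0) by apply: bpi; rewrite normr0.
  have hb2 : box (pi, r * u) by apply: (bpi); have [] := box_scale hr (bpi _ hu).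
  have [c1 u1 e1] := hpsi s _ hs hb1.
  have [c2 u2 e2] := hpsi s _ hs hb2.
  split.
  - apply: qctsM; first apply: qcts_conj.
      by apply: (@qcts_comp _ _ _ psi (fun x : R * (R * R) => (x.2.1, (pi, 0)))) => //; cts.
    by apply: (@qcts_comp _ _ _ psi (fun x : R * (R * R) => (x.2.1, (pi, x.1 * x.2.2)))) => //; cts.
  - by apply: qunitM => //; exact: qunit_conj.
  - by apply: (qcplx_ratio u1 e1); rewrite -e2 /= (hpi _ (r * u)).
have [b hb] := phase_log cK' hz.
have psib s u : 0 <= s <= 1 -> `|u| <= 10 ->
    psi (s, (pi, u)) = psi (s, (pi, 0)) * qexp (b (s, u)).
  move=> hs hu; have [_] := hb _ (hK' _ _ hs hu); rewrite /z /= mul1r mul0r.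
  have [_ u1 _] := hpsi s _ hs (bpi 0 n0).
  rewrite qconj_mul // mul1r => <-; by rewrite mulrA qmul_conj // mul1r.
have n2 : `|2 * pi : R| <= 10 by rewrite gtr0_norm; move: pi4 pi0; lra.
have wind s : 0 <= s <= 1 ->
    has_winding (fun p => F (s, p)) ((b (s, 2 * pi) - b (s, 0)) / (2 * pi)).
  move=> hs; exists (fun p => psi (s, p)), (fun u => b (s, u)); split => //.
  - move=> p hp; have [c u e] := hpsi s p hs hp; split => //.
    apply: (@qcts_comp _ _ _ psi (fun y => (s, y)) p) => //; exact: pairr_continuous.
  - move=> u hu; have [c _] := hb _ (hK' _ _ hs hu); split; last exact: psib.
    apply: (@continuous_comp _ _ _ (fun v => (s, v)) b) => //; exact: pairr_continuous.
  - by rewrite [RHS]mulrC divfK // mulf_neq0 ?pnatr_eq0 // gt_eqF.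
exists ((b (0, 2 * pi) - b (0, 0)) / (2 * pi)); split; first exact: wind.
suff -> : b (0, 2 * pi) - b (0, 0) = b (1, 2 * pi) - b (1, 0) by exact: wind.
have qe s : 0 <= s <= 1 -> qexp (b (s, 2 * pi) - b (s, 0)) = 1.
  move=> hs; have [_ u1 _] := hpsi s _ hs (bpi 0 n0).
  rewrite qexpD qexpN.
  have -> : qexp (b (s, 2 * pi)) = qexp (b (s, 0)).
    by apply: (qmulIl u1); rewrite -!psib // -[2 * pi]add0r psiper.
  by rewrite qmul_conj //; exact: qunit_exp.
symmetry; apply: (@qexp_const (fun s => b (s, 2 * pi) - b (s, 0))) => // s hs.
  apply: rctsB.
    have [c _] := hb _ (hK' _ _ hs n2).
    by apply: (@continuous_comp _ _ _ (fun v => (v, 2 * pi)) b) => //; exact: pairl_continuous.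
  have [c _] := hb _ (hK' _ _ hs n0).
  by apply: (@continuous_comp _ _ _ (fun v => (v, 0)) b) => //; exact: pairl_continuous.
by rewrite !qe.
Qed.

(** On the chart the ratio of two lifts is a constant times exp(a). The increment of a over a period
    in u is a multiple of 2 pi, hence independent of t; it is 0 at t = 0, where both lifts are
    constant, so it is 0 at t = pi, and the two phases there wind equally. *)
Lemma winding_unique n D D' : 
  (forall u, n (pi, u) = n (pi, 0)) ->
  has_winding n D -> has_winding n D' -> D = D'.
Proof.
move=> npi [psi [b [h1 h2 h3 h4 h5]]] [psi' [b' [h1' h2' h3' h4' h5']]].
have pi4 := pi_lt4; have pi0 := @pi_gt0 R.
have n0 : `|0 : R| <= 10 by rewrite normr0.
have n2 : `|2 * pi : R| <= 10 by rewrite gtr0_norm; move: pi4 pi0; lra.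
have np (t : R) : 0 <= t <= pi -> `|t| <= 10.
  by move=> /andP[? ?]; rewrite ger0_norm //; move: pi4; lra.
have np2 (t : R) : 0 <= t <= 2 * pi -> `|t| <= 10.
  by move=> /andP[? ?]; rewrite ger0_norm //; move: pi4; lra.
pose z p := qconj (psi p) * psi' p.
pose y (x : R * (R * R)) := z (x.1 * x.2.1, x.1 * x.2.2).
have hz p : box p -> [/\ qcts z p, qunit (z p) & qcplx (z p)].
  move=> hp; have [c u e] := h1 p hp; have [c' u' e'] := h1' p hp; split.
  - by apply: qctsM => //; exact: qcts_conj.
  - by apply: qunitM => //; exact: qunit_conj.
  - exact: (qcplx_ratio u e).
have [|a ha] := @phase_log _ _ box y compact_box.
  move=> r p r01 hp; have [c ? ?] := hz _ (box_scale r01 hp); split => //.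
  by apply: (@qcts_comp _ _ _ z (fun x : R * (R * R) => (x.1 * x.2.1, x.1 * x.2.2))) => //; cts.
have za p : box p -> z p = z (0, 0) * qexp (a p).
  move=> hp; have [_] := ha p hp; rewrite /y !mul1r !mul0r => <-.
  by case: (p).
have uz : qunit (z (0, 0)) by have [] := hz (0, 0).
have acts1 t u : box (t, u) -> rcts (fun u => a (t, u)) u.
  move=> hb; have [c _] := ha _ hb.
  by apply: (@continuous_comp _ _ _ (fun v => (t, v)) a) => //; exact: pairr_continuous.
have acts2 t u : box (t, u) -> rcts (fun t => a (t, u)) t.
  move=> hb; have [c _] := ha _ hb.
  by apply: (@continuous_comp _ _ _ (fun v => (v, u)) a) => //; exact: pairl_continuous.
have tp0 : 0 <= 2 * pi :> R by move: pi0; lra.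
have a0 : a (0, 2 * pi) = a (0, 0).
  apply: (@qexp_const (fun u => a (0, u))) => // u /np2 hu; first exact: acts1.
  by apply: (qmulIl uz); rewrite -!za // /z h2 // h2'.
have api : a (pi, 2 * pi) - a (pi, 0) = a (0, 2 * pi) - a (0, 0).
  apply: (@qexp_const (fun t => a (t, 2 * pi) - a (t, 0))); rewrite ?ltW //.
    by move=> t /np ht; apply: rctsB; exact: acts2.
  move=> t /np ht; rewrite a0 subrr qexp0 qexpD qexpN.
  have -> : qexp (a (t, 2 * pi)) = qexp (a (t, 0)).
    apply: (qmulIl uz); rewrite -!za //.
    by rewrite /z -[2 * pi]add0r h3 h3'.
  by rewrite qmul_conj //; exact: qunit_exp.
(* Over t = pi the ratio of the lifts is a constant times exp(b' - b), so a + b - b' has constant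
   exponential. *)
have hab : a (pi, 2 * pi) + b (2 * pi) - b' (2 * pi) = a (pi, 0) + b 0 - b' 0.
  have hpi : `|pi : R| <= 10 by apply: np; rewrite lexx ltW.
  apply: (@qexp_const (fun u => a (pi, u) + b u - b' u)) => // u hu.
    have hu' := np2 u hu.
    by apply: rctsB; [apply: rctsD; [exact: acts1|have [] := h4 u hu']|have [] := h4' u hu'].
  suff key v : `|v| <= 10 -> qexp (a (pi, v) + b v - b' v) =
      qconj (z (0, 0)) * z (pi, 0).
    by rewrite !key // np2.
  move=> hv; have [_ e] := h4 v hv; have [_ e'] := h4' v hv.
  apply: (qmulIl uz); rewrite mulrA qmul_conj // mul1r -addrA qexpD mulrA -za //.
  rewrite /z e e' qconjM -!qexpN.
  have -> : qexp (- b v) * qconj (psi (pi, 0)) * (psi' (pi, 0) * qexp (b' v)) =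
     qexp (- b v) * z (pi, 0) * qexp (b' v) by rewrite /z !mulrA.
  have [_ _ kz] := hz (pi, 0) (conj hpi n0).
  rewrite (qcplxC (qcplx_exp _) kz) -!mulrA -!qexpD /z.
  by rewrite (_ : - b v + _ = 0) ?qexp0 ?mulr1 //; ring.
have : 2 * pi * (D - D') = 0 by rewrite mulrBr -h5 -h5'; move: hab api a0; lra.
by move/eqP; rewrite mulf_eq0 gt_eqF ?mulr_gt0 //= subr_eq0 => /eqP.
Qed.

End Winding.

(** * Calculus in two variables and the area form *)

Section TwoVariableCalculus.
Variable R : realType.
Local Notation quat := (quat R).
Implicit Types (O : set (R * R)) (f g : R * R -> R) (F G : R * R -> quat).

Definition dquat (F : R -> quat) (x : R) (d : quat) :=
  [/\ is_derive x (1 : R) (fun y => qre (F y)) (qre d),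
      is_derive x (1 : R) (fun y => qi (F y)) (qi d),
      is_derive x (1 : R) (fun y => qj (F y)) (qj d) &
      is_derive x (1 : R) (fun y => qk (F y)) (qk d)].

Lemma rderD (f g : R -> R) x a b : is_derive x (1 : R) f a -> is_derive x (1 : R) g b ->
  is_derive x (1 : R) (fun y => f y + g y) (a + b).
Proof. by move=> ? ?; apply: is_deriveD. Qed.

Lemma rderN (f : R -> R) x a : is_derive x (1 : R) f a ->
  is_derive x (1 : R) (fun y => - f y) (- a).
Proof. by move=> ?; apply: is_deriveN. Qed.

Lemma rderM (f g : R -> R) x a b : is_derive x (1 : R) f a -> is_derive x (1 : R) g b ->
  is_derive x (1 : R) (fun y => f y * g y) (a * g x + f x * b).
Proof.
by move=> ? ?; apply: is_derive_eq; rewrite /GRing.scale /=; ring.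
Qed.

Lemma rder_cst (c x : R) : is_derive x (1 : R) (fun=> c) 0.
Proof. exact: is_derive_cst. Qed.

Lemma rder_eq (f : R -> R) x a b : is_derive x (1 : R) f a -> a = b -> is_derive x (1 : R) f b.
Proof. by move=> h <-. Qed.

Lemma rder_unique (f : R -> R) x a b :
  is_derive x (1 : R) f a -> is_derive x (1 : R) f b -> a = b.
Proof. by move=> [_ <-] [_ <-]. Qed.

Lemma dquat_cst (c : quat) x : dquat (fun=> c) x 0.
Proof. by split; exact: rder_cst. Qed.

Lemma dquatN (F : R -> quat) x a : dquat F x a -> dquat (fun y => - F y) x (- a).
Proof. by move=> [? ? ? ?]; split; apply: rderN. Qed.

Lemma dquat_conj (F : R -> quat) x a : dquat F x a ->
  dquat (fun y => qconj (F y)) x (qconj a).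
Proof. by move=> [? ? ? ?]; split => //; apply: rderN. Qed.

Lemma dquatM (F G : R -> quat) x a b : dquat F x a -> dquat G x b ->
  dquat (fun y => F y * G y) x (a * G x + F x * b).
Proof.
move=> [f0 f1 f2 f3] [g0 g1 g2 g3]; split.
- apply: (rder_eq (rderD (rderD (rderD (rderM f0 g0) (rderN (rderM f1 g1)))
    (rderN (rderM f2 g2))) (rderN (rderM f3 g3)))); rewrite !qE; ring.
- apply: (rder_eq (rderD (rderD (rderD (rderM f0 g1) (rderM f1 g0))
    (rderM f2 g3)) (rderN (rderM f3 g2)))); rewrite !qE; ring.
- apply: (rder_eq (rderD (rderD (rderD (rderM f0 g2) (rderN (rderM f1 g3)))
    (rderM f2 g0)) (rderM f3 g1))); rewrite !qE; ring.
- apply: (rder_eq (rderD (rderD (rderD (rderM f0 g3) (rderM f1 g2))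
    (rderN (rderM f2 g1))) (rderM f3 g0))); rewrite !qE; ring.
Qed.

Lemma dquat_unique (F : R -> quat) x a b : dquat F x a -> dquat F x b -> a = b.
Proof.
by move=> [? ? ? ?] [? ? ? ?]; apply: quatP; split; apply: rder_unique; eassumption.
Qed.

Lemma rder_dot (F G : R -> quat) x a b : dquat F x a -> dquat G x b ->
  is_derive x (1 : R) (fun y => qdot (F y) (G y)) (qdot a (G x) + qdot (F x) b).
Proof.
move=> [f0 f1 f2 f3] [g0 g1 g2 g3].
apply: (rder_eq (rderD (rderD (rderD (rderM f0 g0) (rderM f1 g1))
  (rderM f2 g2)) (rderM f3 g3))); by rewrite /qdot; ring.
Qed.

Definition C1 O f := exists ft fu : R * R -> R, forall p, O p ->
  [/\ is_derive p.1 (1 : R) (fun t => f (t, p.2)) (ft p),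
      is_derive p.2 (1 : R) (fun u => f (p.1, u)) (fu p),
      rcts f p, rcts ft p & rcts fu p].

Lemma C1_cst O (c : R) : C1 O (fun=> c).
Proof.
by exists (fun=> 0), (fun=> 0) => p _; split; try exact: rder_cst; exact: rcts_cst.
Qed.

Lemma C1D O f g : C1 O f -> C1 O g -> C1 O (fun p => f p + g p).
Proof.
move=> [ft [fu hf]] [gt [gu hg]]; exists (fun p => ft p + gt p), (fun p => fu p + gu p).
move=> p Op; have [? ? ? ? ?] := hf p Op; have [? ? ? ? ?] := hg p Op.
by split; solve [exact: rderD | exact: rctsD].
Qed.

Lemma C1N O f : C1 O f -> C1 O (fun p => - f p).
Proof.
move=> [ft [fu hf]]; exists (fun p => - ft p), (fun p => - fu p).
move=> p Op; have [? ? ? ? ?] := hf p Op.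
by split; solve [exact: rderN | exact: rctsN].
Qed.

Lemma C1M O f g : C1 O f -> C1 O g -> C1 O (fun p => f p * g p).
Proof.
move=> [ft [fu hf]] [gt [gu hg]].
exists (fun p => ft p * g p + f p * gt p), (fun p => fu p * g p + f p * gu p).
move=> p Op; have [a1 a2 ? ? ?] := hf p Op; have [b1 b2 ? ? ?] := hg p Op.
split; try by apply: rctsD; apply: rctsM.
- by apply: (rder_eq (rderM a1 b1)); rewrite /= -!surjective_pairing.
- by apply: (rder_eq (rderM a2 b2)); rewrite /= -!surjective_pairing.
- exact: rctsM.
Qed.

Lemma C1_comp O f (h h' : R -> R) : C1 O f ->
  (forall p, O p -> is_derive (f p) (1 : R) h (h' (f p)) /\ rcts h' (f p)) ->
  C1 O (fun p => h (f p)).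
Proof.
move=> [ft [fu hf]] hh; exists (fun p => h' (f p) * ft p), (fun p => h' (f p) * fu p).
move=> p Op; have [d1 d2 c c1 c2] := hf p Op; have [dh ch] := hh p Op.
have cf : rcts (fun p => h' (f p)) p by exact: rcts_comp c ch.
split.
- case: p Op d1 d2 c c1 c2 dh {ch cf} => t u Op d1 d2 c c1 c2 dh.
  by apply: (@is_derive1_comp R h (fun t => f (t, u))).
- case: p Op d1 d2 c c1 c2 dh {ch cf} => t u Op d1 d2 c c1 c2 dh.
  by apply: (@is_derive1_comp R h (fun u => f (t, u))).
- apply: (rcts_comp c); apply/differentiable_continuous/derivable1_diffP.
  by case: dh.
- exact: rctsM.
- exact: rctsM.
Qed.

Lemma C1_invsqrt O f : C1 O f -> (forall p, O p -> 0 < f p) ->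
  C1 O (fun p => (Num.sqrt (f p))^-1).
Proof.
move=> hf f0; pose h' (x : R) := - ((2 * Num.sqrt x)^-1 / Num.sqrt x ^+ 2).
apply: (@C1_comp O f (fun x => (Num.sqrt x)^-1) h') => // p /f0 fp.
have s0 : Num.sqrt (f p) != 0 by rewrite gt_eqF // sqrtr_gt0.
split.
  have ds := is_derive1_sqrt fp.
  have := @is_deriveV R Num.sqrt (f p) _ 1 s0 ds.
  move=> dd; apply: (rder_eq dd). by rewrite /GRing.scale /= /h'; field.
apply: rctsN; apply: rctsM; apply: rctsV.
- by rewrite mulf_neq0.
- by apply: rctsM; [exact: rcts_cst|exact: sqrt_continuous].
- by rewrite expf_neq0.
- by apply: rctsM; exact: sqrt_continuous.
Qed.

Definition qC1 O F := exists Ft Fu : R * R -> quat, forall p, O p ->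
  [/\ dquat (fun t => F (t, p.2)) p.1 (Ft p), dquat (fun u => F (p.1, u)) p.2 (Fu p),
      qcts F p, qcts Ft p & qcts Fu p].

Lemma qC1P O F : [/\ C1 O (fun p => qre (F p)), C1 O (fun p => qi (F p)),
  C1 O (fun p => qj (F p)) & C1 O (fun p => qk (F p))] <-> qC1 O F.
Proof.
split.
  move=> [[t1 [u1 h1]] [t2 [u2 h2]] [t3 [u3 h3]] [t4 [u4 h4]]].
  exists (fun p => Quat (t1 p) (t2 p) (t3 p) (t4 p)),
         (fun p => Quat (u1 p) (u2 p) (u3 p) (u4 p)) => p Op.
  by have [? ? ? ? ?] := h1 p Op; have [? ? ? ? ?] := h2 p Op;
     have [? ? ? ? ?] := h3 p Op; have [? ? ? ? ?] := h4 p Op.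
move=> [Ft [Fu h]]; split.
- exists (fun p => qre (Ft p)), (fun p => qre (Fu p)) => p /h [[? ? ? ?] [? ? ? ?] [? ? ? ?] [? ? ? ?] [? ? ? ?]].
  by split.
- exists (fun p => qi (Ft p)), (fun p => qi (Fu p)) => p /h [[? ? ? ?] [? ? ? ?] [? ? ? ?] [? ? ? ?] [? ? ? ?]].
  by split.
- exists (fun p => qj (Ft p)), (fun p => qj (Fu p)) => p /h [[? ? ? ?] [? ? ? ?] [? ? ? ?] [? ? ? ?] [? ? ? ?]].
  by split.
- exists (fun p => qk (Ft p)), (fun p => qk (Fu p)) => p /h [[? ? ? ?] [? ? ? ?] [? ? ? ?] [? ? ? ?] [? ? ? ?]].
  by split.
Qed.

Lemma qC1_cst O (c : quat) : qC1 O (fun=> c).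
Proof. by apply/qC1P; split; exact: C1_cst. Qed.

Lemma qC1M O F G : qC1 O F -> qC1 O G -> qC1 O (fun p => F p * G p).
Proof.
move=> /qC1P[f0 f1 f2 f3] /qC1P[g0 g1 g2 g3]; apply/qC1P; split.
- exact: (C1D (C1D (C1D (C1M f0 g0) (C1N (C1M f1 g1)))
    (C1N (C1M f2 g2))) (C1N (C1M f3 g3))).
- exact: (C1D (C1D (C1D (C1M f0 g1) (C1M f1 g0)) (C1M f2 g3)) (C1N (C1M f3 g2))).
- exact: (C1D (C1D (C1D (C1M f0 g2) (C1N (C1M f1 g3))) (C1M f2 g0)) (C1M f3 g1)).
- exact: (C1D (C1D (C1D (C1M f0 g3) (C1M f1 g2)) (C1N (C1M f2 g1))) (C1M f3 g0)).
Qed.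

Lemma qC1B O F G : qC1 O F -> qC1 O G -> qC1 O (fun p => F p - G p).
Proof.
move=> /qC1P[f0 f1 f2 f3] /qC1P[g0 g1 g2 g3]; apply/qC1P.
by split; [exact: (C1D f0 (C1N g0))|exact: (C1D f1 (C1N g1))
  |exact: (C1D f2 (C1N g2))|exact: (C1D f3 (C1N g3))].
Qed.

Lemma qC1_normalize O F : qC1 O F -> (forall p, O p -> 0 < qdot (F p) (F p)) ->
  qC1 O (fun p => qnormalize (F p)).
Proof.
move=> hF F0; apply: qC1M => //; apply/qC1P; split; try exact: C1_cst.
apply: C1_invsqrt => //; move: hF => /qC1P[f0 f1 f2 f3].
exact: (C1D (C1D (C1D (C1M f0 f0) (C1M f1 f1)) (C1M f2 f2)) (C1M f3 f3)).
Qed.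

(** The samples of the contracted map, from which [transport] is built, have this form. *)
Lemma qC1_scale1 (O : set (R * R)) (r : R) F : qC1 setT F -> qC1 O (fun p => F (r * p.1, p.2)).
Proof.
move=> [Ft [Fu h]].
exists (fun p => qR r * Ft (r * p.1, p.2)), (fun p => Fu (r * p.1, p.2)) => -[t u] _ /=.
have [dt du c ct cu] := h (r * t, u) I.
have cc : rcts (fun p : R * R => (r * p.1, p.2)) (t, u) by cts.
have aux (f : R * R -> R) d : is_derive (r * t) (1 : R) (fun t => f (t, u)) d ->
    is_derive t (1 : R) (fun t => f (r * t, u)) (d * r).
  move=> hf; refine (@is_derive1_comp R (fun t => f (t, u)) (fun t => r * t) t _ _ hf _).
  have := rderM (rder_cst r t) (is_derive_id t (1 : R)).
  by rewrite mul0r mulr1 add0r.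
split.
- case: dt => d1 d2 d3 d4; split.
  + by apply: (rder_eq (aux (fun p => qre (F p)) _ d1)); rewrite !qE /=; ring.
  + by apply: (rder_eq (aux (fun p => qi (F p)) _ d2)); rewrite !qE /=; ring.
  + by apply: (rder_eq (aux (fun p => qj (F p)) _ d3)); rewrite !qE /=; ring.
  + by apply: (rder_eq (aux (fun p => qk (F p)) _ d4)); rewrite !qE /=; ring.
- by [].
- exact: (qcts_comp (F := F) (h := fun p : R * R => (r * p.1, p.2))).
- apply: qctsM; first exact: qcts_cst.
  exact: (qcts_comp (F := Ft) (h := fun p : R * R => (r * p.1, p.2))).
- exact: (qcts_comp (F := Fu) (h := fun p : R * R => (r * p.1, p.2))).
Qed.

Lemma qC1_transport O (n : R * R -> nat -> quat) k :
  (forall j, qC1 O (fun p => n p j)) ->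
  (forall p j, O p -> (j < k)%N ->
     0 < qdot (1 - n p j.+1 * n p j) (1 - n p j.+1 * n p j)) ->
  qC1 O (fun p => transport (n p) k).
Proof.
move=> hn; elim: k => [_|k IH h] /=; first exact: qC1_cst.
apply: qC1M; last by apply: IH => p j Op jk; apply: h => //; exact: ltnW.
apply: qC1_normalize => [|p Op]; last exact: h.
by apply: qC1B; [exact: qC1_cst|apply: qC1M].
Qed.

(* The area form of n = psi I psi^-1 in terms of psi; both sides are computed
   from the imaginary quaternions psi^-1 psi_t and psi^-1 psi_u. *)
Lemma area_density (psi a b : quat) : qunit psi -> qdot psi a = 0 -> qdot psi b = 0 ->
  let n := psi * qI R * qconj psi in
  let nt := a * qI R * qconj psi + psi * qI R * qconj a in
  let nu := b * qI R * qconj psi + psi * qI R * qconj b in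
  qre (n * nt * nu) = 4 * qdot (a * qI R) b.
Proof.
move=> u ha hb n nt nu.
pose x := qconj psi * a; pose y := qconj psi * b.
have ax : a = psi * x by rewrite /x mulrA qmul_conj ?mul1r.
have by_ : b = psi * y by rewrite /y mulrA qmul_conj ?mul1r.
have x0 : qre x = 0 by rewrite -ha /x /qdot !qE /=; ring.
have y0 : qre y = 0 by rewrite -hb /y /qdot !qE /=; ring.
clearbody x y.
have ntE : nt = psi * (x * qI R + qI R * qconj x) * qconj psi.
  by rewrite /nt ax qconjM mulrDr mulrDl !mulrA.
have nuE : nu = psi * (y * qI R + qI R * qconj y) * qconj psi.
  by rewrite /nu by_ qconjM mulrDr mulrDl !mulrA.
have -> : n * nt * nu = psi * (qI R * (x * qI R + qI R * qconj x) *
    (y * qI R + qI R * qconj y)) * qconj psi.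
  rewrite ntE nuE /n.
  have e (p q : quat) : psi * p * qconj psi * (psi * q * qconj psi) = psi * (p * q) * qconj psi.
    by rewrite -!mulrA (mulrA (qconj psi)) qconj_mul // mul1r.
  by rewrite !e.
have -> : qdot (a * qI R) b = qdot (x * qI R) y.
  by rewrite ax by_ -mulrA qdotMl u mul1r.
have re_conj (p : quat) : qre (psi * p * qconj psi) = qre p.
  have -> : qre (psi * p * qconj psi) = qdot psi psi * qre p by rewrite /qdot !qE /=; ring.
  by rewrite u mul1r.
by rewrite re_conj /qdot !qE /= x0 y0; ring.
Qed.

End TwoVariableCalculus.

(** * Integrals of continuous functions over segments *)

Section SegmentIntegral.
Variable R : realType.
Implicit Types (f g : R -> R) (a b : R).

Definition integ a b f : R := \int[lebesgue_measure]_(x in `[a, b]) f x.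

Definition seg_cts a b f := forall x, a <= x <= b -> rcts f x.

Lemma seg_cts_within a b f : seg_cts a b f -> {within `[a, b], continuous f}.
Proof.
move=> h; apply: continuous_in_subspaceT => x; rewrite inE /= in_itv /=; exact: h.
Qed.

Lemma seg_integrable a b f : seg_cts a b f ->
  (@lebesgue_measure R).-integrable `[a, b] (EFin \o f).
Proof.
move=> h; apply: continuous_compact_integrable; first exact: segment_compact.
exact: seg_cts_within.
Qed.

Lemma integ_eq a b f g : (forall x, a <= x <= b -> f x = g x) ->
  integ a b f = integ a b g.
Proof. by move=> h; apply: eq_Rintegral => x; rewrite inE /= in_itv /=; exact: h. Qed.

Lemma integD a b f g : seg_cts a b f -> seg_cts a b g ->
  integ a b (fun x => f x + g x) = integ a b f + integ a b g.
Proof.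
by move=> hf hg; apply: RintegralD; [exact: measurable_itv|exact: seg_integrable..].
Qed.

Lemma integZ a b f (c : R) : seg_cts a b f ->
  integ a b (fun x => c * f x) = c * integ a b f.
Proof.
by move=> hf; apply: RintegralZl; [exact: measurable_itv|exact: seg_integrable].
Qed.

Lemma integ_cst a b (c : R) : a <= b -> integ a b (fun=> c) = c * (b - a).
Proof.
rewrite le_eqVlt => /orP[/eqP->|ab].
  by rewrite /integ set_itv1 Rintegral_set1 subrr mulr0.
rewrite /integ Rintegral_cst; last exact: measurable_itv.
by congr (_ * _); rewrite /= lebesgue_measure_itv /= lte_fin ab.
Qed.

Lemma integ_le a b f g : seg_cts a b f -> seg_cts a b g ->
  (forall x, a <= x <= b -> f x <= g x) -> integ a b f <= integ a b g.
Proof.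
move=> hf hg h; apply: le_Rintegral; [exact: measurable_itv|exact: seg_integrable..|].
by move=> x /=; rewrite in_itv /=; exact: h.
Qed.

Lemma integ_dist a b f g (e : R) : a <= b -> seg_cts a b f -> seg_cts a b g ->
  (forall x, a <= x <= b -> `|f x - g x| <= e) ->
  `|integ a b f - integ a b g| <= e * (b - a).
Proof.
move=> ab hf hg h.
have he : seg_cts a b (fun=> e) by move=> x _; exact: rcts_cst.
have aux f' g' : seg_cts a b f' -> seg_cts a b g' ->
    (forall x, a <= x <= b -> `|f' x - g' x| <= e) ->
    integ a b f' <= integ a b g' + e * (b - a).
  move=> hf' hg' h'; rewrite -integ_cst // -integD //; apply: integ_le => //.
    by move=> x hx; apply: rctsD; [exact: hg'|exact: he].
  by move=> x /h'; rewrite ler_norml => /andP[_]; lra.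
rewrite ler_norml; apply/andP; split; last first.
  by have := aux f g hf hg h; lra.
suff : integ a b g <= integ a b f + e * (b - a) by lra.
by apply: aux => // x hx; rewrite distrC; exact: h.
Qed.

Lemma rder_cts f x d : is_derive x (1 : R) f d -> rcts f x.
Proof. by move=> [h _]; apply/differentiable_continuous/derivable1_diffP. Qed.

Lemma integ_FTC a b f F : a < b -> seg_cts a b f ->
  (forall x, a <= x <= b -> is_derive x (1 : R) F (f x)) ->
  integ a b f = F b - F a.
Proof.
move=> ab hf hF.
have cF x : a <= x <= b -> rcts F x by move=> /hF; exact: rder_cts.
have := @continuous_FTC2 R f F a b ab (seg_cts_within hf).
rewrite /integ /Rintegral => -> //.
- split.
  + by move=> x; rewrite in_itv /= => /andP[h1 h2]; have [] := hF x (ltac:(by rewrite !ltW)).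
  + by apply: cvg_at_right_filter; apply: cF; rewrite lexx ltW.
  + by apply: cvg_at_left_filter; apply: cF; rewrite lexx ltW.
- move=> x; rewrite in_itv /= => /andP[h1 h2].
  by have [_ <-] := hF x (ltac:(by rewrite !ltW)); rewrite derive1E.
Qed.

(** Compactness of the segment makes q (s, u) close to q (t, u) uniformly in u. *)
Lemma integ_param a b (q : R * R -> R) (t : R) : a <= b ->
  (forall u, a <= u <= b -> rcts q (t, u)) ->
  (\forall s \near t, seg_cts a b (fun u => q (s, u))) ->
  rcts (fun s => integ a b (fun u => q (s, u))) t.
Proof.
move=> ab hq hs; apply/cvgrPdist_le => e e0.
(* The summand 1 keeps the denominator positive when a = b. *)
pose d := e / (b - a + 1).
have ba1 : 0 < b - a + 1 by lra.
have d0 : 0 < d by rewrite divr_gt0.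
have unif : \forall s \near t, forall u, a <= u <= b -> `|q (t, u) - q (s, u)| <= d.
  have cov := iffLR (compact_near_coveringP _) (@segment_compact R a b).
  apply: filterS (cov _ (nbhs t) (fun s u => `|q (t, u) - q (s, u)| <= d) _ _).
    by move=> s hs' u hu; apply: hs'; rewrite /= in_itv.
  move=> u; rewrite /= in_itv /= => hu.
  have d20 : 0 < d / 2 by rewrite divr_gt0.
  have /cvgrPdist_le /(_ _ d20) [[V1 V2] /= [h1 h2] hV] := hq u hu.
  exists (V2, V1) => //= -[v s] [/= hv hs'].
  have b1 := hV (s, v) (conj hs' hv).
  have b2 := hV (t, v) (conj (nbhs_singleton h1) hv).
  rewrite (le_trans (ler_distD (q (t, u)) _ _)) // (splitr d) lerD //.
  by rewrite distrC.
have st : seg_cts a b (fun u => q (t, u)) by apply: nbhs_singleton hs.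
near=> s.
have h1 : seg_cts a b (fun u => q (s, u)) by near: s.
have h2 : forall u, a <= u <= b -> `|q (t, u) - q (s, u)| <= d by near: s.
apply: (le_trans (integ_dist ab st h1 h2)).
by rewrite /d mulrAC ler_pdivrMr // ler_pM2l //; lra.
Unshelve. all: by end_near. Qed.

End SegmentIntegral.

(** * Circulation of a lift around circles of latitude *)

Section Circulation.
Variable R : realType.
Local Notation quat := (quat R).
Implicit Types (F : R * R -> quat).

Lemma near_norm_lt (x r : R) : `|x| < r -> \forall y \near x, `|y| < r.
Proof. by move=> h; exact: (@cvgr_norm_lt R R R (nbhs x) _ id x cvg_id r h). Qed.

Definition obox : set (R * R) := [set p | `|p.1| < 10 /\ `|p.2| < 10].

Lemma obox_nbhs p : obox p -> nbhs p obox.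
Proof.
case: p => t u [/= ht hu].
exists ([set y : R | `|y| < 10], [set y : R | `|y| < 10]); first by split; exact: near_norm_lt.
by move=> [x y] [].
Qed.

Definition dquot (T : Type) (f ft : R * T -> R) (h : R) (p : R * T) : R :=
  if h == 0 then ft p else h^-1 * (f (p.1 + h, p.2) - f p).

(** By the mean value theorem each quotient is a value of [ft] at a point close to t, so continuity
    of [ft] at (t, u) is enough, including across h = 0. *)
Lemma dquot_cts (T : topologicalType) (f ft : R * T -> R) (t : R) (u : T) :
  (\forall p \near (t, u), is_derive p.1 (1 : R) (fun t => f (t, p.2)) (ft p)) ->
  rcts ft (t, u) -> rcts (fun x : R * T => dquot f ft x.1 (t, x.2)) (0, u).
Proof.
move=> hf hc; apply/cvgrPdist_lt => e e0.
have /cvgrPdist_lt /(_ _ e0) near1 := hc.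
have := filterI near1 hf => -[[V1 V2] /= [/nbhs_ballP[d /= d0 hd] h2] hV].
exists (ball (0 : R) d, V2); first by split => //=; exact: nbhsx_ballx.
move=> [h v] [/= hh hv]; rewrite /dquot eqxx.
have hh' : `|h| < d by move: hh; rewrite /ball /= sub0r normrN.
have inV s : `|s - t| < d -> `|ft (t, u) - ft (s, v)| < e /\
    is_derive s (1 : R) (fun s => f (s, v)) (ft (s, v)).
  by move=> hs; apply: (hV (s, v)); split => //=; apply: hd; rewrite /ball /= distrC.
have der s : `|s - t| < d -> is_derive s (1 : R) (fun s => f (s, v)) (ft (s, v)).
  by move=> /inV[].
have cts_ (a b : R) : (forall s, a <= s <= b -> `|s - t| < d) ->
    {within `[a, b], continuous (fun s => f (s, v))}.
  by move=> hab; apply: seg_cts_within => s /hab /der; exact: rder_cts.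
case: eqP => [_|/eqP h0].
  by have [] := inV t; rewrite ?subrr ?normr0.
suff [c hc' ->] : exists2 c, `|c - t| < d & h^-1 * (f (t + h, v) - f (t, v)) = ft (c, v).
  by have [] := inV c.
have [hpos|hneg|/eqP] := ltgtP 0 h; last by rewrite eq_sym (negbTE h0).
- have seg s : t <= s <= t + h -> `|s - t| < d.
    by move=> /andP[? ?]; move: hh'; rewrite ger0_norm ?ger0_norm; lra.
  have [|c||c hc' E] := @MVT_segment R (fun s => f (s, v)) (fun s => ft (s, v)) t (t + h).
  + by rewrite lerDl ltW.
  + by rewrite in_itv /= => /andP[? ?]; apply: der; apply: seg; rewrite !ltW.
  + exact: cts_.
  exists c; first by apply: seg; move: hc'; rewrite in_itv.
  by rewrite E addrAC subrr add0r mulrCA mulVf ?mulr1.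
- have seg s : t + h <= s <= t -> `|s - t| < d.
    by move=> /andP[? ?]; move: hh'; rewrite !ler0_norm; lra.
  have [|c||c hc' E] := @MVT_segment R (fun s => f (s, v)) (fun s => ft (s, v)) (t + h) t.
  + by rewrite gerDl ltW.
  + by rewrite in_itv /= => /andP[? ?]; apply: der; apply: seg; rewrite !ltW.
  + exact: cts_.
  exists c; first by apply: seg; move: hc'; rewrite in_itv.
  have -> : f (t + h, v) - f (t, v) = ft (c, v) * h by rewrite -opprB E; ring.
  by rewrite mulrCA mulVf ?mulr1.
Qed.

Definition qdquot F Ft (h : R) p : quat :=
  Quat (dquot (fun p => qre (F p)) (fun p => qre (Ft p)) h p)
       (dquot (fun p => qi (F p)) (fun p => qi (Ft p)) h p)
       (dquot (fun p => qj (F p)) (fun p => qj (Ft p)) h p)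
       (dquot (fun p => qk (F p)) (fun p => qk (Ft p)) h p).

Lemma qdquotE F Ft h p : h != 0 ->
  qdquot F Ft h p = qR h^-1 * (F (p.1 + h, p.2) - F p).
Proof.
by move=> /negbTE h0; apply: quatP; split; rewrite /= /dquot h0; ring.
Qed.

Definition qder2 F Ft Fu := forall p, obox p ->
  [/\ dquat (fun t => F (t, p.2)) p.1 (Ft p), dquat (fun u => F (p.1, u)) p.2 (Fu p),
      qcts F p, qcts Ft p & qcts Fu p].

(** The integral over a circle of latitude of <psi I, d psi>, the pulled back connection form of the
    Hopf fibration. Its differential has density 2 <psi_t I, psi_u>, half the area density of n. *)
Definition circulation F Fu (t : R) :=
  integ 0 (2 * pi) (fun u => qdot (F (t, u) * qI R) (Fu (t, u))).

Lemma seg_obox (t u : R) : `|t| < 10 -> 0 <= u <= 2 * pi -> obox (t, u).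
Proof.
move=> ht /andP[u0 u1]; split => //=; rewrite ger0_norm //.
by have := @pi_lt4 R; lra.
Qed.

Lemma qcts_slice2 F t u : qcts F (t, u) -> qcts (fun u => F (t, u)) u.
Proof. by apply: (@qcts_comp _ _ _ F (fun v => (t, v))); exact: pairr_continuous. Qed.

(* Integration by parts in u turns the increment of the circulation into
   \int <(F' - F) I, F'_u + F_u>, so that no second derivatives are needed. *)
Lemma circulation_derive F Ft Fu (t : R) : qder2 F Ft Fu -> `|t| < 10 ->
  (forall t, F (t, 2 * pi) = F (t, 0)) ->
  is_derive t (1 : R) (circulation F Fu)
    (2 * integ 0 (2 * pi) (fun u => qdot (Ft (t, u) * qI R) (Fu (t, u)))).
Proof.
move=> hF ht per.
have p0 : 0 < 2 * pi :> R by rewrite mulr_gt0 // pi_gt0.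
pose q (x : R * R) := qdot (qdquot F Ft (x.1 - t) (t, x.2) * qI R)
                           (Fu (x.1, x.2) + Fu (t, x.2)).
set D := 2 * _.
have near_t := near_norm_lt ht.
have cF z u : `|z| < 10 -> 0 <= u <= 2 * pi ->
    [/\ qcts (fun u => F (z, u)) u, qcts (fun u => Ft (z, u)) u & qcts (fun u => Fu (z, u)) u].
  by move=> hz hu; have [_ _ ? ? ?] := hF _ (seg_obox hz hu); split; exact: qcts_slice2.
have qcts_seg z : `|z| < 10 -> seg_cts 0 (2 * pi) (fun u => q (z, u)).
  move=> hz u hu; have [c1 c2 c3] := cF z u hz hu; have [c4 c5 c6] := cF t u ht hu.
  apply: rcts_dot; last exact: qctsD.
  apply: qctsM; last exact: qcts_cst.
  rewrite /=; have [->|h0] := eqVneq (z - t) 0.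
    have e : (fun u => qdquot F Ft 0 (t, u)) = (fun u => Ft (t, u)).
      by apply/funext => v; apply: quatP; split; rewrite /= /dquot eqxx.
    by rewrite e.
  have e : (fun u => qdquot F Ft (z - t) (t, u)) =
      (fun u => qR (z - t)^-1 * (F (z, u) - F (t, u))).
    by apply/funext => v; rewrite qdquotE //= (addrC t) subrK.
  by rewrite e; apply: qctsM; [exact: qcts_cst|exact: qctsB].
have incr z : `|z| < 10 ->
    circulation F Fu z - circulation F Fu t = integ 0 (2 * pi) (fun u => q (z, u)) * (z - t).
  move=> hz; have [zt|h0] := eqVneq (z - t) 0.
    by move/eqP: (zt); rewrite subr_eq0 => /eqP ->; rewrite !subrr mulr0.
  (* r is the u-derivative of the periodic function <F (z, u) I, F (t, u)>, so its integral
     vanishes; the increment of the circulation plus this integral is (z - t) times the integral of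
     q (z, .). *)
  pose r u := qdot (F (z, u) * qI R) (Fu (t, u)) - qdot (F (t, u) * qI R) (Fu (z, u)).
  have cr : seg_cts 0 (2 * pi) r.
    move=> u hu; have [c1 c2 c3] := cF z u hz hu; have [c4 c5 c6] := cF t u ht hu.
    by apply: rctsB; apply: rcts_dot => //; apply: qctsM => //; exact: qcts_cst.
  have r0 : integ 0 (2 * pi) r = 0.
    have -> : integ 0 (2 * pi) r = qdot (F (z, 2 * pi) * qI R) (F (t, 2 * pi)) -
        qdot (F (z, 0) * qI R) (F (t, 0)); last by rewrite !per subrr.
    apply: (@integ_FTC _ _ _ r (fun u => qdot (F (z, u) * qI R) (F (t, u)))) => //.
    move=> u hu; have [_ d1 _ _ _] := hF _ (seg_obox hz hu).
    have [_ d2 _ _ _] := hF _ (seg_obox ht hu).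
    apply: (rder_eq (rder_dot (dquatM d1 (dquat_cst (qI R) u)) d2)).
    by rewrite /r /qdot !qE /=; ring.
  have cc z' : `|z'| < 10 -> seg_cts 0 (2 * pi) (fun u => qdot (F (z', u) * qI R) (Fu (z', u))).
    move=> hz' u hu; have [c1 c2 c3] := cF z' u hz' hu.
    by apply: rcts_dot => //; apply: qctsM => //; exact: qcts_cst.
  suff : circulation F Fu z = integ 0 (2 * pi) (fun u => q (z, u)) * (z - t) +
      (circulation F Fu t + (-1) * integ 0 (2 * pi) r) by rewrite r0; lra.
  rewrite /circulation [integ _ _ _ * _]mulrC -(integZ _ cr) -(integZ _ (qcts_seg z hz)) -!integD.
  - apply: integ_eq => u _; rewrite /q qdquotE //= (addrC t) subrK /r /qdot !qE /=.
    by field.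
  - by move=> u hu; apply: rctsM; [exact: rcts_cst|exact: qcts_seg].
  - move=> u hu; apply: rctsD; first exact: cc.
    by apply: rctsM; [exact: rcts_cst|exact: cr].
  - exact: cc.
  - by move=> u hu; apply: rctsM; [exact: rcts_cst|exact: cr].
have qt : integ 0 (2 * pi) (fun u => q (t, u)) = D.
  rewrite /D -integZ; last first.
    move=> u hu; have [c1 c2 c3] := cF t u ht hu.
    by apply: rcts_dot => //; apply: qctsM => //; exact: qcts_cst.
  apply: integ_eq => u _; rewrite /q subrr.
  by rewrite /qdot !qE /= /dquot eqxx; ring.
apply/is_derive1_caratheodory.
(* The slope function of Caratheodory's criterion; off t it is the integral of q (z, .) by [incr],
   whose limit at t is D. *)
exists (fun z => if z == t then D else (circulation F Fu z - circulation F Fu t) / (z - t)).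
split; last by rewrite eqxx.
  move=> z; case: eqP => [->|/eqP zt]; first by rewrite !subrr mulr0.
  by rewrite divfK // subr_eq0.
have c0 : rcts (fun z => integ 0 (2 * pi) (fun u => q (z, u))) t.
  apply: integ_param; first exact: ltW.
    move=> u hu; have hO := seg_obox ht hu.
    have [_ _ _ [k1 k2 k3 k4] k] := hF _ hO.
    have sh : rcts (fun x : R * R => (x.1 - t, x.2)) (t, u) by cts.
    apply: rcts_dot; last first.
      apply: qctsD.
        by apply: (@qcts_comp _ _ _ Fu (fun x : R * R => (x.1, x.2))) => //; cts.
      by apply: (@qcts_comp _ _ _ Fu (fun x : R * R => (t, x.2))) => //; cts.
    apply: qctsM; last exact: qcts_cst.
    apply: (@qcts_comp _ _ _ (fun x : R * R => qdquot F Ft x.1 (t, x.2))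
       (fun x : R * R => (x.1 - t, x.2))) => //=.
    rewrite subrr; split => /=; apply: dquot_cts => //;
      by apply: filterS (obox_nbhs hO) => p /hF[[? ? ? ?] _ _ _ _].
  by near=> z; apply: qcts_seg; near: z.
rewrite /prop_for /continuous_at eqxx -qt.
apply: cvg_trans c0; apply: near_eq_cvg; near=> z.
case: eqP => [-> //|/eqP zt]; rewrite incr ?mulfK ?subr_eq0 //.
by near: z.
Unshelve. all: by end_near. Qed.

(** For psi = psi(0) exp(b) the integrand is the derivative of b. As b is only known to be
    continuous, this derivative has to be produced: near u, the difference b v - b u is the [asin]
    of a differentiable function of v. *)
Lemma circulation_phase (psi psiu : R -> quat) (b : R -> R) :
  qunit (psi 0) ->
  (forall u, 0 <= u <= 2 * pi -> dquat psi u (psiu u) /\ qcts psiu u) ->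
  (forall u, `|u| <= 10 -> rcts b u /\ psi u = psi 0 * qexp (b u)) ->
  integ 0 (2 * pi) (fun u => qdot (psi u * qI R) (psiu u)) = b (2 * pi) - b 0.
Proof.
move=> u0 hd hb.
have p4 := @pi_lt4 R; have pp := @pi_gt0 R.
have p0 : 0 < 2 * pi :> R by rewrite mulr_gt0.
have seg (u : R) : 0 <= u <= 2 * pi -> `|u| < 10.
  by move=> /andP[h0 h1]; rewrite ger0_norm //; clear - h1 p4; lra.
have cpsi u : 0 <= u <= 2 * pi -> qcts psi u.
  by move=> /hd[[? ? ? ?] _]; split; apply: rder_cts; eassumption.
apply: integ_FTC => // u hu.
  have [_ c] := hd u hu.
  by apply: rcts_dot => //; apply: qctsM; [exact: cpsi|exact: qcts_cst].
have [d c] := hd u hu.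
have hu10 := seg u hu.
have [cb eb] := hb u (ltW hu10).
have upsi : qunit (psi u) by rewrite eb; apply: qunitM => //; exact: qunit_exp.
pose s v := qi (qconj (psi u) * psi v).
have ds : is_derive u (1 : R) s (qdot (psi u * qI R) (psiu u)).
  have [_ d1 _ _] := dquatM (dquat_cst (qconj (psi u)) u) d.
  by apply: (rder_eq d1); rewrite /qdot !qE /=; ring.
have s0 : s u = 0 by rewrite /s qconj_mul.
have dasin : is_derive u (1 : R) (fun v => b u + asin (s v)) (qdot (psi u * qI R) (psiu u)).
  have h1 : -1 < s u < 1 by rewrite s0; apply/andP; split; lra.
  have dd := @is_derive1_comp R (@asin R) s u _ _ (is_derive1_asin h1) ds.
  apply: (rder_eq (rderD (rder_cst (b u) u) dd)).
  by rewrite s0 expr0n /= subr0 sqrtr1 invr1 mul1r add0r.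
apply: near_eq_is_derive dasin; near=> v.
have v10 : `|v| <= 10.
  by apply: ltW; near: v; exact: near_norm_lt.
have bv : `|b u - b v| < 1.
  by near: v; move/cvgrPdist_lt: cb => /(_ _ ltr01).
have [_ ev] := hb v v10.
have -> : s v = sin (b v - b u).
  rewrite /s ev eb qconjM -!mulrA (mulrA (qconj (psi 0))) qconj_mul // mul1r.
  by rewrite -qexpN -qexpD [- _ + _]addrC.
rewrite sinK; first by rewrite addrC subrK.
rewrite in_itv /=; have := @pihalf_ge1 R; move: bv; rewrite ltr_norml => /andP[h1 h2] h3.
by apply/andP; split; clear - h1 h2 h3; lra.
Unshelve. all: by end_near. Qed.

End Circulation.

(** * The area integral in terms of the winding number *)

Section AreaWinding.
Variable R : realType.
Local Notation quat := (quat R).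
Implicit Types (n psi : R * R -> quat).

Lemma rcts_slice1 (a : R * R -> R) t u : rcts a (t, u) -> rcts (fun t => a (t, u)) t.
Proof.
by apply: (@continuous_comp _ _ _ (fun v => (v, u)) a) => //; exact: pairl_continuous.
Qed.

Lemma rcts_slice2 (a : R * R -> R) t u : rcts a (t, u) -> rcts (fun u => a (t, u)) u.
Proof.
by apply: (@continuous_comp _ _ _ (fun v => (t, v)) a) => //; exact: pairr_continuous.
Qed.

(** D is by construction a real number, the increment of the phase over a period divided by 2 pi;
    its value comes from the area integral. *)
Lemma lift_winding n psi : sphere_lift n psi ->
  (forall u, n (pi, u) = n (pi, 0)) ->
  (forall u, psi (0, u) = psi (0, 0)) ->
  (forall t u, psi (t, u + 2 * pi) = psi (t, u)) ->
  exists b D, winding_lift n psi b D.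
Proof.
move=> hpsi npi psi0 per.
have pi4 := @pi_lt4 R; have pi0 := @pi_gt0 R.
have bpi (u : R) : `|u| <= 10 -> box (pi, u).
  by split => //=; rewrite gtr0_norm //; move: pi4; lra.
have n0 : `|0 : R| <= 10 by rewrite normr0.
pose z (x : R * R) := qconj (psi (pi, 0)) * psi (pi, x.1 * x.2).
pose K := (`[-10, 10]%classic : set R).
have hK u : `|u| <= 10 -> K u by rewrite ler_norml /K /= in_itv.
have hz (r : R) u : 0 <= r <= 1 -> K u ->
    [/\ qcts z (r, u), qunit (z (r, u)) & qcplx (z (r, u))].
  rewrite /K /= in_itv /= -ler_norml => hr hu.
  have hb : box (pi, r * u) by apply: (bpi); have [] := box_scale hr (bpi _ hu).
  have [c1 u1 e1] := hpsi _ (bpi _ n0); have [c2 u2 e2] := hpsi _ hb.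
  split.
  - apply: qctsM; first exact: qcts_cst.
    by apply: (@qcts_comp _ _ _ psi (fun x : R * R => (pi, x.1 * x.2))) => //; cts.
  - by apply: qunitM => //; exact: qunit_conj.
  - by apply: (qcplx_ratio u1 e1); rewrite -e2 (npi (r * u)).
have [b hb] := phase_log (@segment_compact R _ _) hz.
exists b, ((b (2 * pi) - b 0) / (2 * pi)); split => //.
- move=> u /[dup] hu /hK /hb [c]; rewrite /z /= mul1r mul0r.
  have [_ u1 _] := hpsi _ (bpi _ n0).
  by rewrite qconj_mul // mul1r => <-; split; rewrite // mulrA qmul_conj // mul1r.
- by rewrite [RHS]mulrC divfK // mulf_neq0 ?pnatr_eq0 // gt_eqF.
Qed.

Lemma dquat_near (F G : R -> quat) x d :
  (\forall y \near x, F y = G y) -> dquat F x d -> dquat G x d.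
Proof.
move=> h [h1 h2 h3 h4]; split; [apply: near_eq_is_derive h1|apply: near_eq_is_derive h2
  |apply: near_eq_is_derive h3|apply: near_eq_is_derive h4]; by apply: filterS h => y ->.
Qed.

(** Stokes' theorem on the chart: the area is twice the increment of the circulation from t = 0,
    where the lift does not depend on u and the circulation vanishes, to t = pi, where it is the
    increment 2 pi D of the phase. *)
Lemma area_winding n nt nu :
  qC1 setT n ->
  (forall p, dquat (fun t => n (t, p.2)) p.1 (nt p) /\
             dquat (fun u => n (p.1, u)) p.2 (nu p)) ->
  (forall p, qunit (n p) /\ qimag (n p)) ->
  (forall u, n (0, u) = n (0, 0)) -> (forall u, n (pi, u) = n (pi, 0)) ->
  (forall t u, n (t, u + 2 * pi) = n (t, u)) ->
  exists2 D, has_winding n D &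
    integ 0 pi (fun t => integ 0 (2 * pi)
      (fun u => qre (n (t, u) * nt (t, u) * nu (t, u)))) = 4 * pi * D.
Proof.
move=> nC1 nder nui n0 npi nper.
have pi4 := @pi_lt4 R; have pi0 := @pi_gt0 R.
have p20 : 0 < 2 * pi :> R by rewrite mulr_gt0.
have seg t : 0 <= t <= pi -> `|t : R| < 10.
  by move=> /andP[h0 h1]; rewrite ger0_norm //; clear - h1 pi4; lra.
have ncts p : qcts n p by have [? [? /(_ p I)[]]] := nC1.
(* Contracting t alone keeps the period in u and starts all paths at the common value of n over t =
   0. *)
pose F (x : R * (R * R)) := n (x.1 * x.2.1, x.2.2).
have hF (r : R) x : 0 <= r <= 1 -> box x ->
     [/\ qcts F (r, x), qunit (F (r, x)) & qimag (F (r, x))].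
  move=> _ _; have [u i] := nui (r * x.1, x.2); split => //.
  by apply: (@qcts_comp _ _ _ n (fun x : R * (R * R) => (x.1 * x.2.1, x.2.2))) => //; cts.
have [N N0 [pos hN]] := lift_path (@compact_box R) hF.
have [u00 i00] := nui (0, 0).
have [p0 up0 ep0] := eigenvector_exists u00 i00.
pose psi x := transport (sample N F x) N * p0.
have ob (p : R * R) : obox p -> box p by move=> [/ltW ? /ltW ?].
have hpsi : sphere_lift n psi.
  move=> p hp; have [c u e] := hN p hp; split.
  - by apply: qctsM c _; exact: qcts_cst.
  - exact: qunitM.
  - move: e; rewrite /F /= mul1r mul0r n0 -surjective_pairing => e.
    by rewrite /psi mulrA e -!mulrA ep0.
have psi0 u : psi (0, u) = psi (0, 0).
  rewrite /psi; congr (_ * _); apply: eq_transport => j _.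
  by rewrite /sample /F /= mulr0 n0.
have psiper t u : psi (t, u + 2 * pi) = psi (t, u).
  rewrite /psi; congr (_ * _); apply: eq_transport => j _.
  by rewrite /sample /F /= nper.
have [b [D W]] := lift_winding hpsi npi psi0 psiper.
exists D; first by exists psi, b.
have : qC1 (@obox R) psi.
  apply: qC1M; last exact: qC1_cst.
  apply: qC1_transport => [j|p j hp jN]; last exact: (pos j p jN (ob p hp)).
  exact: qC1_scale1.
move=> [psit [psiu hder]].
have d2 : qder2 psi psit psiu by [].
have upsi p : obox p -> qunit (psi p) by move=> /ob /hpsi[].
have nE p : obox p -> n p = psi p * qI R * qconj (psi p).
  by move=> hp; have [_ u e] := hpsi _ (ob _ hp); rewrite -e -mulrA qmul_conj ?mulr1.
have dens p : obox p ->
    qre (n p * nt p * nu p) = 4 * qdot (psit p * qI R) (psiu p).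
  move=> hp; have [dt du _ _ _] := hder p hp; have [nt' nu'] := nder p.
  have nearT : \forall t \near p.1, obox (t, p.2).
    by apply: filterS (near_norm_lt hp.1) => t ht; split => //; exact: hp.2.
  have nearU : \forall u \near p.2, obox (p.1, u).
    by apply: filterS (near_norm_lt hp.2) => t ht; split => //; exact: hp.1.
  have u := upsi p hp.
  have unit_orth (f : R -> quat) x d : dquat f x d -> (\forall y \near x, qunit (f y)) ->
      qdot (f x) d = 0.
    move=> df uf; have h0 : is_derive x (1 : R) (fun y => qdot (f y) (f y)) 0.
      apply: near_eq_is_derive (rder_cst 1 x).
      by apply: filterS uf => y ->.
    have := rder_unique (rder_dot df df) h0; rewrite [qdot d _]qdotC.
    by lra.
  have o1 : qdot (psi p) (psit p) = 0.
    have := unit_orth _ _ _ dt; rewrite -surjective_pairing; apply.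
    by apply: filterS nearT => t /upsi.
  have o2 : qdot (psi p) (psiu p) = 0.
    have := unit_orth _ _ _ du; rewrite -surjective_pairing; apply.
    by apply: filterS nearU => t /upsi.
  have prodder (f : R -> quat) x d : dquat f x d ->
      dquat (fun y => f y * qI R * qconj (f y)) x
        (d * qI R * qconj (f x) + f x * qI R * qconj d).
    move=> df; have := dquatM (dquatM df (dquat_cst (qI R) x)) (dquat_conj df).
    by rewrite mulr0 addr0.
  have E1 : nt p = psit p * qI R * qconj (psi p) + psi p * qI R * qconj (psit p).
    apply: (dquat_unique nt'); have := prodder _ _ _ dt; rewrite -!surjective_pairing.
    by apply: dquat_near; apply: filterS nearT => t /nE ->.
  have E2 : nu p = psiu p * qI R * qconj (psi p) + psi p * qI R * qconj (psiu p).
    apply: (dquat_unique nu'); have := prodder _ _ _ du; rewrite -!surjective_pairing.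
    by apply: dquat_near; apply: filterS nearU => t /nE ->.
  by rewrite E1 E2 nE //; exact: area_density.
have per0 t : psi (t, 2 * pi) = psi (t, 0) by rewrite -[2 * pi]add0r psiper.
pose w t := integ 0 (2 * pi) (fun u => qdot (psit (t, u) * qI R) (psiu (t, u))).
have wder t : 0 <= t <= pi -> is_derive t (1 : R) (circulation psi psiu) (2 * w t).
  by move=> /seg ht; apply: circulation_derive.
have cpsi p : obox p -> rcts (fun p => qdot (psit p * qI R) (psiu p)) p.
  move=> /hder[_ _ _ ? ?]; apply: rcts_dot => //.
  by apply: qctsM => //; exact: qcts_cst.
have wcts : seg_cts 0 pi (fun t => 2 * w t).
  move=> t /seg ht; apply: rctsM; first exact: rcts_cst.
  apply: (@integ_param _ _ _ (fun p => qdot (psit p * qI R) (psiu p))); first exact: ltW.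
    by move=> u hu; apply: cpsi; exact: seg_obox.
  apply: filterS (near_norm_lt ht) => s hs u hu; apply: (@rcts_slice2 (fun p => qdot (psit p * qI R) (psiu p))).
  by apply: cpsi; exact: seg_obox.
have -> : integ 0 pi (fun t => integ 0 (2 * pi)
      (fun u => qre (n (t, u) * nt (t, u) * nu (t, u)))) =
    integ 0 pi (fun t => 2 * (2 * w t)).
  apply: integ_eq => t /seg ht.
  have -> : 2 * (2 * w t) = 4 * w t by ring.
  rewrite -integZ; first by apply: integ_eq => u hu; apply: dens; exact: seg_obox.
  by move=> u hu; apply: (@rcts_slice2 (fun p => qdot (psit p * qI R) (psiu p))); apply: cpsi; exact: seg_obox.
rewrite integZ //.
have -> : integ 0 pi (fun t => 2 * w t) = circulation psi psiu pi - circulation psi psiu 0.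
  exact: integ_FTC.
have -> : circulation psi psiu 0 = 0.
  transitivity (integ 0 (2 * pi) (fun=> 0 : R)); last by rewrite integ_cst ?mul0r // ltW.
  apply: integ_eq => u hu.
  have z10 : `|0 : R| < 10 by rewrite normr0.
  have [_ du _ _ _] := hder (0, u) (seg_obox z10 hu).
  have -> : psiu (0, u) = 0.
    apply: (dquat_unique du); rewrite /=.
    have -> : (fun u => psi (0, u)) = fun=> psi (0, 0) by apply/funext => v.
    exact: dquat_cst.
  by rewrite /qdot !qE /=; ring.
have [_ _ _ hb bD] := W.
have hpi : `|pi : R| < 10 by apply: seg; rewrite lexx ltW.
rewrite /circulation (@circulation_phase R (fun u => psi (pi, u)) (fun u => psiu (pi, u)) b) //.
- by rewrite bD; ring.
- by apply: upsi; split => //=; rewrite normr0.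
- move=> u hu; have [_ du _ _ c] := hder (pi, u) (seg_obox hpi hu); split => //.
  exact: qcts_slice2.
Qed.

End AreaWinding.

(** * Maps with Klein symmetry *)

Section KleinSymmetry.
Variable R : realType.
Local Notation quat := (quat R).

(** Points of this square stay in [box] under both half-turns of the chart, as 6 + pi < 10. *)
Definition hbox : set (R * R) := [set p | `|p.1| <= 6 /\ `|p.2| <= 6].

Lemma compact_hbox : compact hbox.
Proof.
have -> : hbox = (`[-6, 6]%classic : set R) `*` (`[-6, 6]%classic : set R).
  by apply/seteqP; split => -[x y] [/=]; rewrite ?in_itv /= -?ler_norml; split; rewrite /= ?in_itv /= -?ler_norml.
by apply: compact_setX; exact: segment_compact.
Qed.

Lemma hbox_scale (r : R) p : 0 <= r <= 1 -> hbox p -> hbox (r * p.1, r * p.2).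
Proof.
move=> /andP[r0 r1] [/= h1 h2]; split=> /=; rewrite normrM ger0_norm //.
  by apply: le_trans h1; rewrite ler_piMl.
by apply: le_trans h2; rewrite ler_piMl.
Qed.

(** The logarithm is fixed only up to the value of z at the origin, which cancels when two points
    are compared. *)
Lemma phase_log_hbox (z : R * R -> quat) :
  (forall p, hbox p -> [/\ qcts z p, qunit (z p) & qcplx (z p)]) ->
  exists a : R * R -> R, (forall p, hbox p -> rcts a p) /\
    forall p q, hbox p -> hbox q -> qexp (a p - a q) = z p * qconj (z q).
Proof.
move=> hz.
have [|a ha] := @phase_log _ _ hbox
    (fun x : R * (R * R) => z (x.1 * x.2.1, x.1 * x.2.2)) compact_hbox.
  move=> r p r01 hp; have [c ? ?] := hz _ (hbox_scale r01 hp); split => //.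
  by apply: (@qcts_comp _ _ _ z (fun x : R * (R * R) => (x.1 * x.2.1, x.1 * x.2.2))) => //; cts.
exists a; split => [p hp|p q hp hq]; first by have [] := ha p hp.
have h00 : hbox (0, 0) by split; rewrite normr0.
have [_ u0 k0] := hz _ h00.
have e p' : hbox p' -> z p' = z (0, 0) * qexp (a p').
  move=> hp'; have [_] := ha p' hp'; rewrite !mul1r !mul0r.
  by case: (p').
rewrite (e p) // (e q) // qconjM -qexpN mulrA -(mulrA _ (qexp (a p))) -qexpD.
by rewrite (qcplxC k0 (qcplx_exp _)) -mulrA qmul_conj ?mulr1.
Qed.

Lemma rcts_opp_arg (f : R -> R) x : rcts f (- x) -> rcts (fun y => f (- y)) x.
Proof. by apply: (@continuous_comp _ _ _ (fun v => - v) f); rewrite -/(rcts _ _); cts. Qed.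

Lemma rcts_add_arg (f : R -> R) c x : rcts f (x + c) -> rcts (fun y => f (y + c)) x.
Proof. by apply: (@continuous_comp _ _ _ (fun v => v + c) f); rewrite -/(rcts _ _); cts. Qed.

(* a and b are the half-turns (t, u) |-> (t, u + pi) and (pi - t, - u) of the
   sphere in its chart, ga and gb their lifts to the bundle. *)
Lemma klein_winding (n ga gb : R * R -> quat) (e : quat) D :
  has_winding n D -> qexp (pi * D) = 1 -> qexp (pi * D / 2) = - 1 ->
  (e = 1 \/ e = - 1) ->
  (forall p, qcts ga p /\ qunit (ga p)) -> (forall p, qcts gb p /\ qunit (gb p)) ->
  (forall u, ga (0, u) = ga (0, 0)) -> (forall u, gb (0, u) = gb (0, 0)) ->
  (forall t u, ga (t, u + 2 * pi) = ga (t, u)) ->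
  (forall t u, gb (t, u + 2 * pi) = gb (t, u)) ->
  (forall t u, n (t, u + pi) * ga (t, u) = ga (t, u) * n (t, u)) ->
  (forall t u, n (pi - t, - u) * gb (t, u) = gb (t, u) * n (t, u)) ->
  (forall t u, ga (t, u + pi) * ga (t, u) = e) ->
  (forall t u, gb (pi - t, - u) * gb (t, u) = e) ->
  (forall t u, ga (pi - t, - u) * gb (t, u) = e * (gb (t, u + pi) * ga (t, u))) ->
  (e = 1 -> [/\ ga (0, 0) = 1, gb (pi / 2, 0) = 1 &
                ga (pi / 2, - (pi / 2)) * gb (pi / 2, pi / 2) = 1]) ->
  False.
Proof.
move=> [psi [b [hpsi psi0 psiper hb bD]]] qD qD2 he hga hgb ga0 gb0 gaper gbper
  nga ngb aa bb ab base.
have pi4 := @pi_lt4 R; have pi0 := @pi_gt0 R.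
have pi10 : `|pi : R| <= 10 by rewrite gtr0_norm //; lra.
have n10 : `|0 : R| <= 10 by rewrite normr0.
have hpi0 : box (pi : R, 0) := conj pi10 n10.
have ec x : e * x = x * e by case: he => ->; rewrite ?mul1r ?mulr1 ?mulN1r ?mulrN1.
have ee : e * e = 1 by case: he => ->; rewrite ?mulr1 // mulrNN mulr1.
have ue : qunit e by case: he => ->; [exact: qunit1|apply: qunitN; exact: qunit1].
(* [ga p * psi p] and psi at the rotated point are eigenvectors of the same value of n. The phases
   chi and kap between them turn relations between ga and gb into relations between complex
   numbers. *)
pose chi p := qconj (ga p * psi p) * psi (p.1, p.2 + pi).
pose kap p := qconj (gb p * psi p) * psi (pi - p.1, - p.2).
have bx1 p : hbox p -> box p.
  by move=> [h1 h2]; split; [apply: le_trans h1 _|apply: le_trans h2 _]; clear; lra.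
have bx2 p : hbox p -> box (p.1, p.2 + pi).
  move=> [/=]; rewrite !ler_norml => /andP[u1 u2] /andP[u3 u4].
  by split; rewrite /= ler_norml; apply/andP; split; clear - pi0 pi4 u1 u2 u3 u4; lra.
have bx3 p : hbox p -> box (pi - p.1, - p.2).
  move=> [/=]; rewrite !ler_norml => /andP[u1 u2] /andP[u3 u4].
  by split; rewrite /= ler_norml; apply/andP; split; clear - pi0 pi4 u1 u2 u3 u4; lra.
have upsi p : box p -> qunit (psi p) by move=> /hpsi[].
have chiE p : box p -> psi (p.1, p.2 + pi) = ga p * psi p * chi p.
  by move=> hp; rewrite /chi mulrA qmul_conj ?mul1r //; apply: qunitM; [have [] := hga p|exact: upsi].
have kapE p : box p -> psi (pi - p.1, - p.2) = gb p * psi p * kap p.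
  by move=> hp; rewrite /kap mulrA qmul_conj ?mul1r //; apply: qunitM; [have [] := hgb p|exact: upsi].
have nga' p : n (p.1, p.2 + pi) * ga p = ga p * n p by case: p.
have ngb' p : n (pi - p.1, - p.2) * gb p = gb p * n p by case: p.
have hchi p : hbox p -> [/\ qcts chi p, qunit (chi p) & qcplx (chi p)].
  move=> hp; have [c1 u1 e1] := hpsi _ (bx1 _ hp); have [c2 u2 e2] := hpsi _ (bx2 _ hp).
  have [c3 u3] := hga p; split.
  - apply: qctsM; first by apply: qcts_conj; exact: qctsM.
    by apply: (@qcts_comp _ _ _ psi (fun p : R * R => (p.1, p.2 + pi))) => //; cts.
  - by apply: qunitM => //; apply: qunit_conj; exact: qunitM.
  - apply: (qcplx_ratio (qunitM u3 u1) _ e2).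
    by rewrite mulrA nga' -mulrA e1 mulrA.
have hkap p : hbox p -> [/\ qcts kap p, qunit (kap p) & qcplx (kap p)].
  move=> hp; have [c1 u1 e1] := hpsi _ (bx1 _ hp); have [c2 u2 e2] := hpsi _ (bx3 _ hp).
  have [c3 u3] := hgb p; split.
  - apply: qctsM; first by apply: qcts_conj; exact: qctsM.
    by apply: (@qcts_comp _ _ _ psi (fun p : R * R => (pi - p.1, - p.2))) => //; cts.
  - by apply: qunitM => //; apply: qunit_conj; exact: qunitM.
  - apply: (qcplx_ratio (qunitM u3 u1) _ e2).
    by rewrite mulrA ngb' -mulrA e1 mulrA.
have chiD p : chi p = qconj (ga p * psi p) * psi (p.1, p.2 + pi) by [].
have kapD p : kap p = qconj (gb p * psi p) * psi (pi - p.1, - p.2) by [].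
clearbody chi kap.
have [B [Bc BE]] := phase_log_hbox hchi.
have [G [Gc GE]] := phase_log_hbox hkap.
have hb6 (t u : R) : `|t| <= 6 -> `|u| <= 6 -> hbox (t, u) by [].
have n0 : `|0 : R| <= 6 by rewrite normr0.
have i6 (x : R) : - 6 <= x -> x <= 6 -> `|x| <= 6 by rewrite ler_norml => -> ->.
have i10 (x : R) : - 10 <= x -> x <= 10 -> `|x| <= 10 by rewrite ler_norml => -> ->.
have np2 : `|pi / 2 : R| <= 6 by apply: i6; clear - pi0 pi4; lra.
have central (p x : quat) : qunit p -> p = e * p * x -> x = e.
  by move=> up E; apply: (qmulIl up); rewrite -ec [in RHS]E !mulrA ee mul1r.
(* The square of a is the rotation by 2 pi in u, which leaves psi unchanged. *)
have chi2 (t u : R) : `|t| <= 6 -> - 6 <= u -> u + pi <= 6 -> chi (t, u) * chi (t, u + pi) = e.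
  move=> ht hu hu'.
  have h1 : hbox (t, u) by apply: hb6 => //; apply: i6; clear - pi0 hu hu'; lra.
  have h2 : hbox (t, u + pi) by apply: hb6 => //; apply: i6; clear - pi0 hu hu'; lra.
  apply: (central _ _ (upsi _ (bx1 _ h1))).
  have := chiE _ (bx1 _ h2); rewrite /= (_ : u + pi + pi = u + 2 * pi); last by ring.
  by rewrite psiper [psi (t, u + pi)](chiE (t, u)) /= ?mulrA ?aa //; exact: bx1.
have kap2 t u : `|t| <= 6 -> `|pi - t| <= 6 -> `|u| <= 6 ->
    kap (t, u) * kap (pi - t, - u) = e.
  move=> ht ht' hu.
  have h1 : hbox (t, u) by [].
  have h2 : hbox (pi - t, - u) by split => //=; rewrite normrN.
  apply: (central _ _ (upsi _ (bx1 _ h1))).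
  have := kapE _ (bx1 _ h2); rewrite /= opprK subKr.
  by rewrite [psi (pi - t, - u)](kapE (t, u)) /= ?mulrA ?bb //; exact: bx1.
(* Both sides describe the action of a b = b a on the lift. *)
have chikap t u : `|t| <= 6 -> `|pi - t| <= 6 -> `|u| <= 6 -> `|u + pi| <= 6 ->
    e * (kap (t, u) * chi (pi - t, - u)) = chi (t, u) * kap (t, u + pi).
  move=> ht ht' hu hu'.
  have h1 : hbox (t, u) by [].
  have h2 : hbox (pi - t, - u) by split => //=; rewrite normrN.
  have h3 : hbox (t, u + pi) by [].
  have := chiE _ (bx1 _ h2).
  rewrite /= [psi (pi - t, - u)](kapE (t, u)) /=; last exact: bx1.
  have := kapE _ (bx1 _ h3).
  rewrite /= [psi (t, u + pi)](chiE (t, u)) /=; last exact: bx1.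
  rewrite (_ : - u + pi = - (u + pi) + 2 * pi); last by ring.
  rewrite psiper => -> E.
  have ug : qunit (gb (t, u + pi) * ga (t, u) * psi (t, u)).
    apply: qunitM; last exact: upsi (bx1 _ h1).
    by apply: qunitM; [have [] := hgb (t, u + pi)|have [] := hga (t, u)].
  apply: (qmulIl ug); rewrite !mulrA in E *; rewrite E.
  by rewrite ab -!ec !mulrA.
have lim (f : R -> R) c d w : c <= d -> (forall x, c <= x <= d -> rcts f x) ->
    (forall x, c <= x <= d -> qexp (f x) = w) -> f d = f c.
  move=> cd hc hw; apply: (qexp_const cd) => // x hx; rewrite !hw //.
  by rewrite lexx cd.
have Bct t u : `|t| <= 6 -> `|u| <= 6 -> rcts (fun t => B (t, u)) t.
  by move=> *; apply: rcts_slice1; exact: Bc.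
have Bcu t u : `|t| <= 6 -> `|u| <= 6 -> rcts (fun u => B (t, u)) u.
  by move=> *; apply: rcts_slice2; exact: Bc.
have Gct t u : `|t| <= 6 -> `|u| <= 6 -> rcts (fun t => G (t, u)) t.
  by move=> *; apply: rcts_slice1; exact: Gc.
have Gcu t u : `|t| <= 6 -> `|u| <= 6 -> rcts (fun u => G (t, u)) u.
  by move=> *; apply: rcts_slice2; exact: Gc.
(* The equator t = h is preserved by both half-turns, which send u to u + pi and to - u. *)
set h := pi / 2 in np2 base *.
have hh : pi = 2 * h by rewrite /h; field.
have h0 : 0 < h by rewrite /h; clear - pi0; lra.
have h2 : h < 2 by rewrite /h; clear - pi4; lra.
clearbody h.
have hpiE : - h + pi = h :> R by clear - hh; lra.
have t6 (t : R) : 0 <= t <= h -> `|t| <= 6 /\ `|pi - t| <= 6.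
  by move=> /andP[u1 u2]; split; apply: i6; clear - u1 u2 h0 h2 hh; lra.
have nh : `|- h| <= 6 by rewrite normrN.
have BE' p q : hbox p -> hbox q -> qexp (B p) * qconj (qexp (B q)) = chi p * qconj (chi q).
  by move=> hp hq; rewrite -qexpN -qexpD BE.
have GE' p q : hbox p -> hbox q -> qexp (G p) * qconj (qexp (G q)) = kap p * qconj (kap q).
  by move=> hp hq; rewrite -qexpN -qexpD GE.
have chi0 u : `|u| <= 6 -> chi (0, u) = chi (0, 0).
  move=> hu; rewrite !chiD /= add0r ga0 psi0; last by apply: le_trans hu _; clear; lra.
  congr (_ * _); move: hu; rewrite ler_norml => /andP[u1 u2].
  by rewrite (psi0 (u + pi)) ?(psi0 pi) //; apply: i10; clear - u1 u2 h0 h2 hh; lra.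
have B0 u : `|u| <= h -> B (0, u) = B (0, 0).
  move=> hu.
  have q6 v : `|v| <= h -> `|v| <= 6 by move=> hv; apply: le_trans hv _; clear - h2; lra.
  have q v : `|v| <= h -> qexp (B (0, v)) = qexp (B (0, 0)).
    move=> /q6 hv; apply: (qmulIr (qunit_conj (qunit_exp (B (0, 0))))).
    by rewrite !BE' ?chi0.
  have [m1 m2] : - h <= u /\ u <= h by move: hu; rewrite ler_norml => /andP[].
  have [u0|/ltW u0] := leP 0 u.
    apply: (lim (fun v => B (0, v)) 0 u (qexp (B (0, 0)))) => // v /andP[v1 v2].
      apply: Bcu => //; apply: q6; rewrite ler_norml; apply/andP.
      by split; clear - v1 v2 m1 m2 h0; lra.
    by apply: q; rewrite ler_norml; apply/andP; split; clear - v1 v2 m1 m2 h0; lra.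
  symmetry; apply: (lim (fun v => B (0, v)) u 0 (qexp (B (0, 0)))) => // v /andP[v1 v2].
    apply: Bcu => //; apply: q6; rewrite ler_norml; apply/andP.
    by split; clear - v1 v2 m1 m2 h0; lra.
  by apply: q; rewrite ler_norml; apply/andP; split; clear - v1 v2 m1 m2 h0; lra.
have chi2' (t : R) : `|t| <= 6 -> chi (t, - h) * chi (t, h) = e.
  have a1 : - 6 <= - h by clear - h2; lra.
  have a2 : - h + pi <= 6 by clear - hh h2; lra.
  move=> ht; rewrite -(chi2 t (- h) ht a1 a2).
  by rewrite hpiE.
have hle : `|h| <= h by rewrite gtr0_norm.
have hle' : `|- h| <= h by rewrite normrN.
(* The half-turn a exchanges (t, - h) and (t, h) up to a period, so chi multiplies to e over them
   for every t; the sum of the logarithms can be evaluated at the pole, where chi does not depend on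
   u. *)
have hB : B (h, - h) + B (h, h) = 2 * B (0, 0).
  rewrite [RHS](_ : _ = B (0, - h) + B (0, h)); last first.
    by rewrite (B0 h) // (B0 (- h)) //; clear; lra.
  have := lim (fun t => B (t, - h) + B (t, h)) 0 h
     (qconj (chi (0, 0)) * qexp (B (0, 0)) * e * (qconj (chi (0, 0)) * qexp (B (0, 0)))) (ltW h0).
  apply => t /t6[ht _].
    by apply: rctsD; exact: Bct.
  have q p : hbox p -> qexp (B p) = chi p * (qconj (chi (0, 0)) * qexp (B (0, 0))).
    move=> hp; rewrite mulrA -BE' // -mulrA qconj_mul ?mulr1 //; exact: qunit_exp.
  rewrite qexpD (q (t, - h)) // (q (t, h)) //.
  have [_ _ k1] := hchi (t, - h) (conj ht nh).
  have [_ _ k0] := hchi (0, 0) (conj n0 n0).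
  have kc : qcplx (qconj (chi (0, 0)) * qexp (B (0, 0))).
    by apply: qcplxM; [exact: qcplx_conj|exact: qcplx_exp].
  rewrite -(chi2' t ht); set k := qconj _ * _ in kc *.
  by rewrite (qcplxC k1 kc) !mulrA.
have upi (u : R) : `|u| <= h -> `|u| <= 6 /\ `|u + pi| <= 6.
  by rewrite ler_norml => /andP[u1 u2]; split; apply: i6; clear - u1 u2 h0 h2 hh; lra.
have hpi2 : pi - h = h by clear - hh; lra.
(* The half-turn b exchanges (h, u) and (h, - u), so kap multiplies to e over them; letting u go to
   0 reaches the fixed point (h, 0). *)
have hG : G (h, h) + G (h, - h) = 2 * G (h, 0).
  rewrite [RHS](_ : _ = G (h, 0) + G (h, - 0)); last by rewrite oppr0; clear; lra.
  pose k := qconj (kap (h, 0)) * qexp (G (h, 0)).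
  apply: (lim (fun u => G (h, u) + G (h, - u)) 0 h (e * k * k) (ltW h0)) => u hu.
    have [hu6 _] := t6 _ hu.
    apply: rctsD; first exact: Gcu.
    by apply: (@rcts_opp_arg (fun u => G (h, u))); apply: Gcu; rewrite ?normrN.
  have [hu6 _] := t6 _ hu.
  have q p : hbox p -> qexp (G p) = kap p * k.
    move=> hp; rewrite mulrA -GE' // -mulrA qconj_mul ?mulr1 //; exact: qunit_exp.
  have hb2 : hbox (h, - u) by apply: hb6; rewrite ?normrN.
  rewrite qexpD (q (h, u)) // (q (h, - u)) //.
  have [_ _ k1] := hkap _ hb2.
  have [_ _ k0] := hkap (h, 0) (conj np2 n0).
  have kc : qcplx k by apply: qcplxM; [exact: qcplx_conj|exact: qcplx_exp].
  clearbody k.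
  have := kap2 h u np2; rewrite hpi2 => <- //.
  by rewrite !mulrA -(mulrA _ k) (qcplxC kc k1) !mulrA.
(* The logarithm of the commutation relation on the equator: its exponential is e, so it is
   constant. In f h + f (- h) all terms cancel but the winding of kap around the equator. *)
pose f u := G (h, u + pi) - G (h, u) + B (h, u) - B (h, - u).
have fE u : `|u| <= h -> qexp (f u) = e.
  move=> hu; have [h6 h6'] := upi _ hu.
  rewrite /f -addrA qexpD GE // BE ?normrN //; last by apply: hb6; rewrite ?normrN.
  have [_ u1 k1] := hkap (h, u + pi) (conj np2 h6').
  have [_ u2 k2] := hkap (h, u) (conj np2 h6).
  have [_ u3 k3] := hchi (h, u) (conj np2 h6).
  have hb4 : hbox (h, - u) by apply: hb6; rewrite ?normrN.
  have [_ u4 k4] := hchi _ hb4.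
  rewrite mulrA -(mulrA (kap _)) (qcplxC (qcplx_conj k2) k3) mulrA (qcplxC k1 k3).
  have := chikap h u np2; rewrite hpi2 => <- //.
  by rewrite -!mulrA (mulrA (chi _)) (qcplxC k4 (qcplx_conj k2)) -mulrA qmul_conj ?mulr1 ?qmul_conj ?mulr1.
have f2 : f h = f (- h).
  apply: (lim f (- h) h e) => [|u hu|u hu]; first by clear - h0; lra.
    have [h6 h6'] := upi u (ltac:(by rewrite ler_norml)).
    apply: rctsB; first apply: rctsD; first apply: rctsB.
    - by apply: (@rcts_add_arg (fun u => G (h, u))); exact: Gcu.
    - exact: Gcu.
    - exact: Bcu.
    - by apply: (@rcts_opp_arg (fun u => B (h, u))); apply: Bcu; rewrite ?normrN.
  by apply: fE; rewrite ler_norml.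
have n3 : `|h + pi| <= 6 by apply: i6; clear - h0 h2 hh; lra.
(* The winding of kap around a circle of latitude does not depend on t and can be read off at the
   pole. *)
have hper : G (h, h + pi) - G (h, - h) = G (0, h + pi) - G (0, - h).
  apply: (lim (fun t => G (t, h + pi) - G (t, - h)) 0 h 1 (ltW h0)) => t /t6[ht _].
    by apply: rctsB; exact: Gct.
  rewrite GE //; have hb1 : hbox (t, - h) by [].
  have -> : kap (t, h + pi) = kap (t, - h).
    rewrite !kapD /= (_ : h + pi = - h + 2 * pi); last by clear - hh; lra.
    rewrite gbper psiper; congr (_ * _).
    by rewrite -[LHS]psiper; congr (psi (_, _)); clear; lra.
  by rewrite qmul_conj //; have [] := hkap _ hb1.
have bper : b h - b (h - 2 * pi) = 2 * pi * D.
  rewrite -bD -[in RHS](subrr (2 * pi)).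
  have b10 (u : R) : 0 <= u <= 2 * pi -> `|u| <= 10 /\ `|u - 2 * pi| <= 10.
    by move=> /andP[u1 u2]; split; apply: i10; clear - u1 u2 pi4; lra.
  have l : h <= 2 * pi by clear - h0 hh; lra.
  symmetry; apply: (lim (fun u => b u - b (u - 2 * pi)) h (2 * pi) 1 l) => u /andP[hu1 hu2].
    have [|b1 b2] := b10 u; first by apply/andP; split; clear - hu1 hu2 h0 h2 hh; lra.
    apply: rctsB; first by have [] := hb u b1.
    by apply: (@rcts_add_arg b); have [] := hb _ b2.
  have [|b1 b2] := b10 u; first by apply/andP; split; clear - hu1 hu2 h0 h2 hh; lra.
  rewrite qexpD qexpN.
  have -> : qexp (b u) = qexp (b (u - 2 * pi)).
    apply: (qmulIl (upsi _ hpi0)).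
    have [_ <-] := hb u b1; have [_ <-] := hb _ b2.
    by rewrite -[in RHS]psiper subrK.
  by rewrite qmul_conj //; exact: qunit_exp.
(* The half-turn sends t = 0 to t = pi and u to - u; there psi winds D times, hence the minus
   sign. *)
have hwind : G (0, h + pi) - G (0, - h) = - (2 * pi * D).
  have l : - h <= h + pi by clear - h0 hh; lra.
  have b10 (u : R) : - h <= u <= h + pi -> `|- u| <= 10 /\ `|u| <= 6.
    by move=> /andP[u1 u2]; split; [apply: i10|apply: i6]; clear - u1 u2 h0 h2 hh; lra.
  have : G (0, h + pi) - b (- (h + pi)) = G (0, - h) - b (- - h).
    apply: (lim (fun u => G (0, u) - b (- u)) (- h) (h + pi)
      (qexp (G (0, 0)) * qconj (kap (0, 0)) * qconj (gb (0, 0) * psi (0, 0)) * psi (pi, 0)) l) => u /b10[b1 b2].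
      apply: rctsB; first exact: Gcu.
      by apply: rcts_opp_arg; have [] := hb _ b1.
    have [_ e1] := hb _ b1.
    have hb1 : hbox (0, u) by [].
    have hb0 : hbox (0, 0) by [].
    have -> : qexp (G (0, u) - b (- u)) = qexp (G (0, 0)) * qexp (G (0, u) - G (0, 0)) * qexp (- b (- u)).
      by rewrite -!qexpD; congr qexp; clear; lra.
    rewrite GE //.
    have [_ _ k1] := hkap _ hb1; have [_ _ k0] := hkap _ hb0.
    rewrite (qcplxC k1 (qcplx_conj k0)) -!mulrA; congr (_ * (_ * _)).
    rewrite !kapD /= subr0 gb0 e1 psi0; last by apply: le_trans b2 _; clear; lra.
    by rewrite -!mulrA -qexpD subrr qexp0 mulr1.
  rewrite opprK (_ : - (h + pi) = h - 2 * pi); last by clear - hh; lra.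
  by clear - bper; lra.
have c0 : f (- h) = - (pi * D).
  have : f h + f (- h) = - (2 * pi * D).
    rewrite -hwind -hper /f opprK hpiE.
    by clear; lra.
  by rewrite f2 => E; clear - E; lra.
have e1 : e = 1.
  have <- : qexp (f (- h)) = e by apply: fE; exact: hle'.
  by rewrite c0 qexpN qD; apply: quatP; split; rewrite /= ?oppr0.
(* With [hB] and [hG] the equation [c0] becomes twice this one. Logarithms can be halved, whereas
   phases would leave a sign undetermined, and this sign is the contradiction. *)
have half : G (h, h) - G (h, 0) + (B (0, 0) - B (h, h)) = - (pi * D / 2).
  move: c0; rewrite /f opprK hpiE.
  by move=> E; clear - hG hB E; lra.
have [v1 v2 v3] := base e1.
have hh0 : hbox (h, h) by [].
have h00 : hbox (0, 0) by [].
have hh1 : hbox (h, 0) by [].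
have hh2 : hbox (h, - h) by [].
have chi00 : chi (0, 0) = 1.
  have u00 := upsi _ (bx1 _ h00).
  by rewrite !chiD /= v1 mul1r add0r (psi0 pi pi10) qconj_mul.
have kap0 : kap (h, 0) = 1.
  have u00 := upsi _ (bx1 _ hh1).
  by rewrite !kapD /= v2 mul1r hpi2 oppr0 qconj_mul.
(* The product of the half-turns fixes (h, h), where its lift is 1 by [v3]; so kap (h, h) and chi
   (h, - h) are inverse to each other, as are chi (h, - h) and chi (h, h) by [chi2']. *)
have kapchi : kap (h, h) = chi (h, h).
  have [_ u1 k1] := hkap _ hh0; have [_ u2 k2] := hchi _ hh2.
  apply: (qmulIr u2).
  have [_ _ k3] := hchi _ hh0.
  rewrite (qcplxC k3 k2) chi2' // e1.
  apply: (qmulIl (upsi _ (bx1 _ hh0))); rewrite mulr1.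
  have := chiE _ (bx1 _ hh2); rewrite /= hpiE.
  have := kapE _ (bx1 _ hh0); rewrite /= hpi2 => ->.
  by rewrite !mulrA v3 mul1r => <-.
have := congr1 (@qexp R) half; rewrite qexpD GE // BE // kap0 chi00 qexpN qD2 kapchi.
have [_ u1 _] := hchi _ hh0.
have -> : qconj (1 : quat) = 1 by apply: quatP; split; rewrite /= ?oppr0.
rewrite mulr1 mul1r qmul_conj // => /(congr1 (@qre R)) /=.
by clear; lra.
Qed.

End KleinSymmetry.

(** * Calculus in three variables *)

Section Row3.
Variable R : realType.
Local Notation V := 'rV[R]_3.
Implicit Types (x v : V).

Definition o0 : 'I_3 := 0.
Definition o1 : 'I_3 := 1.
Definition o2 : 'I_3 := 2%:R.

Lemma row3_0 (a b c : R) : row3 a b c 0 o0 = a.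
Proof. by rewrite mxE. Qed.
Lemma row3_1 (a b c : R) : row3 a b c 0 o1 = b.
Proof. by rewrite mxE. Qed.
Lemma row3_2 (a b c : R) : row3 a b c 0 o2 = c.
Proof. by rewrite mxE. Qed.

Lemma ord3P (P : 'I_3 -> Prop) : P o0 -> P o1 -> P o2 -> forall i, P i.
Proof.
move=> h0 h1 h2 [[|[|[|//]]] hi].
- by rewrite (_ : Ordinal hi = o0) //; exact: val_inj.
- by rewrite (_ : Ordinal hi = o1) //; exact: val_inj.
- by rewrite (_ : Ordinal hi = o2) //; exact: val_inj.
Qed.

Lemma row3P (x y : V) : x 0 o0 = y 0 o0 -> x 0 o1 = y 0 o1 -> x 0 o2 = y 0 o2 -> x = y.
Proof.
by move=> h0 h1 h2; apply/rowP; apply: ord3P.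
Qed.

Lemma row3_eta x : x = row3 (x 0 o0) (x 0 o1) (x 0 o2).
Proof. by apply: row3P; rewrite ?row3_0 ?row3_1 ?row3_2. Qed.

Lemma sum3 (M : zmodType) (f : 'I_3 -> M) : \sum_i f i = f o0 + f o1 + f o2.
Proof.
rewrite !big_ord_recl big_ord0 addr0 addrA.
by congr (f _ + f _ + f _); exact: val_inj.
Qed.

Lemma row3E (a b c : R) : row3 a b c =
  a *: delta_mx 0 o0 + b *: delta_mx 0 o1 + c *: delta_mx 0 o2.
Proof.
by apply: row3P; rewrite ?row3_0 ?row3_1 ?row3_2 !mxE /= ?mulr0 ?mulr1 ?addr0 ?add0r.
Qed.

Lemma row3_shift0 (a b c h : R) :
  row3 a b c + h *: delta_mx 0 o0 = row3 (a + h) b c.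
Proof.
by apply: row3P; rewrite mxE [X in _ + X]mxE ?row3_0 ?row3_1 ?row3_2 [delta_mx _ _ _ _]mxE /=
  ?mulr0 ?mulr1 ?addr0.
Qed.

Lemma row3_shift1 (a b c h : R) :
  row3 a b c + h *: delta_mx 0 o1 = row3 a (b + h) c.
Proof.
by apply: row3P; rewrite mxE [X in _ + X]mxE ?row3_0 ?row3_1 ?row3_2 [delta_mx _ _ _ _]mxE /=
  ?mulr0 ?mulr1 ?addr0.
Qed.

Lemma row3_shift2 (a b c h : R) :
  row3 a b c + h *: delta_mx 0 o2 = row3 a b (c + h).
Proof.
by apply: row3P; rewrite mxE [X in _ + X]mxE ?row3_0 ?row3_1 ?row3_2 [delta_mx _ _ _ _]mxE /=
  ?mulr0 ?mulr1 ?addr0.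
Qed.

Lemma cvg_row3 (T : Type) (F : set_system T) {FF : Filter F} (a b c : T -> R) (a0 b0 c0 : R) :
  a @ F --> a0 -> b @ F --> b0 -> c @ F --> c0 ->
  (fun t => row3 (a t) (b t) (c t)) @ F --> row3 a0 b0 c0.
Proof.
move=> ha hb hc; rewrite row3E.
under eq_fun do rewrite row3E.
by apply: cvgD; [apply: cvgD|]; apply: cvgZr_tmp.
Qed.

Lemma rcts_row3 (T : topologicalType) (a b c : T -> R) t :
  rcts a t -> rcts b t -> rcts c t -> rcts (fun t => row3 (a t) (b t) (c t)) t.
Proof. exact: cvg_row3. Qed.

Lemma rcts_coord (i : 'I_3) x : rcts (fun y : V => y 0 i) x.
Proof. exact: coord_continuous. Qed.

Lemma row3_derive1 (a b c : R -> R) t a' b' c' :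
  is_derive t (1 : R) a a' -> is_derive t (1 : R) b b' -> is_derive t (1 : R) c c' ->
  derive1 (fun t => row3 (a t) (b t) (c t)) t = row3 a' b' c'.
Proof.
move=> ha hb hc; rewrite /derive1.
apply: cvg_lim => //.
have q (f : R -> R) f' : is_derive t (1 : R) f f' ->
    h^-1 * (f (h + t) - f t) @[h --> 0^'] --> f'.
  move=> [hd <-].
  have -> : (fun h => h^-1 * (f (h + t) - f t)) = (fun h => h^-1 *: (f (h *: 1 + t) - f t)).
    by apply/funext => h; rewrite /GRing.scale /= mulr1.
  exact: hd.
have -> : (fun h => h^-1 *: (row3 (a (h + t)) (b (h + t)) (c (h + t)) - row3 (a t) (b t) (c t)))
  = fun h => row3 (h^-1 * (a (h + t) - a t)) (h^-1 * (b (h + t) - b t)) (h^-1 * (c (h + t) - c t)).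
  by apply/funext => h; apply: row3P; rewrite !mxE.
by apply: cvg_row3; exact: q.
Qed.

Definition C1v (f : V -> R) := forall x i, rcts f x /\
  derivable f x (delta_mx 0 i) /\ rcts (partial i f) x.

Lemma smooth_C1v f : smooth f -> C1v f.
Proof.
move=> h x i; have [c d] := h [::]; have [c' _] := h [:: i].
by split; [exact: c|split; [exact: d|exact: c']].
Qed.

Lemma partial_der (f : V -> R) x i : derivable f x (delta_mx 0 i) ->
  is_derive (0 : R) (1 : R) (fun s => f (x + s *: delta_mx 0 i)) (partial i f x).
Proof.
have e : (fun h : R => h^-1 *: (f (x + (h *: 1 + 0) *: delta_mx 0 i) - f (x + 0 *: delta_mx 0 i)))
   = (fun h : R => h^-1 *: (f (h *: delta_mx 0 i + x) - f x)).
  apply/funext => h; rewrite !addr0 scale0r addr0 [x + _]addrC.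
  by rewrite (_ : h *: 1 = h) //; exact: mulr1.
move=> hd; split; first by rewrite /derivable /= e.
by rewrite /derive /= e.
Qed.

(* Telescoping over the coordinates; each increment is a difference quotient
   based at the fixed coordinate of the limit point. *)
Lemma C1v_der_curve (f : V -> R) (a b c : R -> R) (t a' b' c' : R) : C1v f ->
  is_derive t (1 : R) a a' -> is_derive t (1 : R) b b' -> is_derive t (1 : R) c c' ->
  is_derive t (1 : R) (fun s => f (row3 (a s) (b s) (c s)))
    (partial o0 f (row3 (a t) (b t) (c t)) * a' +
     partial o1 f (row3 (a t) (b t) (c t)) * b' +
     partial o2 f (row3 (a t) (b t) (c t)) * c').
Proof.
move=> hf ha hb hc.
have hp i x : is_derive (0 : R) (1 : R) (fun s => f (x + s *: delta_mx 0 i)) (partial i f x).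
  by apply: partial_der; have [_ []] := hf x i.
have shift (g : R -> R) s d : is_derive (0 : R) (1 : R) (fun h => g (s + h)) d ->
    is_derive s (1 : R) g d.
  move=> /is_derive1_caratheodory [k [k1 k2 k3]].
  apply/is_derive1_caratheodory; exists (fun z => k (z - s)); split.
  - by move=> z; have := k1 (z - s); rewrite subr0 addr0 subrKC.
  - have : rcts (fun z : R => z - s) s by cts.
    by move=> h; apply: (continuous_comp h); rewrite subrr.
  - by rewrite subrr.
have d0 (x y z : R) : is_derive x (1 : R) (fun s => f (row3 s y z)) (partial o0 f (row3 x y z)).
  have h := hp o0 (row3 x y z).
  have e : (fun h => f (row3 x y z + h *: delta_mx 0 o0)) = (fun h => f (row3 (x + h) y z)).
    by apply/funext => s; rewrite row3_shift0.
  rewrite e in h; exact: (shift (fun s => f (row3 s y z)) x _ h).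
have d1 (x y z : R) : is_derive y (1 : R) (fun s => f (row3 x s z)) (partial o1 f (row3 x y z)).
  have h := hp o1 (row3 x y z).
  have e : (fun h => f (row3 x y z + h *: delta_mx 0 o1)) = (fun h => f (row3 x (y + h) z)).
    by apply/funext => s; rewrite row3_shift1.
  rewrite e in h; exact: (shift (fun s => f (row3 x s z)) y _ h).
have d2 (x y z : R) : is_derive z (1 : R) (fun s => f (row3 x y s)) (partial o2 f (row3 x y z)).
  have h := hp o2 (row3 x y z).
  have e : (fun h => f (row3 x y z + h *: delta_mx 0 o2)) = (fun h => f (row3 x y (z + h))).
    by apply/funext => s; rewrite row3_shift2.
  rewrite e in h; exact: (shift (fun s => f (row3 x y s)) z _ h).
have pc i (T : topologicalType) (x y z : T -> R) s : rcts x s -> rcts y s -> rcts z s ->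
    rcts (fun s => partial i f (row3 (x s) (y s) (z s))) s.
  move=> cx cy cz; apply: (@continuous_comp _ _ _ (fun s => row3 (x s) (y s) (z s)) (partial i f)).
    exact: rcts_row3.
  by have [_ []] := hf (row3 (x s) (y s) (z s)) i.
pose f0 (p : R * (R * R)) := f (row3 p.1 p.2.1 p.2.2).
pose g0 (p : R * (R * R)) := partial o0 f (row3 p.1 p.2.1 p.2.2).
pose f1 (p : R * R) := f (row3 (a t) p.1 p.2).
pose g1 (p : R * R) := partial o1 f (row3 (a t) p.1 p.2).
(* In the third increment only the last coordinate moves; the parameter slot of [dquot] holds a
   dummy 0. *)
pose f2 (p : R * R) := f (row3 (a t) (b t) p.1).
pose g2 (p : R * R) := partial o2 f (row3 (a t) (b t) p.1).
move: ha hb hc => /is_derive1_caratheodory[ka [ka1 ka2 ka3]]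
  /is_derive1_caratheodory[kb [kb1 kb2 kb3]] /is_derive1_caratheodory[kc [kc1 kc2 kc3]].
have cont (g k : R -> R) : (forall z, g z - g t = k z * (z - t)) -> rcts k t -> rcts g t.
  move=> h ck; have -> : g = fun z => g t + k z * (z - t).
    by apply/funext => z; rewrite -h; ring.
  by apply: rctsD; [exact: rcts_cst|apply: rctsM => //; cts].
have ca := cont _ _ ka1 ka2; have cb := cont _ _ kb1 kb2; have cc := cont _ _ kc1 kc2.
have dE (T : Type) (g h : R * T -> R) (x x' : R) u :
    g (x', u) - g (x, u) = dquot g h (x' - x) (x, u) * (x' - x).
  rewrite /dquot; case: eqP => [/eqP|/eqP ne].
    by rewrite subr_eq0 => /eqP ->; rewrite !subrr mulr0.
  by rewrite /= (addrC x) subrK mulrAC mulVf // mul1r.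
apply/is_derive1_caratheodory.
exists (fun z => dquot f0 g0 (a z - a t) (a t, (b z, c z)) * ka z +
  dquot f1 g1 (b z - b t) (b t, c z) * kb z + dquot f2 g2 (c z - c t) (c t, 0 : R) * kc z).
split; last by rewrite !subrr /dquot !eqxx ka3 kb3 kc3.
- move=> z.
  have e0 := dE _ f0 g0 (a t) (a z) (b z, c z).
  have e1 := dE _ f1 g1 (b t) (b z) (c z).
  have e2 := dE _ f2 g2 (c t) (c z) (0 : R).
  rewrite mulrDl mulrDl -!mulrA -ka1 -kb1 -kc1 -e0 -e1 -e2 /f0 /f1 /f2 /=.
  by ring.
- have k0 : rcts (fun z => dquot f0 g0 (a z - a t) (a t, (b z, c z))) t.
    have k : rcts (fun z => (a z - a t, (b z, c z))) t.
      by apply: cts_pair; [apply: rctsB => //; exact: rcts_cst|exact: cts_pair].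
    apply: (@continuous_comp _ _ _ _ (fun x : R * (R * R) => dquot f0 g0 x.1 (a t, x.2)) _ k).
    rewrite subrr; apply: dquot_cts.
      by exists (setT, setT) => [|p _]; [split; exact: filterT|exact: d0].
    by apply: pc; cts.
  have k1 : rcts (fun z => dquot f1 g1 (b z - b t) (b t, c z)) t.
    have k : rcts (fun z => (b z - b t, c z)) t.
      by apply: cts_pair => //; apply: rctsB => //; exact: rcts_cst.
    apply: (@continuous_comp _ _ _ _ (fun x : R * R => dquot f1 g1 x.1 (b t, x.2)) _ k).
    rewrite subrr; apply: dquot_cts.
      by exists (setT, setT) => [|p _]; [split; exact: filterT|exact: d1].
    by apply: pc; cts.
  have k2 : rcts (fun z => dquot f2 g2 (c z - c t) (c t, 0 : R)) t.
    have k : rcts (fun z => (c z - c t, 0 : R)) t.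
      by apply: cts_pair; [apply: rctsB => //; exact: rcts_cst|exact: cts_cst].
    apply: (@continuous_comp _ _ _ _ (fun x : R * R => dquot f2 g2 x.1 (c t, x.2)) _ k).
    rewrite subrr; apply: dquot_cts.
      by exists (setT, setT) => [|p _]; [split; exact: filterT|exact: d2].
    by apply: pc; cts.
  by rewrite -/(rcts _ _); do ?apply: rctsD; apply: rctsM.
Qed.

Lemma C1_comp3 (f : V -> R) (O : set (R * R)) (a b c : R * R -> R) : C1v f ->
  C1 O a -> C1 O b -> C1 O c -> C1 O (fun p => f (row3 (a p) (b p) (c p))).
Proof.
move=> hf [at_ [au ha]] [bt [bu hb]] [ct [cu hc]].
pose x p := row3 (a p) (b p) (c p).
exists (fun p => partial o0 f (x p) * at_ p + partial o1 f (x p) * bt p + partial o2 f (x p) * ct p),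
  (fun p => partial o0 f (x p) * au p + partial o1 f (x p) * bu p + partial o2 f (x p) * cu p).
move=> p Op; have [a1 a2 a3 a4 a5] := ha p Op; have [b1 b2 b3 b4 b5] := hb p Op.
have [c1 c2 c3 c4 c5] := hc p Op.
have xc : rcts x p by exact: rcts_row3.
have pc i : rcts (fun p => partial i f (x p)) p.
  apply: (@continuous_comp _ _ _ x (partial i f)) => //.
  by have [_ []] := hf (x p) i.
split.
- by have := C1v_der_curve hf a1 b1 c1; rewrite -surjective_pairing.
- by have := C1v_der_curve hf a2 b2 c2; rewrite -surjective_pairing.
- apply: (@continuous_comp _ _ _ x f) => //; by have [] := hf (x p) o0.
- by do ?apply: rctsD; apply: rctsM.
- by do ?apply: rctsD; apply: rctsM.
Qed.

End Row3.

(** * Quaternionic form of the monopole fields *)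

Lemma det2 (K : comNzRingType) (A : 'M[K]_2) :
  \det A = A 0 0 * A 1 1 - A 0 1 * A 1 0.
Proof.
rewrite (expand_det_row _ 0) !big_ord_recl big_ord0 addr0 /cofactor !det_mx11 !mxE /=.
have -> : lift 0 0 = 1 :> 'I_2 by exact: val_inj.
have -> : lift 1 0 = 0 :> 'I_2 by exact: val_inj.
by rewrite /bump /= !addn0 ?expr0 ?expr1 !mul1r mulN1r mulrN.
Qed.

Lemma det3 (K : comNzRingType) (A : 'M[K]_3) : \det A =
  A 0 0 * (A 1 1 * A 2%:R 2%:R - A 1 2%:R * A 2%:R 1)
  - A 0 1 * (A 1 0 * A 2%:R 2%:R - A 1 2%:R * A 2%:R 0)
  + A 0 2%:R * (A 1 0 * A 2%:R 1 - A 1 1 * A 2%:R 0).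
Proof.
rewrite (expand_det_row _ 0) !big_ord_recl big_ord0 addr0 /cofactor !det2 !mxE /=.
(* Indexing by natural numbers makes equal indices that are presented as different nested lifts
   identical. *)
pose f (m n : nat) := A (inord m) (inord n).
have E i j : A i j = f i j by rewrite /f !inord_val.
by rewrite !E /= /bump /= !addn0 ?addn1 !expr0 ?expr1 sqrrN expr1n; ring.
Qed.

Section SU2Quaternions.
Variable R : realType.
Local Open Scope complex_scope.
Local Open Scope sesquilinear_scope.
Local Notation quat := (quat R).
Local Notation M2 := 'M[R[i]]_2.
Implicit Types X Y : M2.

Lemma cReM (x y : R[i]) : complex.Re (x * y) =
  complex.Re x * complex.Re y - complex.Im x * complex.Im y.
Proof. by case: x; case: y. Qed.
Lemma cImM (x y : R[i]) : complex.Im (x * y) =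
  complex.Re x * complex.Im y + complex.Im x * complex.Re y.
Proof. by case: x; case: y. Qed.
Lemma cReD (x y : R[i]) : complex.Re (x + y) = complex.Re x + complex.Re y.
Proof. by case: x; case: y. Qed.
Lemma cImD (x y : R[i]) : complex.Im (x + y) = complex.Im x + complex.Im y.
Proof. by case: x; case: y. Qed.
Lemma cReN (x : R[i]) : complex.Re (- x) = - complex.Re x.
Proof. by case: x. Qed.
Lemma cImN (x : R[i]) : complex.Im (- x) = - complex.Im x.
Proof. by case: x. Qed.
Lemma cReJ (x : R[i]) : complex.Re (Num.conj x) = complex.Re x.
Proof. by case: x. Qed.
Lemma cImJ (x : R[i]) : complex.Im (Num.conj x) = - complex.Im x.
Proof. by case: x. Qed.

Definition cE := (cReM, cImM, cReD, cImD, cReN, cImN, cReJ, cImJ).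

Lemma sum2 (M : zmodType) (f : 'I_2 -> M) : \sum_i f i = f 0 + f 1.
Proof.
rewrite !big_ord_recl big_ord0 addr0.
by congr (f _ + f _); exact: val_inj.
Qed.

(* The quaternion alpha + beta j, alpha and beta the first row of X. *)
Definition toq X : quat := Quat (complex.Re (X 0 0)) (complex.Im (X 0 0))
  (complex.Re (X 0 1)) (complex.Im (X 0 1)).

(** The matrices whose second row is (- conj beta, conj alpha), the usual image of the quaternions.
    As [toq] reads the first row, a product is controlled by this property of its right factor. *)
Definition qform X :=
  [/\ complex.Re (X 1 1) = complex.Re (X 0 0),
      complex.Im (X 1 1) = - complex.Im (X 0 0),
      complex.Re (X 1 0) = - complex.Re (X 0 1) &
      complex.Im (X 1 0) = complex.Im (X 0 1)].

Lemma toqM X Y : qform Y -> toq (X *m Y) = toq X * toq Y.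
Proof.
move=> [h1 h2 h3 h4]; apply: quatP; split;
  by rewrite !qE /= !mxE !sum2 !cE ?h1 ?h2 ?h3 ?h4; ring.
Qed.

Lemma toqD X Y : toq (X + Y) = toq X + toq Y.
Proof. by apply: quatP; split; rewrite !qE /= !mxE !cE. Qed.

Lemma toqN X : toq (- X) = - toq X.
Proof. by apply: quatP; split; rewrite !qE /= !mxE !cE. Qed.

Lemma toqZ (r : R) X : toq (r%:C *: X) = qR r * toq X.
Proof. by apply: quatP; split; rewrite !qE /= !mxE !cE /=; ring. Qed.

Lemma su2_quat X : su2 X -> qform X /\ qimag (toq X).
Proof.
move=> [h t].
have e00 := congr1 (fun M : M2 => M 0 0) h.
have e01 := congr1 (fun M : M2 => M 0 1) h.
rewrite !mxE in e00 e01.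
have r0 := congr1 (@complex.Re R) e00; rewrite !cE in r0.
have r1 := congr1 (@complex.Re R) e01; rewrite !cE in r1.
have i1 := congr1 (@complex.Im R) e01; rewrite !cE in i1.
rewrite /mxtrace sum2 in t.
have rt := congr1 (@complex.Re R) t; rewrite !cE /= in rt.
have it := congr1 (@complex.Im R) t; rewrite !cE /= in it.
by split; [split|rewrite /qimag /=]; lra.
Qed.

Lemma SU2_quat X : SU2 X -> qform X /\ qunit (toq X).
Proof.
move=> [/unitarymxP h]; rewrite det2 => D.
have e00 := congr1 (fun M : M2 => M 0 0) h.
have e10 := congr1 (fun M : M2 => M 1 0) h.
rewrite !mxE !sum2 !mxE /= in e00 e10.
have E1 : Num.conj (X 0 0) = X 1 1.
  apply/eqP; rewrite -subr_eq0; apply/eqP.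
  (* Cramer's rule spelled out: the last factors are the equations det X = 1 and X X^* = 1, so each
     term vanishes. *)
  transitivity (- Num.conj (X 0 0) * (X 0 0 * X 1 1 - X 0 1 * X 1 0 - 1)
    + X 1 1 * (X 0 0 * Num.conj (X 0 0) + X 0 1 * Num.conj (X 0 1) - 1)
    - X 0 1 * (X 1 0 * Num.conj (X 0 0) + X 1 1 * Num.conj (X 0 1))); first by ring.
  by rewrite D e00 e10 !subrr !mulr0 subr0 addr0.
have E2 : Num.conj (X 0 1) = - X 1 0.
  apply/eqP; rewrite -subr_eq0 opprK; apply/eqP.
  transitivity (- Num.conj (X 0 1) * (X 0 0 * X 1 1 - X 0 1 * X 1 0 - 1)
    - X 1 0 * (X 0 0 * Num.conj (X 0 0) + X 0 1 * Num.conj (X 0 1) - 1)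
    + X 0 0 * (X 1 0 * Num.conj (X 0 0) + X 1 1 * Num.conj (X 0 1))); first by ring.
  by rewrite D e00 e10 !subrr !mulr0 subr0 addr0.
have r1 := congr1 (@complex.Re R) E1; have i1 := congr1 (@complex.Im R) E1.
have r2 := congr1 (@complex.Re R) E2; have i2 := congr1 (@complex.Im R) E2.
have r0 := congr1 (@complex.Re R) e00.
rewrite !cE /= in r1 i1 r2 i2 r0.
split; last by rewrite /qunit /qdot /=; move: r0; lra.
by split; move: r1 i1 r2 i2; lra.
Qed.

Lemma su2_norm_quat X : su2 X -> su2_norm X = Num.sqrt (qdot (toq X) (toq X)).
Proof.
move=> /su2_quat[[h1 h2 h3 h4] _]; rewrite /su2_norm; congr Num.sqrt.
rewrite /mxtrace sum2 !mxE !sum2 !mxE !cE h1 h2 h3 h4 /qdot /=.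
by field.
Qed.

Lemma qRD (r s : R) : qR (r + s) = qR r + qR s.
Proof. by apply: quatP; split; rewrite !qE /=; ring. Qed.
Lemma qRM (r s : R) : qR (r * s) = qR r * qR s.
Proof. by apply: quatP; split; rewrite !qE /=; ring. Qed.
Lemma qR0 : qR 0 = 0 :> quat.
Proof. by []. Qed.
Lemma qRC (r : R) (a : quat) : qR r * a = a * qR r.
Proof. by apply: quatP; split; rewrite !qE /=; ring. Qed.

Lemma qR_sum n (f : 'I_n -> R) : qR (\sum_i f i) = \sum_i qR (f i).
Proof. exact: (big_morph _ qRD qR0). Qed.

Lemma toq_sum n (f : 'I_n -> M2) : toq (\sum_i f i) = \sum_i toq (f i).
Proof.
apply: (big_morph _ toqD).
by apply: quatP; split; rewrite !qE /= !mxE.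
Qed.

(** * Gauge transformations over a motion *)

Section Intertwiner.
Variable c : configuration R.
Implicit Types (q : 'M[R]_3 * 'rV[R]_3) (x v : 'rV[R]_3) (g : 'rV[R]_3 -> quat).

Definition qhiggs x := toq (higgs c x).

Definition qconn v x : quat := \sum_i qR (v 0 i) * toq (connection c i x).

(* The gauge transformations g with q^* (A, phi) = g . (A, phi); the
   connection condition is stated along lines, where it is stable under
   composition of motions. *)
Definition intertwiner q g :=
  [/\ forall x, qunit (g x), forall x, qcts g x,
      forall x, qhiggs (motion q x) * g x = g x * qhiggs x &
      forall x v, dquat (fun s : R => g (x + s *: v)) 0
        (g x * qconn v x - qconn (v *m q.1) (motion q x) * g x)].

Lemma C1v_line (f : 'rV[R]_3 -> R) x v : C1v f ->
  is_derive (0 : R) (1 : R) (fun s => f (x + s *: v)) (\sum_i v 0 i * partial i f x).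
Proof.
move=> hf.
have dl (a b : R) : is_derive (0 : R) (1 : R) (fun s => a + s * b) b.
  apply: (rder_eq (rderD (rder_cst a 0) (rderM (is_derive_id (0 : R) (1 : R)) (rder_cst b 0)))).
  by ring.
have := C1v_der_curve hf (dl (x 0 o0) (v 0 o0)) (dl (x 0 o1) (v 0 o1)) (dl (x 0 o2) (v 0 o2)).
have -> : (fun s => f (row3 (x 0 o0 + s * v 0 o0) (x 0 o1 + s * v 0 o1) (x 0 o2 + s * v 0 o2)))
    = (fun s => f (x + s *: v)).
  apply/funext => s; congr f; apply: row3P; rewrite ?row3_0 ?row3_1 ?row3_2 !mxE //.
rewrite !mul0r !addr0 -row3_eta => h; apply: (rder_eq h).
by rewrite sum3; congr (_ + _ + _); rewrite mulrC.
Qed.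

Lemma mx_smooth_line (g : 'rV[R]_3 -> M2) x v : mx_smooth g ->
  dquat (fun s : R => toq (g (x + s *: v))) 0
    (\sum_i qR (v 0 i) * toq (mx_partial i g x)).
Proof.
move=> hg.
have h00 := hg 0 0; have h01 := hg 0 1.
have E (p : quat -> R) (F : 'I_3 -> quat) : p 0 = 0 -> {morph p : x y / x + y} ->
    p (\sum_i F i) = \sum_i p (F i).
  by move=> p0 pD; rewrite (big_morph p pD p0).
split; rewrite E //=.
- apply: (rder_eq (C1v_line x v (smooth_C1v h00.1))).
  by apply: eq_bigr => i _; rewrite mxE /=; ring.
- apply: (rder_eq (C1v_line x v (smooth_C1v h00.2))).
  by apply: eq_bigr => i _; rewrite mxE /=; ring.
- apply: (rder_eq (C1v_line x v (smooth_C1v h01.1))).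
  by apply: eq_bigr => i _; rewrite !mxE /=; ring.
- apply: (rder_eq (C1v_line x v (smooth_C1v h01.2))).
  by apply: eq_bigr => i _; rewrite !mxE /=; ring.
Qed.

Hypothesis hc : smooth_configuration c.

Lemma conn_quat i x : qform (connection c i x) /\ qimag (toq (connection c i x)).
Proof. by have [/(_ i)[_ h] _] := hc; exact: su2_quat. Qed.

Lemma higgs_quat x : qform (higgs c x) /\ qimag (qhiggs x).
Proof. by have [_ [_ h]] := hc; exact: su2_quat. Qed.

Lemma mx_smooth_qcts (g : 'rV[R]_3 -> M2) x : mx_smooth g -> qcts (fun x => toq (g x)) x.
Proof.
move=> hg; have h00 := hg 0 0; have h01 := hg 0 1.
by split; [case: (h00.1 [::])|case: (h00.2 [::])|case: (h01.1 [::])|case: (h01.2 [::])] => h _;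
  exact: h.
Qed.

Lemma qhiggs_cts x : qcts qhiggs x.
Proof. by have [_ [h _]] := hc; exact: mx_smooth_qcts. Qed.

(** Solving q^*A = g A g^-1 - dg g^-1 for dg gives the linear equation dg = g A - (q^*A) g. *)
Lemma gauge_intertwiner q : gauge_equivalent c (pullback q c) ->
  exists g, intertwiner q g.
Proof.
move=> [g [gs gSU E]]; exists (fun x => toq (g x)).
have gq x := SU2_quat (gSU x).
have gu x : g x \in unitmx by have [h _] := gSU x; exact: unitarymx_unit.
split.
- by move=> x; have [] := gq x.
- by move=> x; exact: mx_smooth_qcts.
- move=> x; have := congr1 (fun c' => higgs c' x) E => /= e.
  have [f1 _] := gq x; have [f2 _] := higgs_quat x.
  rewrite /qhiggs -(toqM _ f1) -(toqM _ f2) e.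
  by rewrite -mulmxA mulVmx ?mulmx1.
- move=> x v; have d := mx_smooth_line x v gs.
  suff -> : toq (g x) * qconn v x - qconn (v *m q.1) (motion q x) * toq (g x) =
     \sum_i qR (v 0 i) * toq (mx_partial i g x) by [].
  have [f1 _] := gq x.
  have key i : toq (mx_partial i g x) = toq (g x) * toq (connection c i x) -
      (\sum_j qR (q.1 i j) * toq (connection c j (motion q x))) * toq (g x).
    have := congr1 (fun c' => connection c' i x) E => /= e.
    have [f2 _] := conn_quat i x.
    have -> : mx_partial i g x = g x *m connection c i x -
        (\sum_j (q.1 i j)%:C *: connection c j (motion q x)) *m g x.
      by rewrite e mulmxBl -!mulmxA mulVmx // !mulmx1 opprB addrC subrK.
    rewrite toqD toqN (toqM _ f1) (toqM _ f2) toq_sum; congr (_ - _ * _).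
    by apply: eq_bigr => j _; rewrite toqZ.
  under [RHS]eq_bigr do rewrite key mulrBr.
  rewrite sumrB; congr (_ - _).
    by rewrite /qconn mulr_sumr; apply: eq_bigr => i _; rewrite mulrA -qRC mulrA.
  under [RHS]eq_bigr do rewrite mulrA.
  rewrite -mulr_suml; congr (_ * _).
  under [RHS]eq_bigr do rewrite mulr_sumr.
  rewrite exchange_big /qconn; apply: eq_bigr => j _ /=.
  rewrite mxE qR_sum mulr_suml; apply: eq_bigr => i _.
  by rewrite qRM mulrA.
Qed.

Lemma intertwiner_comp q1 q2 g1 g2 : intertwiner q1 g1 -> intertwiner q2 g2 ->
  intertwiner (q1.1 *m q2.1, q1.2 *m q2.1 + q2.2) (fun x => g2 (motion q1 x) * g1 x).
Proof.
move=> [u1 c1 p1 d1] [u2 c2 p2 d2].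
have E x : motion (q1.1 *m q2.1, q1.2 *m q2.1 + q2.2) x = motion q2 (motion q1 x).
  by rewrite /motion /= mulmxDl mulmxA addrA.
have mc x : rcts (motion q1) x.
  have -> : motion q1 = fun y => row3 (\sum_i y 0 i * q1.1 i o0 + q1.2 0 o0)
     (\sum_i y 0 i * q1.1 i o1 + q1.2 0 o1) (\sum_i y 0 i * q1.1 i o2 + q1.2 0 o2).
    by apply/funext => y; apply: row3P; rewrite ?row3_0 ?row3_1 ?row3_2 !mxE.
  apply: rcts_row3; apply: rctsD; try exact: rcts_cst; apply: rcts_sum => i;
    apply: rctsM; try exact: rcts_cst; exact: rcts_coord.
split.
- by move=> x; exact: qunitM.
- by move=> x; apply: qctsM => //; apply: (qcts_comp (F := g2) (h := motion q1)).
- by move=> x; rewrite E mulrA p2 -mulrA p1 mulrA.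
- move=> x v.
  have e2 : (fun s : R => g2 (motion q1 (x + s *: v))) =
      (fun s : R => g2 (motion q1 x + s *: (v *m q1.1))).
    by apply/funext => s; congr g2; rewrite /motion mulmxDl -scalemxAl addrAC.
  have := d2 (motion q1 x) (v *m q1.1); rewrite -e2 => dd.
  have key (a b c' d f : quat) : (a * b - c' * a) * d + a * (d * f - b * d) =
      a * d * f - c' * (a * d).
    by rewrite mulrBl mulrBr !mulrA addrC addrA subrK.
  by have := dquatM dd (d1 x v); rewrite /= scale0r addr0 E key mulmxA.
Qed.

Lemma intertwinerN q g : intertwiner q g -> intertwiner q (fun x => - g x).
Proof.
move=> [u co p d]; split.
- by move=> x; exact: qunitN.
- by move=> x; exact: qctsN.
- by move=> x; rewrite mulrN p mulNr.
- by move=> x v; rewrite mulNr mulrN -opprD; exact: dquatN.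
Qed.

Lemma intertwiner_id : intertwiner (1%:M, 0) (fun=> 1).
Proof.
have E x : motion (1%:M, 0) x = x by rewrite /motion mulmx1 addr0.
split.
- by move=> x; exact: qunit1.
- by move=> x; exact: qcts_cst.
- by move=> x; rewrite E mulr1 mul1r.
- by move=> x v; rewrite E mulmx1 mulr1 mul1r subrr; exact: dquat_cst.
Qed.

(** Both solve the same linear equation, whose coefficients are imaginary quaternions and act by
    skew maps; the inner product therefore has zero derivative along every line. *)
Lemma intertwiner_dot q g1 g2 : intertwiner q g1 -> intertwiner q g2 ->
  forall x y, qdot (g1 x) (g2 x) = qdot (g1 y) (g2 y).
Proof.
move=> [u1 c1 p1 d1] [u2 c2 p2 d2] x y.
pose v := x - y.
pose f (s : R) := qdot (g1 (y + s *: v)) (g2 (y + s *: v)).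
have imag w z : qimag (qconn w z).
  rewrite /qimag /qconn (big_morph _ (@reD R) (erefl : qre (0 : quat) = 0)).
  by apply: big1 => i _; have [_ h] := conn_quat i z; rewrite /qimag in h; rewrite reM h /=; ring.
have df s : is_derive s (1 : R) f 0.
  have sh (g : 'rV[R]_3 -> quat) d : dquat (fun h : R => g (y + s *: v + h *: v)) 0 d ->
      dquat (fun s : R => g (y + s *: v)) s d.
    have e (p : quat -> R) : is_derive (0 : R) (1 : R) (fun h => p (g (y + s *: v + h *: v))) (p d) ->
        is_derive s (1 : R) (fun s => p (g (y + s *: v))) (p d).
      move=> /is_derive1_caratheodory [k [k1 k2 k3]].
      apply/is_derive1_caratheodory; exists (fun z => k (z - s)); split.
      - move=> z; have := k1 (z - s); rewrite subr0 scale0r addr0 => <-.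
        by rewrite -addrA -scalerDl subrKC.
      - have h : rcts (fun z : R => z - s) s by cts.
        by apply: (continuous_comp h); rewrite subrr.
      - by rewrite subrr.
    by move=> [h1 h2 h3 h4]; split; exact: e.
  apply: (rder_eq (rder_dot (sh _ _ (d1 (y + s *: v) v)) (sh _ _ (d2 (y + s *: v) v)))).
  move: (imag v (y + s *: v)) (imag (v *m q.1) (motion q (y + s *: v))).
  rewrite /qimag; set a := qconn _ _; set b := qconn _ _ => ha hb.
  by rewrite /qdot !qE ha hb; ring.
have := is_derive_0_is_cst 1 0 df.
by rewrite /f scale1r scale0r addr0 /v subrKC.
Qed.

End Intertwiner.
End SU2Quaternions.

(** * Degree of the Higgs field *)

Lemma det_rows3 (K : comNzRingType) (a b c : 'rV[K]_3) :
  \det (\matrix_(i < 3) nth 0 [:: a; b; c] i) =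
  a 0 o0 * (b 0 o1 * c 0 o2 - b 0 o2 * c 0 o1)
  - a 0 o1 * (b 0 o0 * c 0 o2 - b 0 o2 * c 0 o0)
  + a 0 o2 * (b 0 o0 * c 0 o1 - b 0 o1 * c 0 o0).
Proof.
have E (i j : 'I_3) : (\matrix_(i < 3) nth 0 [:: a; b; c] i) i j =
    nth 0 [:: a; b; c] i 0 j by rewrite mxE.
by rewrite det3 !E /=.
Qed.

Section ChartedSpheres.
Variable R : realType.
Local Notation quat := (quat R).
Local Notation V := 'rV[R]_3.

Lemma row3Z (r a b c : R) : r *: row3 a b c = row3 (r * a) (r * b) (r * c).
Proof. by apply: row3P; rewrite mxE ?row3_0 ?row3_1 ?row3_2. Qed.

Lemma rcts_cos (T : topologicalType) (f : T -> R) x : rcts f x -> rcts (fun y => cos (f y)) x.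
Proof. by move=> h; exact: rcts_comp h (@continuous_cos _ _). Qed.

Lemma rcts_sin (T : topologicalType) (f : T -> R) x : rcts f x -> rcts (fun y => sin (f y)) x.
Proof. by move=> h; exact: rcts_comp h (@continuous_sin _ _). Qed.

Lemma rcts_sphere_point (T : topologicalType) (r t u : T -> R) x :
  rcts r x -> rcts t x -> rcts u x -> rcts (fun y => r y *: sphere_point (t y) (u y)) x.
Proof.
move=> hr ht hu.
have -> : (fun y => r y *: sphere_point (t y) (u y)) = fun y =>
    row3 (r y * (sin (t y) * cos (u y))) (r y * (sin (t y) * sin (u y))) (r y * cos (t y)).
  by apply/funext => y; rewrite -row3Z.
have st := rcts_sin ht; have ct := rcts_cos ht; have su := rcts_sin hu; have cu := rcts_cos hu.
by apply: rcts_row3; [do 2 (apply: rctsM => //)|do 2 (apply: rctsM => //)|apply: rctsM].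
Qed.

Lemma sphere_point0 (u : R) : sphere_point 0 u = sphere_point 0 0.
Proof. by rewrite /sphere_point !sin0 !mul0r. Qed.

Lemma sphere_point_pi (u : R) : sphere_point pi u = sphere_point pi 0.
Proof. by rewrite /sphere_point !sinpi !mul0r. Qed.

Lemma sphere_point_per (t u : R) : sphere_point t (u + 2 * pi) = sphere_point t u.
Proof. by rewrite /sphere_point mulr2n mulrDl mul1r -mulr2n sinD2pi cosD2pi. Qed.

Lemma enorm_sphere (r t u : R) : 0 <= r -> enorm (r *: sphere_point t u) = r.
Proof.
move=> r0; rewrite /enorm /sphere_point row3Z sum3 row3_0 row3_1 row3_2.
rewrite -[RHS](ger0_norm r0) -sqrtr_sqr; congr Num.sqrt.
transitivity (r ^+ 2 * (sin t ^+ 2 * (cos u ^+ 2 + sin u ^+ 2) + cos t ^+ 2)); first by ring.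
by rewrite cos2Dsin2 mulr1 [_ + cos t ^+ 2]addrC cos2Dsin2 mulr1.
Qed.

(** Shrinking the radius to 0 deforms the map to a constant one, which has a constant lift. *)
Lemma extension_winding (h : V -> quat) (r : R) :
  (forall x, [/\ qcts h x, qunit (h x) & qimag (h x)]) ->
  has_winding (fun p => h (r *: sphere_point p.1 p.2)) 0.
Proof.
move=> hh.
pose F (x : R * (R * R)) := h ((x.1 * r) *: sphere_point x.2.1 x.2.2).
have [||||D [D0 D1]] := @winding_homotopy R F.
- move=> s p _ _; have [c u i] := hh ((s * r) *: sphere_point p.1 p.2); split => //.
  apply: (@qcts_comp _ _ _ h (fun x : R * (R * R) => (x.1 * r) *: sphere_point x.2.1 x.2.2)) => //.
  by apply: rcts_sphere_point; cts.
- by move=> s u; rewrite /F /= sphere_point0.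
- by move=> s u; rewrite /F /= sphere_point_pi.
- by move=> s t u; rewrite /F /= sphere_point_per.
have e1 : (fun p => F (1, p)) = fun p => h (r *: sphere_point p.1 p.2).
  by apply/funext => p; rewrite /F /= mul1r.
suff -> : 0 = D by rewrite -e1.
apply: (@winding_unique R (fun p => F (0, p))) => //.
  by move=> u; rewrite /F /= !mul0r !scale0r.
have [_ u0 i0] := hh 0.
have [p up ep] := eigenvector_exists u0 i0.
exists (fun=> p), (fun=> 0); split => //.
- by move=> x _; split => //; [exact: qcts_cst|rewrite /F /= mul0r scale0r].
- by move=> u _; split; [exact: rcts_cst|rewrite qexp0 mulr1].
- by rewrite subrr mulr0.
Qed.

Lemma C1_fst O : C1 O (fun p : R * R => p.1).
Proof.
exists (fun=> 1), (fun=> 0) => p _; split; try exact: rcts_cst.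
- exact: is_derive_id.
- exact: rder_cst.
- by cts.
Qed.

Lemma C1_snd O : C1 O (fun p : R * R => p.2).
Proof.
exists (fun=> 0), (fun=> 1) => p _; split; try exact: rcts_cst.
- exact: rder_cst.
- exact: is_derive_id.
- by cts.
Qed.

Lemma C1_sin O (f : R * R -> R) : C1 O f -> C1 O (fun p => sin (f p)).
Proof.
move=> hf; apply: (@C1_comp R O f sin cos) => // p _; split; first exact: is_derive_sin.
exact: continuous_cos.
Qed.

Lemma C1_cos O (f : R * R -> R) : C1 O f -> C1 O (fun p => cos (f p)).
Proof.
move=> hf; apply: (@C1_comp R O f cos (fun x => - sin x)) => // p _.
split; first exact: is_derive_cos.
by apply: rctsN; exact: continuous_sin.
Qed.

Lemma C1_sphere (f : V -> R) (r : R) : C1v f ->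
  C1 setT (fun p : R * R => f (r *: sphere_point p.1 p.2)).
Proof.
move=> hf.
have -> : (fun p : R * R => f (r *: sphere_point p.1 p.2)) = fun p : R * R =>
    f (row3 (r * (sin p.1 * cos p.2)) (r * (sin p.1 * sin p.2)) (r * cos p.1)).
  by apply/funext => y; rewrite -row3Z.
have c := C1_cst; have s1 := C1_sin (C1_fst setT); have c1 := C1_cos (C1_fst setT).
have s2 := C1_sin (C1_snd setT); have c2 := C1_cos (C1_snd setT).
apply: C1_comp3 => //; apply: C1M; try exact: C1_cst; by [|exact: C1M].
Qed.

Variable c : configuration R.
Hypothesis hc : smooth_configuration c.

Definition higgs_sphere (r : R) (p : R * R) : quat :=
  qnormalize (qhiggs c (r *: sphere_point p.1 p.2)).

Lemma qnormalize_imag (q : quat) : qimag q -> qimag (qnormalize q).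
Proof. by rewrite /qimag /qnormalize reM /= => ->; ring. Qed.

Lemma higgs_sphere_degree (r : R) :
  (forall t u, 0 < qdot (qhiggs c (r *: sphere_point t u)) (qhiggs c (r *: sphere_point t u))) ->
  exists2 D, has_winding (higgs_sphere r) D &
    sphere_degree (fun x => (su2_norm (higgs c (r *: x)))^-1 *:
                            su2_coord (higgs c (r *: x))) = D.
Proof.
move=> pos.
pose n := higgs_sphere r.
have nC1 : qC1 setT n.
  apply: qC1_normalize => [|p _]; last exact: pos.
  have [_ [hs _]] := hc; have h00 := hs 0 0; have h01 := hs 0 1.
  apply/qC1P; split.
  - by apply: (@C1_sphere (fun x => complex.Re (higgs c x 0 0))); apply: smooth_C1v h00.1.
  - by apply: (@C1_sphere (fun x => complex.Im (higgs c x 0 0))); apply: smooth_C1v h00.2.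
  - by apply: (@C1_sphere (fun x => complex.Re (higgs c x 0 1))); apply: smooth_C1v h01.1.
  - by apply: (@C1_sphere (fun x => complex.Im (higgs c x 0 1))); apply: smooth_C1v h01.2.
have [nt [nu hn]] := nC1.
have im p : qimag (n p) by apply: qnormalize_imag; have [_] := higgs_quat hc (r *: sphere_point p.1 p.2).
have un p : qunit (n p) by apply: qunit_normalize.
have [p|p|u|u|t u|D hD hI] := @area_winding R n nt nu nC1.
- by have [? ? _ _ _] := hn p I.
- by [].
- by rewrite /n /higgs_sphere /= sphere_point0.
- by rewrite /n /higgs_sphere /= sphere_point_pi.
- by rewrite /n /higgs_sphere /= sphere_point_per.
exists D => //.
have pi0 := @pi_gt0 R.
pose f x := (su2_norm (higgs c (r *: x)))^-1 *: su2_coord (higgs c (r *: x)).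
rewrite -[X in sphere_degree X]/f /sphere_degree.
have fE t u : f (sphere_point t u) = row3 (qk (n (t, u))) (qj (n (t, u))) (qi (n (t, u))).
  rewrite /f su2_norm_quat; last by have [_ [_ ]] := hc.
  rewrite /su2_coord row3Z /n /higgs_sphere /qnormalize /= -/(qhiggs c _).
  by apply: row3P; rewrite ?row3_0 ?row3_1 ?row3_2; ring.
have ft t u : derive1 (fun t' => f (sphere_point t' u)) t =
    row3 (qk (nt (t, u))) (qj (nt (t, u))) (qi (nt (t, u))).
  have -> : (fun t' => f (sphere_point t' u)) = fun t' =>
      row3 (qk (n (t', u))) (qj (n (t', u))) (qi (n (t', u))) by apply/funext => t'; exact: fE.
  by have [[_ d1 d2 d3] _ _ _ _] := hn (t, u) I; exact: row3_derive1.
have fu t u : derive1 (fun u' => f (sphere_point t u')) u =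
    row3 (qk (nu (t, u))) (qj (nu (t, u))) (qi (nu (t, u))).
  have -> : (fun u' => f (sphere_point t u')) = fun u' =>
      row3 (qk (n (t, u'))) (qj (n (t, u'))) (qi (n (t, u'))) by apply/funext => u'; exact: fE.
  by have [_ [_ d1 d2 d3] _ _ _] := hn (t, u) I; exact: row3_derive1.
have imt p : qimag (nt p).
  have [[d _ _ _] _ _ _ _] := hn p I; rewrite /qimag; apply: (rder_unique d).
  have -> : (fun t => qre (n (t, p.2))) = fun=> 0 by apply/funext => t; exact: im.
  exact: rder_cst.
have imu p : qimag (nu p).
  have [_ [d _ _ _] _ _ _] := hn p I; rewrite /qimag; apply: (rder_unique d).
  have -> : (fun u => qre (n (p.1, u))) = fun=> 0 by apply/funext => t; exact: im.
  exact: rder_cst.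
clearbody f n.
transitivity ((4 * pi)^-1 * (4 * pi * D)); last first.
  by rewrite mulrA mulVf ?mul1r // mulf_neq0 ?pnatr_eq0 // gt_eqF.
congr (_ * _); rewrite -hI; apply: integ_eq => t _; apply: integ_eq => u _.
(* The real part of a product of three imaginary quaternions is minus their triple product in the
   basis i, j, k; [su2_coord] lists the components in the order k, j, i, which restores the sign. *)
rewrite det_rows3 fE ft fu !row3_0 !row3_1 !row3_2.
have := im (t, u); have := imt (t, u); have := imu (t, u); rewrite /qimag => i1 i2 i3.
by rewrite !qE i1 i2 i3; ring.
Qed.

End ChartedSpheres.

(** * Uniqueness of intertwiners and their cocycle *)

Section Uniqueness.
Variable R : realType.
Local Notation quat := (quat R).
Local Notation V := 'rV[R]_3.

Lemma sign_const (f : R -> R) : (forall s, 0 <= s <= 1 -> rcts f s) ->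
  (forall s, 0 <= s <= 1 -> f s = 1 \/ f s = -1) -> f 1 = f 0.
Proof.
move=> hc hs.
have z01 : 0 <= (0 : R) <= 1 by rewrite lexx ler01.
have o01 : 0 <= (1 : R) <= 1 by rewrite lexx ler01.
have aux : Num.min (f 0) (f 1) <= 0 <= Num.max (f 0) (f 1) -> False.
  move=> h; have [] := @IVT _ f 0 1 0 ler01 _ h.
    by apply: seg_cts_within => x hx; exact: hc.
  move=> s; rewrite in_itv /= => /hs[] -> /eqP; rewrite ?oppr_eq0 oner_eq0 //.
case: (hs _ z01) => h0; case: (hs _ o01) => h1; rewrite ?h0 ?h1 // in aux *.
  by case: aux; rewrite ge_min le_max ?lerN10 ?ler01 ?orbT.
by case: aux; rewrite ge_min le_max ?lerN10 ?ler01 ?orbT.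
Qed.

(** Commuting imaginary quaternions have zero cross product, so Lagrange's identity gives <a, b>^2 =
    1. *)
Lemma qimag_comm (a b : quat) : qunit a -> qimag a -> qunit b -> qimag b ->
  a * b = b * a -> qdot a b = 1 \/ qdot a b = -1.
Proof.
rewrite /qunit /qimag /qdot => ua ia ub ib h; rewrite ia ib in ua ub *.
have e1 := congr1 (@qi R) h; have e2 := congr1 (@qj R) h; have e3 := congr1 (@qk R) h.
rewrite !qE ia ib in e1 e2 e3.
have x1 : qj a * qk b - qk a * qj b = 0 by move: e1; lra.
have x2 : qk a * qi b - qi a * qk b = 0 by move: e2; lra.
have x3 : qi a * qj b - qj a * qi b = 0 by move: e3; lra.
have sq : (0 * 0 + qi a * qi b + qj a * qj b + qk a * qk b) ^+ 2 = 1.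
  transitivity ((0 * 0 + qi a * qi a + qj a * qj a + qk a * qk a) *
    (0 * 0 + qi b * qi b + qj b * qj b + qk b * qk b) -
    ((qj a * qk b - qk a * qj b) ^+ 2 + (qk a * qi b - qi a * qk b) ^+ 2 +
     (qi a * qj b - qj a * qi b) ^+ 2)); first by ring.
  by rewrite ua ub x1 x2 x3; ring.
by move/eqP: sq; rewrite sqrf_eq1 => /orP[] /eqP; [left|right].
Qed.

Variable c : configuration R.
Hypothesis hc : smooth_configuration c.

Lemma higgs_nonzero_far k : boundary_conditions k c ->
  exists2 r0 : R, 0 < r0 & forall x, r0 <= enorm x -> 0 < qdot (qhiggs c x) (qhiggs c x).
Proof.
move=> [[C [r0 [r00 hb]]] _ _].
(* The bound 4 k makes k / (2 r) at most 1 / 8 and the bound 2 (|C| + 1) makes C / r^2 at most 1 /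
   4, so |phi| stays positive. *)
pose r1 := Num.max r0 (Num.max (4 * k%:R) (2 * (`|C| + 1))).
have h1 : r0 <= r1 by rewrite /r1 le_max lexx.
have h2 : 4 * k%:R <= r1 by rewrite /r1 !le_max lexx orbT.
have h3 : 2 * (`|C| + 1) <= r1 by rewrite /r1 !le_max lexx !orbT.
have r10 : 0 < r1 by rewrite (lt_le_trans r00).
exists r1 => // x hx.
have x0 : 0 < enorm x by rewrite (lt_le_trans r10).
have := hb x (le_trans h1 hx).
have hsu : su2 (higgs c x) by have [_ [_ h]] := hc.
rewrite su2_norm_quat // -/(qhiggs c x) => hbx.
suff : 0 < Num.sqrt (qdot (qhiggs c x) (qhiggs c x)) by rewrite sqrtr_gt0.
have b1 : k%:R / (2 * enorm x) <= 1 / 8.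
  rewrite ler_pdivrMr ?mulr_gt0 //; clear - h2 hx; lra.
have b2 : C / enorm x ^+ 2 <= 1 / 4.
  rewrite ler_pdivrMr ?exprn_gt0 //.
  have : `|C| + 1 <= (enorm x ^+ 2) / 4.
    have c0 := normr_ge0 C; have : 2 * (`|C| + 1) <= enorm x by apply: le_trans hx.
    rewrite expr2; move: (enorm x) (`|C|) c0 => e n *; nra.
  have := ler_norm C; move: (enorm x ^+ 2) => e; lra.
move: hbx; rewrite ler_norml => /andP[hl _]; clear - hl b1 b2; lra.
Qed.

Lemma intertwiner_unique (r D : R) q g1 g2 : 0 < r ->
  (forall t u, 0 < qdot (qhiggs c (r *: sphere_point t u)) (qhiggs c (r *: sphere_point t u))) ->
  has_winding (higgs_sphere c r) D -> D != 0 ->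
  intertwiner c q g1 -> intertwiner c q g2 ->
  (forall x, g1 x = g2 x) \/ (forall x, g1 x = - g2 x).
Proof.
move=> r0 pos hD D0 i1 i2.
have dot_const := intertwiner_dot hc i1 i2.
have [u1 c1 p1 _] := i1; have [u2 c2 p2 _] := i2.
pose d := qdot (g1 0) (g2 0).
have hd x : qdot (g1 x) (g2 x) = d by exact: dot_const.
have [d1|d1] := eqVneq d 1; first by left=> x; apply: qdot_eq1; rewrite ?hd.
have [d2|d2] := eqVneq d (-1); first by right=> x; apply: qdot_eqN1; rewrite ?hd.
exfalso.
pose m x := qconj (g2 x) * g1 x.
have um x : qunit (m x) by apply: qunitM => //; exact: qunit_conj.
have rem x : qre (m x) = d by rewrite -(hd x) /m /qdot !qE /=; ring.
have conjP x : qconj (qhiggs c x) = - qhiggs c x.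
  have [_ i] := higgs_quat hc x; rewrite /qimag in i.
  by apply: quatP; split => //; rewrite reN i oppr0; exact: i.
have commm x : m x * qhiggs c x = qhiggs c x * m x.
  have e2 := congr1 (@qconj R) (p2 x).
  rewrite !qconjM !conjP mulrN mulNr in e2.
  by rewrite /m -mulrA -p1 mulrA (oppr_inj e2) mulrA.
have cm x : qcts m x by apply: qctsM => //; exact: qcts_conj.
clearbody m.
(* The imaginary part of the ratio has constant squared norm 1 - d^2; for d other than 1 and -1 it
   can be normalised on all of R^3. *)
pose h x := m x - qR d.
have ih x : qimag (h x) by rewrite /qimag /h reD reN rem subrr.
have hh x : qdot (h x) (h x) = 1 - d ^+ 2.
  have := um x; rewrite /qunit => <-; rewrite /h /qdot !qE /= -(rem x); ring.
have dlt : 0 < 1 - d ^+ 2.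
  rewrite lt_neqAle -[X in _ && X](_ : 0 <= qdot (h 0) (h 0) = (0 <= 1 - d ^+ 2)); last by rewrite hh.
  have -> : 0 <= qdot (h 0) (h 0) by rewrite /qdot !addr_ge0 // -expr2 sqr_ge0.
  by rewrite andbT eq_sym subr_eq0 eq_sym sqrf_eq1 negb_or d1 d2.
pose k x := qnormalize (h x).
have hk x : [/\ qcts k x, qunit (k x) & qimag (k x)].
  split.
  - apply: qcts_normalize; first by rewrite hh.
    by apply: qctsB => //; exact: qcts_cst.
  - by apply: qunit_normalize; rewrite hh.
  - exact: qnormalize_imag.
have commh x : h x * qhiggs c x = qhiggs c x * h x.
  by rewrite /h mulrBl mulrBr commm qRC.
have commn x (y : quat) : y * h x = h x * y -> y * k x = k x * y.
  by move=> e; rewrite /k /qnormalize mulrA -(qRC _ y) -!mulrA e.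
pose n := higgs_sphere c r.
have un p : qunit (n p) by apply: qunit_normalize.
have im p : qimag (n p) by apply: qnormalize_imag; have [_] := higgs_quat hc (r *: sphere_point p.1 p.2).
pose ks p := k (r *: sphere_point p.1 p.2).
have hdot p : qdot (n p) (ks p) = 1 \/ qdot (n p) (ks p) = -1.
  have [_ uk ik] := hk (r *: sphere_point p.1 p.2).
  apply: qimag_comm => //; apply: commn; rewrite /n /higgs_sphere /qnormalize.
  by rewrite -mulrA -commh mulrA qRC mulrA.
have cn (T : topologicalType) (t u : T -> R) x : rcts t x -> rcts u x ->
    qcts (fun x => n (t x, u x)) x /\ qcts (fun x => ks (t x, u x)) x.
  move=> ht hu.
  have cs : rcts (fun x => r *: sphere_point (t x) (u x)) x.
    by apply: rcts_sphere_point => //; exact: rcts_cst.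
  split.
    apply: qcts_normalize; first exact: pos.
    by apply: (@qcts_comp _ _ _ (qhiggs c) (fun x => r *: sphere_point (t x) (u x))) => //; exact: qhiggs_cts.
  apply: (@qcts_comp _ _ _ k (fun x => r *: sphere_point (t x) (u x))) => //.
  by have [] := hk (r *: sphere_point (t x) (u x)).
(* The chart is connected, so one sign relates k to n on the whole sphere. *)
have cst p : qdot (n p) (ks p) = qdot (n (0, 0)) (ks (0, 0)).
  have := @sign_const (fun s => qdot (n (s * p.1, s * p.2)) (ks (s * p.1, s * p.2))).
  rewrite !mul0r !mul1r -surjective_pairing; apply => s _; last exact: hdot.
  by have [||a b] := @cn R (fun s => s * p.1) (fun s => s * p.2) s; [cts|cts|exact: rcts_dot].
have key (k' : V -> quat) : (forall x, [/\ qcts k' x, qunit (k' x) & qimag (k' x)]) ->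
    (forall p, n p = k' (r *: sphere_point p.1 p.2)) -> False.
  move=> hk' e; have := extension_winding r hk'.
  have -> : (fun p => k' (r *: sphere_point p.1 p.2)) = n by apply/funext => p; rewrite e.
  move=> h0; move/eqP: D0; apply; apply: (winding_unique _ hD h0) => u.
  by rewrite /higgs_sphere /= sphere_point_pi.
case: (hdot (0, 0)) => s0.
  apply: (key k) => // p; apply: qdot_eq1 => //; last by rewrite -s0 cst.
  by have [] := hk (r *: sphere_point p.1 p.2).
apply: (key (fun x => - k x)) => [x|p].
  have [a b i] := hk x; split; [exact: qctsN|exact: qunitN|].
  by rewrite /qimag reN; move: i; rewrite /qimag => ->; rewrite oppr0.
apply: qdot_eqN1 => //; last by rewrite -s0 cst.
by have [] := hk (r *: sphere_point p.1 p.2).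
Qed.

End Uniqueness.

(** * Signs of the lifted half-turns *)

Section Cocycle.
Variable R : realType.
Local Notation quat := (quat R).
Local Notation V := 'rV[R]_3.

Definition turn_z : 'M[R]_3 := diag_mx (row3 (-1) (-1) 1).
Definition turn_x : 'M[R]_3 := diag_mx (row3 1 (-1) (-1)).
(** The rotation of order three about the diagonal (1, 1, 1). *)
Definition cycle_axes : 'M[R]_3 :=
  \matrix_(i, j) ((j == i + 1)%:R : R).

(* The motion that is x |-> x M in the coordinates y |-> y Q + a. *)
Definition frame_motion (Q : 'M[R]_3) (a : V) (M : 'M[R]_3) : 'M[R]_3 * V :=
  (Q^T *m M *m Q, a - a *m (Q^T *m M *m Q)).

Lemma mul_turn_z (x : V) : x *m turn_z = row3 (- x 0 o0) (- x 0 o1) (x 0 o2).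
Proof.
apply: row3P; rewrite mul_mx_diag !mxE /= ?mulrN1 ?mulr1 //.
Qed.

Lemma mul_turn_x (x : V) : x *m turn_x = row3 (x 0 o0) (- x 0 o1) (- x 0 o2).
Proof.
apply: row3P; rewrite mul_mx_diag !mxE /= ?mulrN1 ?mulr1 //.
Qed.

Lemma mul_cycle_axes (x : V) : x *m cycle_axes = row3 (x 0 o2) (x 0 o0) (x 0 o1).
Proof.
by apply: row3P; rewrite !mxE sum3 !mxE /= ?mulr0 ?mulr1 ?addr0 ?add0r.
Qed.

Lemma row_mul_ext (A B : 'M[R]_3) : (forall x : V, x *m A = x *m B) -> A = B.
Proof. by move=> h; apply/row_matrixP => i; rewrite !rowE h. Qed.

Lemma turn_zz : turn_z *m turn_z = 1%:M.
Proof.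
apply: row_mul_ext => x; rewrite mulmxA !mul_turn_z mulmx1.
by apply: row3P; rewrite ?row3_0 ?row3_1 ?row3_2 ?opprK.
Qed.

Lemma turn_xx : turn_x *m turn_x = 1%:M.
Proof.
apply: row_mul_ext => x; rewrite mulmxA !mul_turn_x mulmx1.
by apply: row3P; rewrite ?row3_0 ?row3_1 ?row3_2 ?opprK.
Qed.

Lemma turn_xz : turn_x *m turn_z = turn_z *m turn_x.
Proof.
apply: row_mul_ext => x; rewrite !mulmxA !mul_turn_x !mul_turn_z.
by rewrite !row3_0 !row3_1 !row3_2.
Qed.

Lemma turn_z_cycle : turn_z *m cycle_axes = cycle_axes *m turn_x.
Proof.
apply: row_mul_ext => x; rewrite !mulmxA mul_turn_z !mul_cycle_axes mul_turn_x.
by rewrite !row3_0 !row3_1 !row3_2.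
Qed.

Lemma turn_x_cycle : turn_x *m cycle_axes = cycle_axes *m (turn_z *m turn_x).
Proof.
apply: row_mul_ext => x; rewrite !mulmxA mul_turn_x !mul_cycle_axes mul_turn_z mul_turn_x.
by rewrite !row3_0 !row3_1 !row3_2 opprK.
Qed.

Variables (Q : 'M[R]_3) (a : V).
Hypothesis QQ : Q *m Q^T = 1%:M.
Local Notation fm := (frame_motion Q a).

Lemma frame_motionE (M : 'M[R]_3) (y : V) : motion (fm M) (y *m Q + a) = y *m M *m Q + a.
Proof.
by rewrite /motion /= mulmxDl !mulmxA -(mulmxA y Q) QQ mulmx1 -addrA; congr (_ + _); rewrite addrC subrK.
Qed.

Lemma frame_motion_center (M : 'M[R]_3) : motion (fm M) a = a.
Proof. by have := frame_motionE M 0; rewrite !mul0mx !add0r. Qed.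

Lemma frame_motionM (M N : 'M[R]_3) :
  ((fm M).1 *m (fm N).1, (fm M).2 *m (fm N).1 + (fm N).2) = fm (M *m N).
Proof.
have e : (Q^T *m M *m Q) *m (Q^T *m N *m Q) = Q^T *m (M *m N) *m Q.
  by rewrite !mulmxA -(mulmxA _ Q Q^T) QQ mulmx1.
rewrite /frame_motion /=; congr (_, _) => //.
by rewrite mulmxBl -(mulmxA a) e addrC addrA subrK.
Qed.

Lemma frame_motion1 : fm 1%:M = (1%:M, 0).
Proof. by rewrite /frame_motion mulmx1 (mulmx1C QQ) mulmx1 subrr. Qed.

Variable c : configuration R.
Hypothesis hc : smooth_configuration c.
Hypothesis unique : forall q g1 g2, intertwiner c q g1 -> intertwiner c q g2 ->
  (forall x, g1 x = g2 x) \/ (forall x, g1 x = - g2 x).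

Definition is_sign (e : quat) := e = 1 \/ e = -1.

Lemma unique_sign q g1 g2 : intertwiner c q g1 -> intertwiner c q g2 ->
  exists2 e, is_sign e & forall x, g1 x = e * g2 x.
Proof.
move=> h1 h2; case: (unique h1 h2) => h; [exists 1; first by left|exists (-1); first by right].
  by move=> x; rewrite mul1r.
by move=> x; rewrite mulN1r.
Qed.

Lemma sign_comm e (x : quat) : is_sign e -> e * x = x * e.
Proof. by case=> ->; rewrite ?mul1r ?mulr1 ?mulN1r ?mulrN1. Qed.

Lemma sign_sqr (e : quat) : is_sign e -> e * e = 1.
Proof. by case=> ->; rewrite ?mulr1 // mulrNN mulr1. Qed.

Lemma frame_comp M N g h : intertwiner c (fm M) g -> intertwiner c (fm N) h ->
  intertwiner c (fm (M *m N)) (fun x => h (motion (fm M) x) * g x).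
Proof. by move=> hg hh; rewrite -frame_motionM; exact: intertwiner_comp. Qed.

Lemma sqr1_sign (x : quat) : qunit x -> x * x = 1 -> is_sign x.
Proof.
move=> u h.
have e : x = qconj x by apply: (qmulIl u); rewrite h qmul_conj.
have := u; rewrite /qunit /qdot.
have ei := congr1 (@qi R) e; have ej := congr1 (@qj R) e; have ek := congr1 (@qk R) e.
rewrite /= in ei ej ek.
have i0 : qi x = 0 by lra. have j0 : qj x = 0 by lra. have k0 : qk x = 0 by lra.
rewrite i0 j0 k0 !mulr0 !addr0 -expr2 => /eqP; rewrite sqrf_eq1 => /orP[] /eqP r0; [left|right];
  by apply: quatP; split; rewrite ?r0 ?i0 ?j0 ?k0 //= oppr0.
Qed.

(* The three-fold rotation permutes the half-turns, which forces their signs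
   to agree. *)
Lemma klein_cocycle ga gb gc :
  intertwiner c (fm turn_z) ga -> intertwiner c (fm turn_x) gb ->
  intertwiner c (fm cycle_axes) gc ->
  exists e ga' gb', [/\ is_sign e, intertwiner c (fm turn_z) ga',
    intertwiner c (fm turn_x) gb',
    [/\ forall x, ga' (motion (fm turn_z) x) * ga' x = e,
        forall x, gb' (motion (fm turn_x) x) * gb' x = e &
        forall x, ga' (motion (fm turn_x) x) * gb' x =
                  e * (gb' (motion (fm turn_z) x) * ga' x)] &
    e = 1 -> ga' a = 1 /\ gb' a = 1].
Proof.
move=> ia ib ic.
have [ua _ _ _] := ia; have [ub _ _ _] := ib; have [uc _ _ _] := ic.
have id1 := intertwiner_id c.
have haa := frame_comp ia ia; rewrite turn_zz frame_motion1 in haa.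
have hbb := frame_comp ib ib; rewrite turn_xx frame_motion1 in hbb.
have hab := frame_comp ia ib; have hba := frame_comp ib ia; rewrite turn_xz in hba.
have hac := frame_comp ia ic; have hcb := frame_comp ic ib; rewrite turn_z_cycle in hac.
have hbc := frame_comp ib ic; have hcab := frame_comp ic hab; rewrite turn_x_cycle in hbc.
have [ea sa Ea] := unique_sign haa id1.
have [eb sb Eb] := unique_sign hbb id1.
have [eab sab Eab] := unique_sign hba hab.
have [s ss Es] := unique_sign hac hcb.
have [s' ss' Es'] := unique_sign hbc hcab.
(* All these motions fix the centre a, where the relations become identities between unit
   quaternions. *)
have A := Ea a; have B := Eb a; have AB := Eab a; have S := Es a; have S' := Es' a.
rewrite /= !frame_motion_center ?mulr1 in A B AB S S'.
(* Conjugation by gc carries ga to gb up to a sign, which disappears in the squares. *)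
have eab_b : ea = eb.
  have : gc a * (ga a * ga a) = gb a * gb a * gc a.
    rewrite mulrA S -mulrA -mulrA S (mulrA (gb a) s) -(sign_comm (gb a) ss).
    by rewrite !mulrA sign_sqr // mul1r.
  by rewrite A B -(sign_comm (gc a) sa) => /(qmulIr (uc a)).
(* Conjugation by gc carries gb to gb ga up to a sign, and the square of gb ga is the commutation
   sign because ga and gb have equal squares. *)
have eab_e : eab = eb.
  have h1 : gc a * (gb a * gb a) = gb a * ga a * (gb a * ga a) * gc a.
    rewrite mulrA S' -mulrA -mulrA S' (mulrA (gb a * ga a) s').
    by rewrite -(sign_comm (gb a * ga a) ss') !mulrA sign_sqr // mul1r.
  have h2 : gb a * ga a * (gb a * ga a) = eab.
    rewrite !mulrA -(mulrA (gb a)) AB.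
    rewrite (mulrA (gb a)) -(sign_comm (gb a) sab) -!mulrA A.
    by rewrite (mulrA (gb a)) B eab_b sign_sqr // mulr1.
  by move: h1; rewrite h2 B -(sign_comm (gc a) sb) => /(qmulIr (uc a)).
rewrite eab_e in Eab sab AB; rewrite -eab_b in sb Eb B eab_e Eab.
(* For ea = 1 the value at the centre is 1 or -1, and the sign of the lift is chosen to make it
   1. *)
have norm g M : intertwiner c (fm M) g -> g a * g a = ea -> exists2 f, is_sign f &
    intertwiner c (fm M) (fun x => f * g x) /\ (ea = 1 -> f * g a = 1).
  move=> ig gg; have [ug _ _ _] := ig.
  have g1E : (fun x => 1 * g x) = g by apply/funext => x; rewrite mul1r.
  have gN1E : (fun x => -1 * g x) = (fun x => - g x) by apply/funext => x; rewrite mulN1r.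
  have [e1|e1] := EM (ea = 1); last first.
    exists 1; first by left.
    by rewrite g1E.
  have := sqr1_sign (ug a); rewrite gg => /(_ e1) [g1|g1].
    exists 1; first by left.
    by rewrite g1E g1 mulr1.
  exists (-1); first by right.
  split; last by rewrite g1 mulrNN mulr1.
  by rewrite gN1E; exact: intertwinerN.
have [f sf [if1 if2]] := norm _ _ ia A.
have [f' sf' [if1' if2']] := norm _ _ ib B.
exists ea, (fun x => f * ga x), (fun x => f' * gb x); split => //; last first.
  by move=> e1; split; auto.
have mix (k k' x y : quat) : is_sign k -> is_sign k' -> k * x * (k' * y) = k * k' * (x * y).
  by move=> hk hk'; rewrite -!mulrA (mulrA x) -(sign_comm x hk') !mulrA.
split=> x.
- by rewrite mix // sign_sqr // mul1r; have := Ea x; rewrite mulr1.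
- by rewrite mix // sign_sqr // mul1r; have := Eb x; rewrite mulr1.
- have E : ga (motion (fm turn_x) x) * gb x = ea * (gb (motion (fm turn_z) x) * ga x).
    exact: Eab.
  rewrite (mix f f') // (mix f' f) // E (sign_comm f' sf).
  by rewrite [RHS]mulrA (sign_comm (f' * f) sa) !mulrA.
Qed.

End Cocycle.

(** * Symmetries of the icosahedron *)

Section Icosahedron.
Variable R : realType.
Local Notation V := 'rV[R]_3.
Local Notation ico := (@icosahedron_vertices R).
Local Notation hull := (convex_hull ico : set V).
Implicit Types (L M Q : 'M[R]_3).

Definition hull_invariant L := forall x : V, hull x -> hull (x *m L).

(** The preimage of a convex set under a linear map is convex, so minimality of the hull applies to
    it. *)
Lemma vertices_hull_invariant L :
  (forall x : V, ico x -> ico (x *m L)) -> hull_invariant L.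
Proof.
move=> hL x hx W [cW VW].
apply: (hx [set y | W (y *m L)]); split; last by move=> y Vy; apply: VW; exact: hL.
move=> y z l; rewrite !inE /= => hy hz.
have := cW (y *m L) (z *m L) l; rewrite !inE => /(_ hy hz).
by rewrite /conv /= mulmxDl -!scalemxAl.
Qed.

Lemma abs_vertices_invariant L : (forall (x : V) i, `|(x *m L) 0 i| = `|x 0 i|) ->
  hull_invariant L.
Proof.
move=> h; apply: vertices_hull_invariant => x [i [h0 h1 h2]]; exists i.
split; rewrite ?h //; apply/eqP; rewrite -normr_eq0 h h0 normr0 //.
Qed.

Lemma hull_turn_z : hull_invariant (turn_z R).
Proof.
apply: abs_vertices_invariant => x; apply: ord3P;
  by rewrite mul_turn_z ?row3_0 ?row3_1 ?row3_2 ?normrN.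
Qed.

Lemma hull_turn_x : hull_invariant (turn_x R).
Proof.
apply: abs_vertices_invariant => x; apply: ord3P;
  by rewrite mul_turn_x ?row3_0 ?row3_1 ?row3_2 ?normrN.
Qed.

Lemma hull_opp : hull_invariant (- 1%:M).
Proof.
by apply: abs_vertices_invariant => x i; rewrite mulmxN mulmx1 mxE normrN.
Qed.

Lemma hull_cycle : hull_invariant (cycle_axes R).
Proof.
apply: vertices_hull_invariant => x [i [h0 h1 h2]]; exists (i + 1).
have shift (j : 'I_3) : (x *m cycle_axes R) 0 (j + 1) = x 0 j.
  by move: j; apply: ord3P; rewrite mul_cycle_axes mxE.
have -> : i + 1 + 2%:R = (i + 2%:R) + 1 by rewrite addrAC.
by rewrite !shift.
Qed.

Lemma hull_mul L M : hull_invariant L -> hull_invariant M -> hull_invariant (L *m M).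
Proof. by move=> h1 h2 x hx; rewrite mulmxA; apply: h2; exact: h1. Qed.

Definition hull_frame (V0 : set V) Q (a : V) := exists2 s : R, 0 < s &
  V0 = (fun x : V => s *: (x *m Q) + a) @` hull.

Lemma hull_frame_mul V0 L Q a : L *m L = 1%:M -> hull_invariant L ->
  hull_frame V0 Q a -> hull_frame V0 (L *m Q) a.
Proof.
move=> LL hL [s s0 ->]; exists s => //; apply/seteqP; split => _ [x hx <-].
  exists (x *m L); first exact: hL.
  by rewrite mulmxA -(mulmxA x) LL mulmx1.
by exists (x *m L); [exact: hL|rewrite mulmxA].
Qed.

Lemma frame_motion_symmetry V0 Q a M M' : Q *m Q^T = 1%:M -> hull_frame V0 Q a ->
  M *m M^T = 1%:M -> \det M = 1 -> M' *m M = 1%:M ->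
  hull_invariant M -> hull_invariant M' ->
  rotational_symmetries V0 (frame_motion Q a M).
Proof.
move=> QQ [s s0 ->] MM dM M'M hM hM'.
have Q'Q : Q^T *m Q = 1%:M by exact: mulmx1C.
have E x : motion (frame_motion Q a M) (s *: (x *m Q) + a) = s *: (x *m M *m Q) + a.
  by rewrite scalemxAl (frame_motionE _ QQ) -!scalemxAl.
split; first split => /=.
- rewrite !trmx_mul trmxK !mulmxA -(mulmxA _ Q Q^T) QQ mulmx1.
  by rewrite -(mulmxA _ M M^T) MM mulmx1.
- rewrite !det_mulmx dM mulr1 -det_mulmx Q'Q det1 //.
- apply/seteqP; split.
    by move=> _ [_ [x hx <-] <-]; exists (x *m M); [exact: hM|rewrite E].
  move=> _ [x hx <-]; exists (s *: (x *m M' *m Q) + a).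
    by exists (x *m M') => //; exact: hM'.
  by rewrite E -(mulmxA x) M'M mulmx1.
Qed.

Lemma tr_turn_z : (turn_z R)^T = turn_z R. Proof. exact: tr_diag_mx. Qed.
Lemma tr_turn_x : (turn_x R)^T = turn_x R. Proof. exact: tr_diag_mx. Qed.

Lemma det_turn_z : \det (turn_z R) = 1.
Proof.
rewrite det_diag !big_ord_recl big_ord0 !mxE /=; ring.
Qed.

Lemma det_turn_x : \det (turn_x R) = 1.
Proof.
rewrite det_diag !big_ord_recl big_ord0 !mxE /=; ring.
Qed.

Lemma cycle_axes3 : cycle_axes R *m cycle_axes R *m cycle_axes R = 1%:M.
Proof.
apply: row_mul_ext => x; rewrite !mulmxA !mul_cycle_axes mulmx1.
by apply: row3P; rewrite ?row3_0 ?row3_1 ?row3_2.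
Qed.

Lemma cycle_axes_orth : cycle_axes R *m (cycle_axes R)^T = 1%:M.
Proof.
apply/matrixP => i j; move: i j; apply: ord3P; apply: ord3P;
  by rewrite !mxE sum3 !mxE /= ?mulr0 ?mulr1 ?addr0 ?add0r.
Qed.

Lemma det_cycle_axes : \det (cycle_axes R) = 1.
Proof. by rewrite det3 !mxE /=; ring. Qed.

(** The frame of an icosahedron is ambiguous by its own symmetries. The central symmetry serves to
    make Q a rotation, and the Klein group to make its trace nonnegative, that is its angle at most
    2 pi / 3, as the homotopy of frames requires. *)
Lemma icosahedron_frame V0 : regular_icosahedron V0 -> exists Q a,
  [/\ Q *m Q^T = 1%:M, \det Q = 1, 0 <= \tr Q &
      [/\ rotational_symmetries V0 (frame_motion Q a (turn_z R)),
          rotational_symmetries V0 (frame_motion Q a (turn_x R)) &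
          rotational_symmetries V0 (frame_motion Q a (cycle_axes R))]].
Proof.
move=> [s [Q [a [s0 QQ VE]]]].
have f0 : hull_frame V0 Q a by exists s.
have [Q1 [QQ1 d1 f1]] : exists Q1, [/\ Q1 *m Q1^T = 1%:M, \det Q1 = 1 & hull_frame V0 Q1 a].
  have : \det Q ^+ 2 = 1 by rewrite expr2 -{2}(det_tr Q) -det_mulmx QQ det1.
  move=> /eqP; rewrite sqrf_eq1 => /orP[] /eqP dQ; first by exists Q.
  exists (- 1%:M *m Q); rewrite mulNmx mul1mx; split.
  - by rewrite linearN /= mulmxN mulNmx opprK.
  - by rewrite -scaleN1r detZ dQ; ring.
  - have e : (- 1%:M) *m (- 1%:M) = 1%:M :> 'M[R]_3 by rewrite mulmxN mulmx1 opprK.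
    by have := hull_frame_mul e hull_opp f0; rewrite mulNmx mul1mx.
have orth L : L *m L^T = 1%:M -> (L *m Q1) *m (L *m Q1)^T = 1%:M.
  by move=> LL; rewrite trmx_mul mulmxA -(mulmxA L) QQ1 mulmx1.
have zz : turn_z R *m (turn_z R)^T = 1%:M by rewrite tr_turn_z turn_zz.
have xx : turn_x R *m (turn_x R)^T = 1%:M by rewrite tr_turn_x turn_xx.
pose y := turn_z R *m turn_x R.
have yy : y *m y^T = 1%:M.
  by rewrite /y trmx_mul mulmxA -(mulmxA (turn_z R)) xx mulmx1.
have yy' : y *m y = 1%:M.
  by rewrite {2}/y -turn_xz /y mulmxA -(mulmxA (turn_z R)) turn_xx mulmx1 turn_zz.
(* The identity and the three half-turns add up to 0, so the four traces cannot all be negative. *)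
have trs : \tr Q1 + \tr (turn_z R *m Q1) + \tr (turn_x R *m Q1) + \tr (y *m Q1) = 0.
  rewrite -!mxtraceD -{1}[Q1]mul1mx -!mulmxDl.
  rewrite (_ : _ + y = 0) ?mul0mx ?mxtrace0 //.
  apply: row_mul_ext => x; rewrite !mulmxDr mulmx1 mulmx0 /y mulmxA mul_turn_z !mul_turn_x.
  by apply: row3P; rewrite !mxE ?row3_0 ?row3_1 ?row3_2 /=; ring.
have [Q2 [QQ2 d2 t2 f2]] : exists Q2,
    [/\ Q2 *m Q2^T = 1%:M, \det Q2 = 1, 0 <= \tr Q2 & hull_frame V0 Q2 a].
  have [t|t1] := leP 0 (\tr Q1); first by exists Q1.
  have [t|t2] := leP 0 (\tr (turn_z R *m Q1)).
    exists (turn_z R *m Q1); split => //; first exact: orth.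
      by rewrite det_mulmx det_turn_z d1 mulr1.
    by apply: hull_frame_mul => //; [exact: turn_zz|exact: hull_turn_z].
  have [t|t3] := leP 0 (\tr (turn_x R *m Q1)).
    exists (turn_x R *m Q1); split => //; first exact: orth.
      by rewrite det_mulmx det_turn_x d1 mulr1.
    by apply: hull_frame_mul => //; [exact: turn_xx|exact: hull_turn_x].
  exists (y *m Q1); split; first exact: orth.
  - by rewrite !det_mulmx det_turn_x det_turn_z d1 !mulr1.
  - by lra.
  - by apply: hull_frame_mul => //; apply: hull_mul; [exact: hull_turn_z|exact: hull_turn_x].
exists Q2, a; split => //; split.
- by apply: (frame_motion_symmetry QQ2 f2 zz det_turn_z (turn_zz R)); exact: hull_turn_z.
- by apply: (frame_motion_symmetry QQ2 f2 xx det_turn_x (turn_xx R)); exact: hull_turn_x.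
- apply: (frame_motion_symmetry QQ2 f2 cycle_axes_orth det_cycle_axes cycle_axes3).
    exact: hull_cycle.
  by apply: hull_mul; exact: hull_cycle.
Qed.

End Icosahedron.

(** * Moving the frame *)

Section FrameHomotopy.
Variable R : realType.
Local Notation quat := (quat R).
Local Notation V := 'rV[R]_3.
Implicit Types (u v y : V) (Q : 'M[R]_3).

Definition dot u v : R := \sum_i u 0 i * v 0 i.

Lemma dotE u v : dot u v = u 0 o0 * v 0 o0 + u 0 o1 * v 0 o1 + u 0 o2 * v 0 o2.
Proof. exact: sum3. Qed.

Lemma dot_mx u v : dot u v = (u *m v^T) 0 0.
Proof. by rewrite mxE; apply: eq_bigr => i _; rewrite mxE. Qed.

Lemma dot_ge0 u : 0 <= dot u u.
Proof. by rewrite /dot sumr_ge0 // => i _; rewrite -expr2 sqr_ge0. Qed.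

Lemma dotDr u v w : dot u (v + w) = dot u v + dot u w.
Proof. by rewrite !dotE !mxE; ring. Qed.

Lemma dotNr u v : dot u (- v) = - dot u v.
Proof. by rewrite !dotE !mxE; ring. Qed.

Lemma dotZr (r : R) u v : dot u (r *: v) = r * dot u v.
Proof. by rewrite !dotE !mxE; ring. Qed.

Lemma dotC u v : dot u v = dot v u.
Proof. by rewrite !dotE; ring. Qed.

Lemma dot_cauchy u v : dot u v ^+ 2 <= dot u u * dot v v.
Proof.
rewrite !dotE -subr_ge0; move: (u 0 o0) (u 0 o1) (u 0 o2) (v 0 o0) (v 0 o1) (v 0 o2).
move=> a b c d e f; rewrite (_ : _ - _ = (a * e - b * d) ^+ 2 + (b * f - c * e) ^+ 2 + (c * d - a * f) ^+ 2).
  by rewrite !addr_ge0 // sqr_ge0.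
by ring.
Qed.

Lemma enorm_dot y : enorm y = Num.sqrt (dot y y).
Proof. by []. Qed.

Lemma dot_sphere_point (t u : R) : dot (sphere_point t u) (sphere_point t u) = 1.
Proof.
have := @enorm_sphere R 1 t u ler01; rewrite scale1r enorm_dot => h.
by rewrite -[LHS]sqr_sqrtr ?dot_ge0 // h expr1n.
Qed.

Lemma rotation_cofactor Q i j : Q *m Q^T = 1%:M -> \det Q = 1 -> Q i j = cofactor Q i j.
Proof.
move=> QQ dQ.
have e : \adj Q = Q^T.
  by rewrite -[LHS]mul1mx -(mulmx1C QQ) -mulmxA mul_mx_adj dQ mulmx1.
by have := congr1 (fun M : 'M[R]_3 => M j i) e; rewrite !mxE.
Qed.

Lemma cofactor3 Q (i j k l m n : 'I_3) (s : R) :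
  [/\ lift i 0 = k, lift i 1 = l, lift j 0 = m, lift j 1 = n & (-1) ^+ (i + j) = s] ->
  cofactor Q i j = s * (Q k m * Q l n - Q k n * Q l m).
Proof. by move=> [<- <- <- <- <-]; rewrite /cofactor det2 !mxE. Qed.

(* Cayley-Hamilton, as the inverse of Q is its transpose. *)
Lemma rotation_sqr Q : Q *m Q^T = 1%:M -> \det Q = 1 ->
  Q *m Q = \tr Q *: Q - (\tr Q)%:M + Q^T.
Proof.
move=> QQ dQ.
have cof (i j k l m n : 'I_3) (s : R) :
    [/\ lift i 0 = k, lift i 1 = l, lift j 0 = m, lift j 1 = n & (-1) ^+ (i + j) = s] ->
    Q i j = s * (Q k m * Q l n - Q k n * Q l m).
  by move=> h; rewrite {1}(rotation_cofactor i j QQ dQ); exact: cofactor3 h.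
have ext (i k : 'I_3) : (i : nat) = k -> i = k by exact: val_inj.
have sg0 : (-1) ^+ 0 = 1 :> R by [].
have sg1 : (-1) ^+ 1 = -1 :> R by [].
have sg2 : (-1) ^+ 2 = 1 :> R by rewrite sqrrN expr1n.
have sg3 : (-1) ^+ 3 = -1 :> R by rewrite exprS sg2 mulr1.
have sg4 : (-1) ^+ 4 = 1 :> R by rewrite exprS sg3 mulrNN mulr1.
have c00 : Q o0 o0 = 1 * (Q o1 o1 * Q o2 o2 - Q o1 o2 * Q o2 o1).
  by apply: cof; split; first [exact: ext|exact: sg0].
have c01 : Q o0 o1 = -1 * (Q o1 o0 * Q o2 o2 - Q o1 o2 * Q o2 o0).
  by apply: cof; split; first [exact: ext|exact: sg1].
have c02 : Q o0 o2 = 1 * (Q o1 o0 * Q o2 o1 - Q o1 o1 * Q o2 o0).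
  by apply: cof; split; first [exact: ext|exact: sg2].
have c10 : Q o1 o0 = -1 * (Q o0 o1 * Q o2 o2 - Q o0 o2 * Q o2 o1).
  by apply: cof; split; first [exact: ext|exact: sg1].
have c11 : Q o1 o1 = 1 * (Q o0 o0 * Q o2 o2 - Q o0 o2 * Q o2 o0).
  by apply: cof; split; first [exact: ext|exact: sg2].
have c12 : Q o1 o2 = -1 * (Q o0 o0 * Q o2 o1 - Q o0 o1 * Q o2 o0).
  by apply: cof; split; first [exact: ext|exact: sg3].
have c20 : Q o2 o0 = 1 * (Q o0 o1 * Q o1 o2 - Q o0 o2 * Q o1 o1).
  by apply: cof; split; first [exact: ext|exact: sg2].
have c21 : Q o2 o1 = -1 * (Q o0 o0 * Q o1 o2 - Q o0 o2 * Q o1 o0).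
  by apply: cof; split; first [exact: ext|exact: sg3].
have c22 : Q o2 o2 = 1 * (Q o0 o0 * Q o1 o1 - Q o0 o1 * Q o1 o0).
  by apply: cof; split; first [exact: ext|exact: sg4].
have tE : \tr Q = Q o0 o0 + Q o1 o1 + Q o2 o2 by rewrite /mxtrace sum3.
apply/matrixP => i j.
have -> : (\tr Q *: Q - (\tr Q)%:M + Q^T) i j =
   \tr Q * Q i j - \tr Q * (i == j)%:R + Q j i by rewrite !mxE mulr_natr.
rewrite mxE sum3 tE; clear - c00 c01 c02 c10 c11 c12 c20 c21 c22.
by move: i j; apply: ord3P; apply: ord3P; rewrite /= ?mulr1 ?mulr0; lra.
Qed.

(** The trace is 1 + 2 cos(theta), so the cosine of the angle is at least - 1 / 2, and <y, y Q> is
    never below this cosine. The argument avoids finding the axis. *)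
Lemma rotation_dot_lb Q y : Q *m Q^T = 1%:M -> \det Q = 1 -> 0 <= \tr Q ->
  dot y y = 1 -> - (1 / 2) <= dot y (y *m Q).
Proof.
move=> QQ dQ tQ y1.
set q := dot y (y *m Q).
have dQT (u v : V) : dot (u *m Q) v = dot u (v *m Q^T).
  by rewrite !dot_mx trmx_mul trmxK mulmxA.
have qT : dot y (y *m Q^T) = q by rewrite -dQT dotC.
have nQ : dot (y *m Q) (y *m Q) = 1 by rewrite dQT -mulmxA QQ mulmx1.
have nQT : dot (y *m Q^T) (y *m Q^T) = 1.
  by rewrite -dQT -mulmxA (mulmx1C QQ) mulmx1.
have qq : dot (y *m Q^T) (y *m Q) = \tr Q * q - \tr Q + q.
  rewrite dotC dQT -mulmxA -trmx_mul (rotation_sqr QQ dQ).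
  have -> : (\tr Q *: Q - (\tr Q)%:M + Q^T)^T = \tr Q *: Q^T - (\tr Q)%:M + Q.
    by apply/matrixP => i j; rewrite !mxE eq_sym.
  rewrite !mulmxDr mulmxN -scalemxAr mul_mx_scalar.
  by rewrite !dotDr dotNr !dotZr qT y1 mulr1.
(* With q = <y, y Q> and t the trace, Cauchy-Schwarz becomes (1 - q) (2 q + 1 - t) >= 0, the mixed
   term being given by Cayley-Hamilton. *)
have := dot_cauchy y (y *m Q + y *m Q^T).
have e : dot (y *m Q + y *m Q^T) (y *m Q + y *m Q^T) = 2 + 2 * (\tr Q * q - \tr Q + q).
  rewrite dotDr dotC dotDr nQ [dot (y *m Q + _) _]dotC dotDr nQT qq [dot (y *m Q) _]dotC qq.
  by ring.
rewrite dotDr qT -/q y1 mul1r e => h.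
have : q ^+ 2 <= 1 by have := dot_cauchy y (y *m Q); rewrite y1 nQ mulr1.
move: h tQ; move: (\tr Q) q {qT qq e} => t q h t0 h1.
have [q1|q1] := leP 1 q; first by lra.
rewrite leNgt; apply/negP => q2.
have : 0 < (1 - q) * (t - 2 * q - 1) by apply: mulr_gt0; lra.
by move: h; lra.
Qed.

End FrameHomotopy.

(** * Straight-line homotopy between two charted spheres *)

Section Framing.
Variable R : realType.
Local Notation quat := (quat R).
Local Notation V := 'rV[R]_3.

Definition framed (Q : 'M[R]_3) (a : V) (r s : R) (p : R * R) : V :=
  r *: ((1 - s) *: sphere_point p.1 p.2 + s *: (sphere_point p.1 p.2 *m Q)) + s *: a.

Lemma frame_coord (Q : 'M[R]_3) (a S : V) (r s : R) i :
  (r *: ((1 - s) *: S + s *: (S *m Q)) + s *: a) 0 i =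
  r * ((1 - s) * S 0 i + s * \sum_j S 0 j * Q j i) + s * a 0 i.
Proof. by rewrite !mxE. Qed.

Lemma dot_lin (p q : R) (u v : V) : dot (p *: u + q *: v) (p *: u + q *: v) =
  p ^+ 2 * dot u u + q ^+ 2 * dot v v + 2 * p * q * dot u v.
Proof.
rewrite dotDr !dotZr [dot _ u]dotC [dot _ v]dotC !dotDr !dotZr [dot v u]dotC.
by ring.
Qed.

(** By the bound - 1 / 2, the chord from y to y Q has squared length at least 1 - 3 s (1 - s) >= 1 /
    4; the translation is absorbed by |u + v|^2 >= |u|^2 / 2 - |v|^2. *)
Lemma framed_far (Q : 'M[R]_3) (a : V) (r s : R) p :
  Q *m Q^T = 1%:M -> \det Q = 1 -> 0 <= \tr Q -> 0 <= s <= 1 ->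
  r ^+ 2 / 8 - dot a a <= dot (framed Q a r s p) (framed Q a r s p).
Proof.
move=> QQ dQ tQ /andP[s0 s1]; rewrite /framed.
have y1 := dot_sphere_point p.1 p.2; set y := sphere_point _ _ in y1 *.
have lb := rotation_dot_lb QQ dQ tQ y1.
have nQ : dot (y *m Q) (y *m Q) = 1.
  by rewrite dot_mx trmx_mul mulmxA -(mulmxA y) QQ mulmx1 -dot_mx.
set z := _ *: y + _.
have z4 : 1 / 4 <= dot z z.
  have -> : dot z z = (1 - s) ^+ 2 * dot y y + s ^+ 2 * dot (y *m Q) (y *m Q) +
     2 * s * (1 - s) * dot y (y *m Q).
    by rewrite /z dot_lin; ring.
  rewrite y1 nQ; move: (dot y (y *m Q)) lb => q lb; clear - s0 s1 lb.
  have : 0 <= s * (1 - s) by rewrite mulr_ge0 // subr_ge0.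
  have := sqr_ge0 (1 - 2 * s); nra.
have half (u v : V) : dot u u / 2 - dot v v <= dot (u + v) (u + v).
  rewrite -subr_ge0.
  have -> : dot (u + v) (u + v) - (dot u u / 2 - dot v v) = dot (u + 2 *: v) (u + 2 *: v) / 2.
    have e1 := dot_lin 1 1 u v; have e2 := dot_lin 1 2 u v; rewrite !scale1r in e1 e2.
    by rewrite e1 e2; field.
  by rewrite divr_ge0 ?dot_ge0.
apply: le_trans (half _ _).
have -> : dot (r *: z) (r *: z) = r ^+ 2 * dot z z.
  by rewrite dotZr dotC dotZr; ring.
have -> : dot (s *: a) (s *: a) = s ^+ 2 * dot a a.
  by rewrite dotZr dotC dotZr; ring.
have a0 := dot_ge0 a; have r20 := sqr_ge0 r.
move: (dot a a) (dot z z) (r ^+ 2) a0 z4 r20 => A Z r2 A0 Z4 R0; clear - s0 s1 A0 Z4 R0.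
have h1 : s ^+ 2 * A <= A.
  by rewrite ler_piMl // expr_le1.
have h2 : r2 * (1 / 4) <= r2 * Z by rewrite ler_wpM2l.
by lra.
Qed.

Variable c : configuration R.
Hypothesis hc : smooth_configuration c.

(** The degree is known in the standard chart about the origin, while the half-turns have their
    simple form in the chart moved by (Q, a). *)
Lemma framed_winding (Q : 'M[R]_3) (a : V) (r r0 D : R) :
  Q *m Q^T = 1%:M -> \det Q = 1 -> 0 <= \tr Q -> 0 < r0 ->
  (forall x, r0 <= enorm x -> 0 < qdot (qhiggs c x) (qhiggs c x)) ->
  r0 ^+ 2 <= r ^+ 2 / 8 - dot a a ->
  has_winding (higgs_sphere c r) D ->
  has_winding (fun p => qnormalize (qhiggs c (r *: (sphere_point p.1 p.2 *m Q) + a))) D.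
Proof.
move=> QQ dQ tQ r00 far hr hD.
pose X (x : R * (R * R)) := framed Q a r x.1 x.2.
pose F x := qnormalize (qhiggs c (X x)).
have pos s p : 0 <= s <= 1 -> 0 < qdot (qhiggs c (X (s, p))) (qhiggs c (X (s, p))).
  move=> hs; apply: far; have -> : r0 = Num.sqrt (r0 ^+ 2).
    by rewrite sqrtr_sqr gtr0_norm.
  rewrite enorm_dot; apply: ler_wsqrtr.
  by apply: le_trans hr _; exact: framed_far.
have cX x : rcts X x.
  have cS : rcts (fun x : R * (R * R) => sphere_point x.2.1 x.2.2) x.
    have := @rcts_sphere_point R _ (fun=> 1) (fun x : R * (R * R) => x.2.1) (fun x => x.2.2) x.
    have -> : (fun y : R * (R * R) => 1 *: sphere_point y.2.1 y.2.2) =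
      (fun y => sphere_point y.2.1 y.2.2) by apply/funext => y; rewrite scale1r.
    by apply; cts.
  have cc i : rcts (fun x : R * (R * R) => sphere_point x.2.1 x.2.2 0 i) x.
    by apply: (@continuous_comp _ _ _ _ (fun v : V => v 0 i) _ cS); exact: rcts_coord.
  pose coord i (x : R * (R * R)) := r * ((1 - x.1) * sphere_point x.2.1 x.2.2 0 i +
    x.1 * \sum_j sphere_point x.2.1 x.2.2 0 j * Q j i) + x.1 * a 0 i.
  have ccoord i : rcts (coord i) x.
    apply: rctsD; last by cts.
    apply: rctsM; first exact: rcts_cst.
    apply: rctsD; apply: rctsM => //; try by cts.
    by apply: rcts_sum => j; apply: rctsM => //; exact: rcts_cst.
  have -> : X = fun x => row3 (coord o0 x) (coord o1 x) (coord o2 x).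
    by apply/funext => y; apply: row3P; rewrite ?row3_0 ?row3_1 ?row3_2; exact: frame_coord.
  exact: rcts_row3.
have [||||D' [D0 D1]] := @winding_homotopy R F.
- move=> s p hs _; split.
  + apply: qcts_normalize; first exact: pos.
    by apply: (@qcts_comp _ _ _ (qhiggs c) X) => //; exact: qhiggs_cts.
  + by apply: qunit_normalize; exact: pos.
  + by apply: qnormalize_imag; have [_] := higgs_quat hc (X (s, p)).
- by move=> s u; rewrite /F /X /framed /= sphere_point0.
- by move=> s u; rewrite /F /X /framed /= sphere_point_pi.
- by move=> s t u; rewrite /F /X /framed /= sphere_point_per.
have e0 : (fun p => F (0, p)) = higgs_sphere c r.
  apply/funext => p; rewrite /F /X /framed /higgs_sphere /=.
  by rewrite subr0 scale1r !scale0r !addr0.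
have e1 : (fun p => F (1, p)) = fun p => qnormalize (qhiggs c (r *: (sphere_point p.1 p.2 *m Q) + a)).
  by apply/funext => p; rewrite /F /X /framed /= subrr scale0r add0r !scale1r.
rewrite -e1; rewrite e0 in D0.
suff -> : D = D' by [].
apply: (@winding_unique R _ _ _ _ hD D0) => u.
by rewrite /higgs_sphere /= sphere_point_pi.
Qed.

(** For use along an axis, from the centre s = 0 to the sphere s = 1: unit quaternions with square 1
    are signs, and a continuous sign is constant. *)
Lemma axis_one (G : R -> quat) :
  (forall s : R, 0 <= s <= 1 -> [/\ qcts G s, qunit (G s) & G s * G s = 1]) ->
  G 0 = 1 -> G 1 = 1.
Proof.
move=> h h0.
have sg (s : R) : 0 <= s <= 1 -> is_sign (G s).
  by move=> /h[_ u e]; exact: sqr1_sign.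
have e : qre (G 1) = qre (G 0).
  apply: (@sign_const R (fun s => qre (G s))) => s hs; first by have [[]] := h s hs.
  by case: (sg s hs) => ->; [left|right].
have o01 : 0 <= (1 : R) <= 1 by rewrite lexx ler01.
by case: (sg 1 o01) => // E; exfalso; move: e; rewrite E h0 !qE /=; lra.
Qed.

Lemma smooth_cst (r : R) : smooth (fun _ : V => r).
Proof.
move=> s; have [k ->] : exists k : R, foldr (@partial R) (fun _ : V => r) s = (fun _ : V => k).
  elim: s => [|i s [k /= ->]]; first by exists r.
  exists 0; apply/funext => x; rewrite /partial; exact: derive_cst.
split; first exact: cst_continuous.
by move=> x i; exact: derivable_cst.
Qed.

(** Invariance speaks of the members of a gauge class; this makes [c] one of them. *)
Lemma gauge_equivalent_refl : gauge_equivalent c c.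
Proof.
exists (fun=> 1%:M); split.
- by move=> i j; split; exact: smooth_cst.
- move=> x; split; last exact: det1.
  by apply/unitarymxP; rewrite trmx1 map_mx1 mulmx1.
- have d0 i x : mx_partial i (fun _ : V => 1%:M) x = 0 :> 'M[R[i]%C]_2.
    by apply/matrixP => k l; rewrite !mxE /partial !derive_cst.
  case: c => A P; rewrite /gauge_transform /=; congr Configuration.
    apply/funext => i; apply/funext => x.
    by rewrite d0 mul0mx subr0 invmx1 mul1mx mulmx1.
  by apply/funext => x; rewrite invmx1 mul1mx mulmx1.
Qed.

End Framing.

(** * Charge six *)

Section ChargeSix.
Variable R : realType.
Local Notation quat := (quat R).
Local Notation V := 'rV[R]_3.

Lemma qexp_pi : qexp pi = - 1 :> quat.
Proof. by apply: quatP; split; rewrite !qE /= ?cospi ?sinpi ?oppr0. Qed.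

Lemma qexp_2pi : qexp (pi + pi) = 1 :> quat.
Proof. by rewrite (qexpD pi pi) qexp_pi mulrNN mulr1. Qed.

Lemma qexp_6pi : qexp (pi * 6) = 1 :> quat.
Proof.
rewrite (_ : pi * 6 = pi + pi + (pi + pi) + (pi + pi)); last by ring.
by rewrite (qexpD (_ + _ + _) (pi + pi)) (qexpD (pi + pi)) qexp_2pi !mulr1.
Qed.

Lemma qexp_3pi : qexp (pi * 6 / 2) = - 1 :> quat.
Proof.
rewrite (_ : pi * 6 / 2 = pi + pi + pi); last by field.
by rewrite (qexpD (pi + pi) pi) qexp_2pi mul1r qexp_pi.
Qed.

Lemma sphere_point_turn_z (t u : R) : sphere_point t u *m turn_z R = sphere_point t (u + pi).
Proof.
by rewrite mul_turn_z /sphere_point ?row3_0 ?row3_1 ?row3_2 sinDpi cosDpi !mulrN.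
Qed.

Lemma sphere_point_turn_x (t u : R) : sphere_point t u *m turn_x R = sphere_point (pi - t) (- u).
Proof.
rewrite mul_turn_x /sphere_point ?row3_0 ?row3_1 ?row3_2 sinN cosN.
have -> : sin (pi - t) = sin t by rewrite addrC sinDpi sinN opprK.
have -> : cos (pi - t) = - cos t by rewrite addrC cosDpi cosN.
by rewrite mulrN.
Qed.

Lemma qnormalize_conj (p p' g : quat) : qunit g -> p' * g = g * p ->
  qnormalize p' * g = g * qnormalize p.
Proof.
move=> u e; rewrite /qnormalize.
have -> : qdot p' p' = qdot p p.
  have : qdot (p' * g) (p' * g) = qdot (g * p) (g * p) by rewrite e.
  by rewrite !qdotM u mulr1 mul1r.
by rewrite -mulrA e mulrA qRC mulrA.
Qed.

Lemma no_klein_symmetry (c : configuration R) (Q : 'M[R]_3) (a : V) :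
  monopole_solution 6 c ->
  Q *m Q^T = 1%:M -> \det Q = 1 -> 0 <= \tr Q ->
  gauge_equivalent c (pullback (frame_motion Q a (turn_z R)) c) ->
  gauge_equivalent c (pullback (frame_motion Q a (turn_x R)) c) ->
  gauge_equivalent c (pullback (frame_motion Q a (cycle_axes R)) c) -> False.
Proof.
move=> [hc _ _ bc [M [Mreal hdeg]]] QQ dQ tQ Ez Ex Ec.
have [r0 r00 far] := higgs_nonzero_far hc bc.
(* Beyond M the degree is 6, beyond r0 the Higgs field does not vanish, and the last bound keeps the
   moved sphere and the homotopy to it beyond r0. *)
pose r := 1 + Num.max `|M| (Num.max r0 (8 * (r0 ^+ 2 + dot a a) + 1)).
have rM : M < r.
  have : `|M| <= r - 1 by rewrite /r [1 + _]addrC addrK le_max lexx.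
  by have := ler_norm M; lra.
have rr0 : r0 <= r.
  have : r0 <= r - 1 by rewrite /r [1 + _]addrC addrK !le_max lexx orbT.
  by lra.
have r_pos : 0 < r by rewrite (lt_le_trans r00).
have rfar : r0 ^+ 2 <= r ^+ 2 / 8 - dot a a.
  have : 8 * (r0 ^+ 2 + dot a a) + 1 <= r - 1.
    by rewrite /r [1 + _]addrC addrK !le_max lexx !orbT.
  have h0 : 0 <= r0 ^+ 2 + dot a a by rewrite addr_ge0 ?sqr_ge0 ?dot_ge0.
  move: h0 r_pos; move: (r) (r0 ^+ 2) (dot a a) => x y z h0 h1 h2; clear - h0 h1 h2; nra.
have pos t u : 0 < qdot (qhiggs c (r *: sphere_point t u)) (qhiggs c (r *: sphere_point t u)).
  by apply: far; rewrite enorm_sphere // ltW.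
have [D hD ED] := higgs_sphere_degree hc pos.
have D6 : D = 6 by rewrite -ED hdeg.
have D0 : D != 0 by rewrite D6 pnatr_eq0.
have unique q g1 g2 := @intertwiner_unique R c hc r D q g1 g2 r_pos pos hD D0.
have [gz iz] := gauge_intertwiner hc Ez.
have [gx ix] := gauge_intertwiner hc Ex.
have [gc ic] := gauge_intertwiner hc Ec.
have [e [ga [gb [se ia ib [aa bb ab] base]]]] := klein_cocycle QQ unique iz ix ic.
have [ua ca pa _] := ia; have [ub cb pb _] := ib.
have hn := framed_winding hc QQ dQ tQ r00 far rfar hD.
rewrite D6 in hn.
(* For fixed p, this runs along a ray from the centre a to the moved sphere at s = 1. *)
pose X (s : R) (p : R * R) : V := (s * r) *: (sphere_point p.1 p.2 *m Q) + a.
have Xz s t u : motion (frame_motion Q a (turn_z R)) (X s (t, u)) = X s (t, u + pi).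
  by rewrite /X scalemxAl (frame_motionE a QQ) -!scalemxAl sphere_point_turn_z.
have Xx s t u : motion (frame_motion Q a (turn_x R)) (X s (t, u)) = X s (pi - t, - u).
  by rewrite /X scalemxAl (frame_motionE a QQ) -!scalemxAl sphere_point_turn_x.
have X1 p : X 1 p = r *: (sphere_point p.1 p.2 *m Q) + a by rewrite /X mul1r.
have cX (T : topologicalType) (s : T -> R) (p : T -> R * R) x :
    rcts s x -> rcts p x -> rcts (fun x => X (s x) (p x)) x.
  move=> hs hp.
  have cs := @rcts_sphere_point R T (fun x => s x * r) (fun x => (p x).1) (fun x => (p x).2) x.
  have c1 : rcts (fun x => s x * r) x by apply: rctsM => //; exact: rcts_cst.
  have {}cs := cs c1 (cts_fst hp) (cts_snd hp).
  have ci i : rcts (fun x => ((s x * r) *: sphere_point (p x).1 (p x).2) 0 i) x.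
    by apply: (@continuous_comp _ _ _ _ (fun v : V => v 0 i) _ cs); exact: rcts_coord.
  pose S (y : T) : V := (s y * r) *: sphere_point (p y).1 (p y).2.
  have coord (w : V) i : (w *m Q + a) 0 i = \sum_j w 0 j * Q j i + a 0 i by rewrite !mxE.
  have -> : (fun x => X (s x) (p x)) = fun y =>
      row3 (\sum_j S y 0 j * Q j o0 + a 0 o0) (\sum_j S y 0 j * Q j o1 + a 0 o1)
           (\sum_j S y 0 j * Q j o2 + a 0 o2).
    apply/funext => y; rewrite /X scalemxAl -/(S y).
    by apply: row3P; rewrite ?row3_0 ?row3_1 ?row3_2 coord.
  apply: rcts_row3; apply: rctsD; try exact: rcts_cst; apply: rcts_sum => j;
    apply: rctsM; try exact: rcts_cst; exact: ci.
have per s t u : X s (t, u + 2 * pi) = X s (t, u) by rewrite /X /= sphere_point_per.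
have pole s u : X s (0, u) = X s (0, 0) by rewrite /X /= sphere_point0.
have X0 p : X 0 p = a by rewrite /X mul0r scale0r add0r.
apply: (@klein_winding R (fun p => qnormalize (qhiggs c (X 1 p))) (fun p => ga (X 1 p))
   (fun p => gb (X 1 p)) e 6 _ (qexp_6pi) (qexp_3pi) se).
- have -> // : (fun p => qnormalize (qhiggs c (X 1 p))) =
    fun p => qnormalize (qhiggs c (r *: (sphere_point p.1 p.2 *m Q) + a)).
  by apply/funext => p; rewrite X1.
- move=> p; split => //; apply: (@qcts_comp _ _ _ ga (fun p => X 1 p)) => //.
  by apply: cX; cts.
- move=> p; split => //; apply: (@qcts_comp _ _ _ gb (fun p => X 1 p)) => //.
  by apply: cX; cts.
- by move=> u; rewrite pole.
- by move=> u; rewrite pole.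
- by move=> t u; rewrite per.
- by move=> t u; rewrite per.
- by move=> t u; apply: qnormalize_conj => //; rewrite -Xz pa.
- by move=> t u; apply: qnormalize_conj => //; rewrite -Xx pb.
- by move=> t u; rewrite -Xz aa.
- by move=> t u; rewrite -Xx bb.
- by move=> t u; rewrite -Xx -Xz ab.
(* The chart points (0, 0), (pi / 2, 0) and (pi / 2, pi / 2) lie on the axes of the two half-turns
   and of their product, and on each of these rays the corresponding lift squares to 1. *)
move=> e1; have [a1 b1] := base e1; split.
- apply: (@axis_one R (fun s => ga (X s (0, 0)))); last by rewrite X0.
  move=> s _; split => //.
    by apply: (@qcts_comp _ _ _ ga (fun s => X s (0, 0))) => //; apply: cX; cts.
  by have := aa (X s (0, 0)); rewrite Xz pole e1.
- apply: (@axis_one R (fun s => gb (X s (pi / 2, 0)))); last by rewrite X0.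
  move=> s _; split => //.
    by apply: (@qcts_comp _ _ _ gb (fun s => X s (pi / 2, 0))) => //; apply: cX; cts.
  have := bb (X s (pi / 2, 0)); rewrite Xx oppr0 e1.
  by rewrite (_ : pi - pi / 2 = pi / 2) //; field.
- have hpi : pi - pi / 2 = pi / 2 :> R by field.
  have hpi' : - (pi / 2) + pi = pi / 2 :> R by field.
  pose h s := ga (X s (pi / 2, - (pi / 2))) * gb (X s (pi / 2, pi / 2)).
  apply: (@axis_one R h); last by rewrite /h !X0 a1 b1 mulr1.
  move=> s _.
  have Zx : motion (frame_motion Q a (turn_x R)) (X s (pi / 2, pi / 2)) =
      X s (pi / 2, - (pi / 2)) by rewrite Xx hpi.
  have Zz : motion (frame_motion Q a (turn_z R)) (X s (pi / 2, - (pi / 2))) =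
      X s (pi / 2, pi / 2) by rewrite Xz hpi'.
  have Zx' : motion (frame_motion Q a (turn_x R)) (X s (pi / 2, - (pi / 2))) =
      X s (pi / 2, pi / 2) by rewrite Xx hpi opprK.
  have Zz' : motion (frame_motion Q a (turn_z R)) (X s (pi / 2, pi / 2)) =
      X s (pi / 2, - (pi / 2)).
    by rewrite Xz -[RHS]per; congr (X s (_, _)); field.
  split.
  + apply: qctsM.
      by apply: (@qcts_comp _ _ _ ga (fun s => X s (pi / 2, - (pi / 2)))) => //; apply: cX; cts.
    by apply: (@qcts_comp _ _ _ gb (fun s => X s (pi / 2, pi / 2))) => //; apply: cX; cts.
  + exact: qunitM.
  (* Replacing ga gb by gb ga in one factor of the square makes first the inner pair and then the
     outer pair cancel. *)
  + have A := aa (X s (pi / 2, pi / 2)); rewrite Zz' e1 in A.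
    have B := bb (X s (pi / 2, - (pi / 2))); rewrite Zx' e1 in B.
    have AB := ab (X s (pi / 2, pi / 2)); rewrite Zx Zz' e1 mul1r in AB.
    rewrite /h {2}AB -!mulrA (mulrA (gb _) (gb _)).
    by rewrite B mul1r A.
Qed.

End ChargeSix.

Theorem theorem3 (R : realType) (V : set 'rV[R]_3)
    (hV : regular_icosahedron V) :
  ~ exists m : set (configuration R),
      monopole 6 m /\ invariant_under (rotational_symmetries V) m.
Proof.
move=> [m [[_ [c sol ->]] inv]].
have [Q [a [QQ dQ tQ [sz sx sc]]]] := icosahedron_frame hV.
have cc := gauge_equivalent_refl c.
exact: (no_klein_symmetry sol QQ dQ tQ (inv _ _ sz cc) (inv _ _ sx cc) (inv _ _ sc cc)).
Qed.
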